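(* For any $\Delta>0$ and $w,z\in\mathbb{C}$, \[ K_{\mathrm{O},\pi\Delta}(w,z) = \frac{\sin\pi\Delta(z-\overline{w})}{\pi(z-\overline{w})} - \frac{1}{2 + \Delta} \left(\frac{\sin\pi\Delta z}{\pi z}\right) \left( \frac{\sin\pi\Delta \overline{w} }{\pi \overline{w}}\right). \]
   Context: $W_{\mathrm O}(x)=1+\frac12\boldsymbol{\delta}_0(x)$, with $\boldsymbol{\delta}_0$ the Dirac delta at $0$. For $\Delta>0$, $\mathcal{H}_{\mathrm O,\pi\Delta}$ is the Hilbert space of entire functions $F$ of exponential type at most $\pi\Delta$ with $\int_{\mathbb{R}}|F(x)|^2dx+\frac12|F(0)|^2<\infty$, with inner product $\langle F,H\rangle=\int_{\mathbb{R}}F(x)\overline{H(x)}\,dx+\frac12F(0)\overline{H(0)}$. Its reproducing kernel $K_{\mathrm O,\pi\Delta}$ is the unique function on $\mathbb{C}\times\mathbb{C}$ such that for each $w$, $K_{\mathrm O,\pi\Delta}(w,\cdot)\in\mathcal{H}_{\mathrm O,\pi\Delta}$ and $F(w)=\langle F,K_{\mathrm O,\pi\Delta}(w,\cdot)\rangle$ for all $F$ in the space. Expressions like $\frac{\sin \pi\Delta z}{\pi z}$ are interpreted by continuity ($=\Delta$) at $z=0$. *)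

(* Defs.v *)
From Stdlib Require Export Reals ClassicalEpsilon.
From Coquelicot Require Export Coquelicot.

Open Scope R_scope.

Definition csin (z : C) : C :=
  (sin (Re z) * cosh (Im z), cos (Re z) * sinh (Im z)).

(* sin(pi Delta z)/(pi z), extended by continuity (value Delta) at z = 0. *)
Definition sincD (Delta : R) (z : C) : C :=
  if excluded_middle_informative (z = 0%C) then RtoC Delta
  else (csin (RtoC (PI * Delta) * z) / (RtoC PI * z))%C.

Definition entire (F : C -> C) : Prop := forall z : C, ex_derive F z.

Definition exp_type_le (F : C -> C) (tau : R) : Prop :=
  forall eps : R, 0 < eps ->
    exists M : R, forall z : C, Cmod (F z) <= M * exp ((tau + eps) * Cmod z).

Definition int_R (f : R -> R) : R :=
  RInt_gen f (Rbar_locally m_infty) (Rbar_locally p_infty).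

(* Membership in H_{O, pi Delta}: entire, exponential type <= pi Delta,
   int |F|^2 + 1/2 |F(0)|^2 < oo (the point term is always finite). *)
Definition in_HO (Delta : R) (F : C -> C) : Prop :=
  entire F /\ exp_type_le F (PI * Delta) /\
  ex_RInt_gen (fun x : R => Cmod (F (RtoC x)) ^ 2)
              (Rbar_locally m_infty) (Rbar_locally p_infty).

Definition inner_O (F H : C -> C) : C :=
  ((int_R (fun x => Re (F (RtoC x) * Cconj (H (RtoC x)))%C),
    int_R (fun x => Im (F (RtoC x) * Cconj (H (RtoC x)))%C)) +
   RtoC (/ 2) * F 0%C * Cconj (H 0%C))%C.

Definition is_repr_kernel_O (Delta : R) (K : C -> C -> C) : Prop :=
  forall w : C, in_HO Delta (K w) /\
    forall F : C -> C, in_HO Delta F -> F w = inner_O F (K w).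

Definition KO_formula (Delta : R) (w z : C) : C :=
  (sincD Delta (z - Cconj w) -
   RtoC (/ (2 + Delta)) * sincD Delta z * sincD Delta (Cconj w))%C.

(* Main.v *)
From Stdlib Require Import Lra Lia.
Require Import Defs.

(* Write tau = pi Delta and S(z) = sin(tau z) / (pi z). Everything reduces to the Paley-Wiener identity
   F(w) = int F(x) S(x - w) dx: the point mass only perturbs the kernel by a rank-one term.

   Given F and w, the function Q(z) = (F(z) - F(w) S(z - w) / Delta) / (z - w) is entire of exponential
   type tau and integrable on the line. For tau' > tau, the contour of int Q(x) exp(i tau' x) dx can be
   rotated: the right half-line to the ray through 1 + ik, the left half-line to the ray through -1 + ik,
   with k so large that the integrand decays exponentially between these rays; hence the integral is 0.
   The rotation is justified by the entire regularizer exp(-eps (1 - ik) z^2), which is bounded on both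
   edges of the sector (opening less than pi/2) and has Gaussian decay inside. Dominated convergence gives
   the same for tau' = tau, and the lower half-plane follows by symmetry, so that
   int Q(x) sin(tau (x - w)) dx = 0, that is, int F(x) S(x - w) dx = F(w) / Delta * int S(x - w)^2 dx.
   The last integral equals Delta by integration over a large semicircle.

   Holomorphy of difference quotients at the removable point is never needed: primitives exist for
   continuous functions that are differentiable off one point. *)

(** Elements of the space are only square integrable on the line, so [F(x) exp(i tau x)] need not
    have absolutely small tails, and no pointwise decay of [F] is at hand to close a contour.
    Dividing by [x - w] gains the missing factor: the product of [F] with a function of size [1/|x|]
    is integrable near infinity. Subtracting [F(w) S(z - w) / Delta] is what permits the division,
    since [S(0) = Delta] makes the numerator vanish at [w].

    Inside the sector only a growth bound [exp(A |z|)] is known, so the far side of the contour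
    cannot be estimated for the function itself. The Gaussian factor serves that side alone and is
    removed by letting [eps] tend to 0 afterwards.

    Uniqueness is a matter of symmetry: each of two reproducing kernels is applied to the other.

    [int_R] has a value even on divergent integrals, so convergence is established for every inner
    product that is evaluated. *)

(** * Derivatives and continuity in the complex plane *)

(** The remainder form with explicit [Cmod] bounds mentions no uniform structure, so it can mediate
    between the several structures that [C] carries. *)
Definition has_cderiv (f : C -> C) (z l : C) : Prop :=
  forall eps : R, 0 < eps -> exists d : R, 0 < d /\
    forall u : C, Cmod (u - z) < d ->
      Cmod (f u - f z - l * (u - z)) <= eps * Cmod (u - z).

Definition ccont (f : C -> C) (z : C) : Prop :=
  forall eps : R, 0 < eps -> exists d : R, 0 < d /\
    forall u : C, Cmod (u - z) < d -> Cmod (f u - f z) < eps.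

Definition rcont (f : R -> C) (t : R) : Prop :=
  forall eps : R, 0 < eps -> exists d : R, 0 < d /\
    forall s : R, Rabs (s - t) < d -> Cmod (f s - f t) < eps.

Definition has_rderiv (f : R -> C) (t : R) (l : C) : Prop :=
  forall eps : R, 0 < eps -> exists d : R, 0 < d /\
    forall s : R, Rabs (s - t) < d ->
      Cmod (f s - f t - l * RtoC (s - t)) <= eps * Rabs (s - t).

Definition CI (f : R -> C) (a b : R) : C := @RInt C_R_CompleteNormedModule f a b.

Lemma Cmod_sub_sym (a b : C) : Cmod (a - b) = Cmod (b - a).
Proof. rewrite <- Cmod_opp. f_equal. ring. Qed.

Lemma Cmod_sub_le (a b : C) : Cmod (a - b) <= Cmod a + Cmod b.
Proof.
  unfold Cminus. eapply Rle_trans; [apply Cmod_triangle|]. rewrite Cmod_opp. lra.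
Qed.

Lemma Cmod_sub_ge (a b : C) : Cmod a - Cmod b <= Cmod (a - b).
Proof.
  assert (H := Cmod_triangle (a - b) b). replace (a - b + b)%C with a in H by ring. lra.
Qed.

Lemma Cmod_le_Re_Im (z : C) : Cmod z <= Rabs (Re z) + Rabs (Im z).
Proof.
  destruct z as [x y]; simpl.
  replace (x, y) with (RtoC x + Ci * RtoC y)%C
    by (unfold RtoC, Ci, Cplus, Cmult; simpl; f_equal; ring).
  eapply Rle_trans; [apply Cmod_triangle|]. rewrite Cmod_mult, Cmod_Ci, !Cmod_R. lra.
Qed.

Lemma im_le_Cmod (z : C) : Rabs (Im z) <= Cmod z.
Proof. eapply Rle_trans; [apply Rmax_r|apply Rmax_Cmod]. Qed.

(* [C] is a normed module over itself in two ways, with different uniform structures; [entire] uses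
   [C_NormedModule], while the product and chain rules need [AbsRing_NormedModule C_AbsRing]. *)
Lemma has_cderiv_is_derive (f : C -> C) (z l : C) :
  has_cderiv f z l <-> @is_derive C_AbsRing C_NormedModule f z l.
Proof.
  split.
  - intros H. split; [apply is_linear_scal_l|].
    intros x Hx.
    assert (E : z = x) by (apply (is_filter_lim_locally_unique (V := AbsRing_NormedModule C_AbsRing) z x Hx)).
    subst x. intros eps. destruct (H eps (cond_pos eps)) as [d [Hd H']].
    exists (mkposreal d Hd). intros u Hu.
    specialize (H' u Hu). change (Cmod (f u - f z - (u - z) * l) <= eps * Cmod (u - z)).
    rewrite (Cmult_comm (u - z) l). exact H'.
  - intros [_ H] eps He.
    assert (Hz : is_filter_lim (locally (T := AbsRing_UniformSpace C_AbsRing) z) z) by (intros P HP; exact HP).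
    destruct (H z Hz (mkposreal eps He)) as [d H'].
    exists d. split; [apply cond_pos|]. intros u Hu.
    specialize (H' u Hu). change (Cmod (f u - f z - (u - z) * l) <= eps * Cmod (u - z)) in H'.
    rewrite (Cmult_comm l (u - z)). exact H'.
Qed.

Lemma has_cderiv_is_derive_AbsRing (f : C -> C) (z l : C) :
  has_cderiv f z l <-> @is_derive C_AbsRing (AbsRing_NormedModule C_AbsRing) f z l.
Proof.
  split.
  - intros H. split; [apply is_linear_scal_l|].
    intros x Hx.
    assert (E : z = x) by (apply (is_filter_lim_locally_unique (V := AbsRing_NormedModule C_AbsRing) z x Hx)).
    subst x. intros eps. destruct (H eps (cond_pos eps)) as [d [Hd H']].
    exists (mkposreal d Hd). intros u Hu.
    specialize (H' u Hu). change (Cmod (f u - f z - (u - z) * l) <= eps * Cmod (u - z)).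
    rewrite (Cmult_comm (u - z) l). exact H'.
  - intros [_ H] eps He.
    assert (Hz : is_filter_lim (locally (T := AbsRing_UniformSpace C_AbsRing) z) z) by (intros P HP; exact HP).
    destruct (H z Hz (mkposreal eps He)) as [d H'].
    exists d. split; [apply cond_pos|]. intros u Hu.
    specialize (H' u Hu). change (Cmod (f u - f z - (u - z) * l) <= eps * Cmod (u - z)) in H'.
    rewrite (Cmult_comm l (u - z)). exact H'.
Qed.

Lemma ccont_continuous (f : C -> C) (z : C) :
  ccont f z <-> @continuous (AbsRing_UniformSpace C_AbsRing) (AbsRing_UniformSpace C_AbsRing) f z.
Proof.
  split.
  - intros H P [eps HP]. destruct (H eps (cond_pos eps)) as [d [Hd H']].
    exists (mkposreal d Hd). intros u Hu. apply HP. exact (H' u Hu).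
  - intros H eps He.
    destruct (H (fun y => Cmod (y - f z) < eps)) as [d H'].
    { exists (mkposreal eps He). intros y Hy. exact Hy. }
    exists d. split; [apply cond_pos|]. intros u Hu. exact (H' u Hu).
Qed.

Lemma has_cderiv_ext (f g : C -> C) (z l : C) :
  (forall u, f u = g u) -> has_cderiv f z l -> has_cderiv g z l.
Proof.
  intros E H eps He. destruct (H eps He) as [d [Hd H']]. exists d; split; [exact Hd|].
  intros u Hu. rewrite <- !E. exact (H' u Hu).
Qed.

Lemma has_cderiv_ext_loc (f g : C -> C) (z l : C) (r : R) : 0 < r ->
  (forall u, Cmod (u - z) < r -> f u = g u) -> has_cderiv f z l -> has_cderiv g z l.
Proof.
  intros Hr E H eps He. destruct (H eps He) as [d [Hd H']]. exists (Rmin d r); split; [apply Rmin_pos; lra|].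
  intros u Hu. rewrite <- (E u), <- (E z).
  - apply H'. eapply Rlt_le_trans; [exact Hu|apply Rmin_l].
  - replace (z - z)%C with (RtoC 0) by ring. rewrite Cmod_0. exact Hr.
  - eapply Rlt_le_trans; [exact Hu|apply Rmin_r].
Qed.

Lemma has_cderiv_const (c z : C) : has_cderiv (fun _ => c) z 0.
Proof.
  intros eps He. exists 1; split; [lra|]. intros u _.
  replace (c - c - 0 * (u - z))%C with (RtoC 0) by ring. rewrite Cmod_0.
  apply Rmult_le_pos; [lra|apply Cmod_ge_0].
Qed.

Lemma has_cderiv_id (z : C) : has_cderiv (fun u => u) z 1.
Proof.
  intros eps He. exists 1; split; [lra|]. intros u _.
  replace (u - z - 1 * (u - z))%C with (RtoC 0) by ring. rewrite Cmod_0.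
  apply Rmult_le_pos; [lra|apply Cmod_ge_0].
Qed.

Lemma has_cderiv_plus (f g : C -> C) (z a b : C) :
  has_cderiv f z a -> has_cderiv g z b -> has_cderiv (fun u => f u + g u)%C z (a + b).
Proof. rewrite !has_cderiv_is_derive_AbsRing. exact (is_derive_plus (V := AbsRing_NormedModule C_AbsRing) f g z a b). Qed.

Lemma has_cderiv_mult (f g : C -> C) (z a b : C) :
  has_cderiv f z a -> has_cderiv g z b ->
  has_cderiv (fun u => f u * g u)%C z (a * g z + f z * b).
Proof.
  rewrite !has_cderiv_is_derive_AbsRing. intros H1 H2.
  exact (is_derive_mult (K := C_AbsRing) f g z a b H1 H2 Cmult_comm).
Qed.

Lemma has_cderiv_comp (f g : C -> C) (z a b : C) :
  has_cderiv f (g z) a -> has_cderiv g z b -> has_cderiv (fun u => f (g u)) z (b * a).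
Proof.
  rewrite !has_cderiv_is_derive_AbsRing. intros H1 H2.
  exact (is_derive_comp (V := AbsRing_NormedModule C_AbsRing) f g z a b H1 H2).
Qed.

Lemma has_cderiv_eq (f : C -> C) (z a b : C) : has_cderiv f z a -> a = b -> has_cderiv f z b.
Proof. intros H <-. exact H. Qed.

Lemma has_cderiv_scal (c : C) (f : C -> C) (z a : C) :
  has_cderiv f z a -> has_cderiv (fun u => c * f u)%C z (c * a).
Proof.
  intros H. eapply has_cderiv_eq; [apply (has_cderiv_mult (fun _ => c) f z 0 a (has_cderiv_const c z) H)|].
  ring.
Qed.

Lemma has_cderiv_minus (f g : C -> C) (z a b : C) :
  has_cderiv f z a -> has_cderiv g z b -> has_cderiv (fun u => f u - g u)%C z (a - b).
Proof.
  intros H1 H2. apply has_cderiv_ext with (f := fun u => (f u + (- (1)) * g u)%C).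
  { intros u; ring. }
  eapply has_cderiv_eq; [apply has_cderiv_plus; [exact H1|apply has_cderiv_scal; exact H2]|]. ring.
Qed.

Lemma has_cderiv_ccont (f : C -> C) (z l : C) : has_cderiv f z l -> ccont f z.
Proof.
  intros H. apply ccont_continuous.
  apply (ex_derive_continuous (K := C_AbsRing) (V := AbsRing_NormedModule C_AbsRing) f z).
  exists l. apply has_cderiv_is_derive_AbsRing. exact H.
Qed.

Lemma has_cderiv_inv (z : C) : z <> 0%C -> has_cderiv Cinv z (- / (z * z)).
Proof.
  intros Hz eps He. assert (Hm : 0 < Cmod z) by (apply Cmod_gt_0; exact Hz).
  set (m := Cmod z) in *.
  (* The first radius keeps [|u| >= m / 2]; the second then makes the remainder
     [(u - z)^2 / (u z^2)] at most [eps |u - z|]. *)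
  exists (Rmin (m / 2) (eps * m ^ 3 / 2)). split.
  { apply Rmin_pos; [lra|]. assert (0 < m ^ 3) by (apply pow_lt; lra). nra. }
  intros u Hu.
  assert (H1 : Cmod (u - z) < m / 2) by (eapply Rlt_le_trans; [exact Hu|apply Rmin_l]).
  assert (H2 : Cmod (u - z) < eps * m ^ 3 / 2) by (eapply Rlt_le_trans; [exact Hu|apply Rmin_r]).
  assert (Hum : m / 2 <= Cmod u).
  { assert (H := Cmod_sub_ge z u). rewrite Cmod_sub_sym in H. fold m in H. lra. }
  assert (Hu0 : u <> 0%C) by (apply Cmod_gt_0; lra).
  replace (/ u - / z - - / (z * z) * (u - z))%C with ((u - z) * (u - z) * / (u * (z * z)))%C
    by (field; split; assumption).
  rewrite !Cmod_mult, Cmod_inv, !Cmod_mult by (repeat apply Cmult_neq_0; assumption).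
  fold m. rewrite (Rmult_comm eps), Rmult_assoc.
  apply Rmult_le_compat_l; [apply Cmod_ge_0|].
  apply Rle_div_l. { apply Rmult_lt_0_compat; nra. }
  apply Rle_trans with (eps * (m / 2 * (m * m))); [nra|].
  apply Rmult_le_compat_l; [lra|]. apply Rmult_le_compat_r; nra.
Qed.

Lemma ccont_ext (f g : C -> C) (z : C) : (forall u, f u = g u) -> ccont f z -> ccont g z.
Proof.
  intros E H eps He. destruct (H eps He) as [d [Hd H']]. exists d; split; [exact Hd|].
  intros u Hu. rewrite <- !E. exact (H' u Hu).
Qed.

Lemma ccont_mult (f g : C -> C) (z : C) :
  ccont f z -> ccont g z -> ccont (fun u => f u * g u)%C z.
Proof.
  rewrite !ccont_continuous. exact (continuous_mult (U := AbsRing_UniformSpace C_AbsRing) (K := C_AbsRing) f g z).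
Qed.

Lemma ccont_plus (f g : C -> C) (z : C) :
  ccont f z -> ccont g z -> ccont (fun u => f u + g u)%C z.
Proof.
  rewrite !ccont_continuous.
  exact (continuous_plus (U := AbsRing_UniformSpace C_AbsRing) (V := AbsRing_NormedModule C_AbsRing) f g z).
Qed.

Lemma ccont_const (c z : C) : ccont (fun _ => c) z.
Proof. apply (has_cderiv_ccont _ _ _ (has_cderiv_const c z)). Qed.

Lemma ccont_id (z : C) : ccont (fun u => u) z.
Proof. apply (has_cderiv_ccont _ _ _ (has_cderiv_id z)). Qed.

Lemma ccont_comp (f g : C -> C) (z : C) :
  ccont f (g z) -> ccont g z -> ccont (fun u => f (g u)) z.
Proof.
  rewrite !ccont_continuous. intros H1 H2. exact (continuous_comp (U := AbsRing_UniformSpace C_AbsRing) (V := AbsRing_UniformSpace C_AbsRing)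
    (W := AbsRing_UniformSpace C_AbsRing) g f z H2 H1).
Qed.

Lemma ccont_minus (f g : C -> C) (z : C) :
  ccont f z -> ccont g z -> ccont (fun u => f u - g u)%C z.
Proof.
  intros H1 H2. apply ccont_ext with (f := fun u => (f u + (- (1)) * g u)%C).
  { intros u; ring. }
  apply ccont_plus; [exact H1|]. apply ccont_mult; [apply ccont_const|exact H2].
Qed.

(** * Complex-valued functions of a real variable *)

Lemma rcont_continuous (f : R -> C) (t : R) :
  rcont f t <-> @continuous R_UniformSpace C_R_NormedModule f t.
Proof.
  split.
  - intros H P [eps HP]. destruct (H eps (cond_pos eps)) as [d [Hd H']].
    exists (mkposreal d Hd). intros s Hs. apply HP.
    apply (C_NormedModule_mixin_compat1 (f t) (f s) eps). exact (H' s Hs).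
  - intros H eps He.
    assert (Hs2 : 0 < sqrt 2) by (apply sqrt_lt_R0; lra).
    (* Balls of [C_R_NormedModule] are squares; a square of half-side [r] lies in the disc of radius
       [sqrt 2 * r]. *)
    assert (He2 : 0 < eps / sqrt 2) by (apply Rdiv_lt_0_compat; lra).
    destruct (H (ball (f t) (mkposreal _ He2))) as [d H'].
    { exists (mkposreal _ He2). intros y Hy. exact Hy. }
    exists d. split; [apply cond_pos|]. intros s Hs.
    specialize (H' s Hs).
    apply (C_NormedModule_mixin_compat2 (f t) (f s) (mkposreal _ He2)) in H'. simpl in H'.
    replace (sqrt 2 * (eps / sqrt 2)) with eps in H' by (field; lra). exact H'.
Qed.

Lemma has_rderiv_is_derive (f : R -> C) (t : R) (l : C) :
  has_rderiv f t l <-> @is_derive R_AbsRing C_R_NormedModule f t l.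
Proof.
  assert (E : forall s, @minus C_R_NormedModule (minus (f s) (f t)) (scal (minus s t) l)
                        = (f s - f t - l * RtoC (s - t))%C).
  { intros s. rewrite scal_R_Cmult, (Cmult_comm _ l). reflexivity. }
  split.
  - intros H. split; [apply is_linear_scal_l|].
    intros x Hx.
    assert (Ex : t = x) by (apply (is_filter_lim_locally_unique (V := R_NormedModule) t x Hx)).
    subst x. intros eps. destruct (H eps (cond_pos eps)) as [d [Hd H']].
    exists (mkposreal d Hd). intros s Hs. specialize (H' s Hs).
    rewrite <- E, Cmod_norm in H'. exact H'.
  - intros [_ H] eps He.
    assert (Hz : is_filter_lim (locally (T := R_UniformSpace) t) t) by (intros P HP; exact HP).
    destruct (H t Hz (mkposreal eps He)) as [d H'].
    exists d. split; [apply cond_pos|]. intros s Hs. specialize (H' s Hs).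
    rewrite <- E, Cmod_norm. exact H'.
Qed.

Lemma has_rderiv_pair (f g : R -> R) (t a b : R) :
  is_derive f t a -> is_derive g t b -> has_rderiv (fun s => (f s, g s)) t (a, b).
Proof.
  intros [_ H1] [_ H2] eps He.
  assert (Hz : is_filter_lim (locally (T := R_UniformSpace) t) t) by (intros P HP; exact HP).
  assert (He2 : 0 < eps / 2) by lra.
  destruct (H1 t Hz (mkposreal _ He2)) as [d1 H1'].
  destruct (H2 t Hz (mkposreal _ He2)) as [d2 H2'].
  exists (Rmin d1 d2). split; [apply Rmin_pos; apply cond_pos|]. intros s Hs.
  assert (Hs1 : Rabs (s - t) < d1) by (eapply Rlt_le_trans; [exact Hs|apply Rmin_l]).
  assert (Hs2 : Rabs (s - t) < d2) by (eapply Rlt_le_trans; [exact Hs|apply Rmin_r]).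
  specialize (H1' s Hs1). specialize (H2' s Hs2).
  change (Rabs (f s - f t - (s - t) * a) <= eps / 2 * Rabs (s - t)) in H1'.
  change (Rabs (g s - g t - (s - t) * b) <= eps / 2 * Rabs (s - t)) in H2'.
  eapply Rle_trans; [apply Cmod_le_Re_Im|]. simpl.
  replace (f s + - f t + - (a * (s - t) - b * 0)) with (f s - f t - (s - t) * a) by ring.
  replace (g s + - g t + - (a * 0 + b * (s - t))) with (g s - g t - (s - t) * b) by ring.
  lra.
Qed.

Lemma has_rderiv_comp (P : C -> C) (g : R -> C) (t : R) (a b : C) :
  has_cderiv P (g t) a -> has_rderiv g t b -> has_rderiv (fun s => P (g s)) t (a * b).
Proof.
  intros HP Hg eps He.
  (* [B] bounds the difference quotients of [g] near [t]: the summand 1 absorbs the remainder of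
     [g], whose tolerance is kept at most 1. In [A] it only ensures positivity. *)
  set (B := Cmod b + 1). assert (HB : 0 < B) by (unfold B; assert (H := Cmod_ge_0 b); lra).
  set (A := Cmod a + 1). assert (HA : 0 < A) by (unfold A; assert (H := Cmod_ge_0 a); lra).
  destruct (HP (eps / 2 / B)) as [d1 [Hd1 HP']]. { apply Rdiv_lt_0_compat; lra. }
  destruct (Hg (Rmin 1 (eps / 2 / A))) as [d2 [Hd2 Hg']].
  { apply Rmin_pos; [lra|apply Rdiv_lt_0_compat; lra]. }
  exists (Rmin d2 (d1 / B)). split. { apply Rmin_pos; [lra|apply Rdiv_lt_0_compat; lra]. }
  intros s Hs.
  assert (Hs2 : Rabs (s - t) < d2) by (eapply Rlt_le_trans; [exact Hs|apply Rmin_l]).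
  assert (Hs1 : Rabs (s - t) < d1 / B) by (eapply Rlt_le_trans; [exact Hs|apply Rmin_r]).
  specialize (Hg' s Hs2).
  assert (Hab := Rabs_pos (s - t)).
  assert (Hgd : Cmod (g s - g t) <= B * Rabs (s - t)).
  { replace (g s - g t)%C with ((g s - g t - b * RtoC (s - t)) + b * RtoC (s - t))%C by ring.
    eapply Rle_trans; [apply Cmod_triangle|]. rewrite Cmod_mult, Cmod_R.
    assert (Rmin 1 (eps / 2 / A) * Rabs (s - t) <= 1 * Rabs (s - t))
      by (apply Rmult_le_compat_r; [lra|apply Rmin_l]).
    unfold B. lra. }
  assert (Hgd1 : Cmod (g s - g t) < d1).
  { eapply Rle_lt_trans; [exact Hgd|]. apply Rmult_lt_compat_l with (r := B) in Hs1; [|lra].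
    replace (B * (d1 / B)) with d1 in Hs1 by (field; lra). exact Hs1. }
  specialize (HP' _ Hgd1).
  replace (P (g s) - P (g t) - a * b * RtoC (s - t))%C with
    ((P (g s) - P (g t) - a * (g s - g t)) + a * (g s - g t - b * RtoC (s - t)))%C by ring.
  eapply Rle_trans; [apply Cmod_triangle|]. rewrite Cmod_mult.
  assert (E1 : eps / 2 / B * Cmod (g s - g t) <= eps / 2 * Rabs (s - t)).
  { apply Rle_trans with (eps / 2 / B * (B * Rabs (s - t))).
    - apply Rmult_le_compat_l; [|exact Hgd]. apply Rlt_le, Rdiv_lt_0_compat; lra.
    - right. field. lra. }
  assert (E2 : Cmod a * Cmod (g s - g t - b * RtoC (s - t)) <= eps / 2 * Rabs (s - t)).
  { apply Rle_trans with (A * (eps / 2 / A * Rabs (s - t))).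
    - apply Rmult_le_compat; [apply Cmod_ge_0|apply Cmod_ge_0|unfold A; lra|].
      eapply Rle_trans; [exact Hg'|]. apply Rmult_le_compat_r; [lra|apply Rmin_r].
    - right. field. lra. }
  lra.
Qed.

Lemma rcont_comp (f : C -> C) (g : R -> C) (t : R) :
  ccont f (g t) -> rcont g t -> rcont (fun s => f (g s)) t.
Proof.
  intros Hf Hg eps He. destruct (Hf eps He) as [d1 [Hd1 H1]].
  destruct (Hg d1 Hd1) as [d2 [Hd2 H2]]. exists d2; split; [exact Hd2|].
  intros s Hs. apply H1, H2, Hs.
Qed.

Lemma has_rderiv_rcont (f : R -> C) (t : R) (l : C) : has_rderiv f t l -> rcont f t.
Proof.
  intros H. apply rcont_continuous.
  apply (ex_derive_continuous (K := R_AbsRing) (V := C_R_NormedModule) f t).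
  exists l. apply has_rderiv_is_derive. exact H.
Qed.

Lemma rcont_mult (f g : R -> C) (t : R) :
  rcont f t -> rcont g t -> rcont (fun u => f u * g u)%C t.
Proof.
  assert (E : forall h : R -> C, rcont h t <->
    @continuous R_UniformSpace (AbsRing_UniformSpace C_AbsRing) h t).
  { intros h. split.
    - intros H P [eps HP]. destruct (H eps (cond_pos eps)) as [d [Hd H']].
      exists (mkposreal d Hd). intros u Hu. apply HP. exact (H' u Hu).
    - intros H eps He.
      destruct (H (fun y => Cmod (y - h t) < eps)) as [d H'].
      { exists (mkposreal eps He). intros y Hy. exact Hy. }
      exists d. split; [apply cond_pos|]. intros u Hu. exact (H' u Hu). }
  rewrite !E. exact (continuous_mult (U := R_UniformSpace) (K := C_AbsRing) f g t).
Qed.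

Lemma rcont_const (c : C) (t : R) : rcont (fun _ => c) t.
Proof.
  intros eps He. exists 1; split; [lra|]. intros s _.
  replace (c - c)%C with (RtoC 0) by ring. rewrite Cmod_0. exact He.
Qed.

Lemma rcont_plus (f g : R -> C) (t : R) :
  rcont f t -> rcont g t -> rcont (fun u => f u + g u)%C t.
Proof.
  rewrite !rcont_continuous.
  exact (continuous_plus (U := R_UniformSpace) (V := C_R_NormedModule) f g t).
Qed.

Lemma rcont_minus (f g : R -> C) (t : R) :
  rcont f t -> rcont g t -> rcont (fun u => f u - g u)%C t.
Proof.
  rewrite !rcont_continuous.
  exact (continuous_minus (U := R_UniformSpace) (V := C_R_NormedModule) f g t).
Qed.

Lemma rcont_ext (f g : R -> C) (t : R) : (forall u, f u = g u) -> rcont f t -> rcont g t.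
Proof.
  intros E H eps He. destruct (H eps He) as [d [Hd H']]. exists d; split; [exact Hd|].
  intros u Hu. rewrite <- !E. exact (H' u Hu).
Qed.

Lemma rcont_line (p d : C) (t : R) : rcont (fun s => p + RtoC s * d)%C t.
Proof.
  intros eps He. assert (H := Cmod_ge_0 d).
  exists (eps / (Cmod d + 1)). split; [apply Rdiv_lt_0_compat; lra|]. intros s Hs.
  replace (p + RtoC s * d - (p + RtoC t * d))%C with (RtoC (s - t) * d)%C
    by (rewrite RtoC_minus; ring).
  rewrite Cmod_mult, Cmod_R.
  apply Rle_lt_trans with (Rabs (s - t) * (Cmod d + 1)).
  - apply Rmult_le_compat_l; [apply Rabs_pos|lra].
  - apply Rlt_div_r; lra.
Qed.

Lemma has_rderiv_line (p d : C) (t : R) : has_rderiv (fun s => p + RtoC s * d)%C t d.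
Proof.
  intros eps He. exists 1; split; [lra|]. intros s _.
  replace (p + RtoC s * d - (p + RtoC t * d) - d * RtoC (s - t))%C with (RtoC 0)
    by (rewrite RtoC_minus; ring).
  rewrite Cmod_0. apply Rmult_le_pos; [lra|apply Rabs_pos].
Qed.

Lemma rcont_Cmod (f : R -> C) (t : R) : rcont f t -> continuous (fun s => Cmod (f s)) t.
Proof.
  intros H P [eps HP]. destruct (H eps (cond_pos eps)) as [d [Hd H']].
  exists (mkposreal d Hd). intros s Hs. apply HP. specialize (H' s Hs).
  change (Rabs (Cmod (f s) - Cmod (f t)) < eps).
  assert (H1 := Cmod_sub_ge (f s) (f t)). assert (H2 := Cmod_sub_ge (f t) (f s)).
  rewrite (Cmod_sub_sym (f t)) in H2. apply Rabs_def1; lra.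
Qed.

(** * Integrals of complex-valued functions *)

Lemma CI_ex (f : R -> C) (a b : R) :
  (forall t, rcont f t) -> @ex_RInt C_R_NormedModule f a b.
Proof.
  intros H. apply (ex_RInt_continuous (V := C_R_CompleteNormedModule)).
  intros z _. apply rcont_continuous, H.
Qed.

Lemma CI_correct (f : R -> C) (a b : R) :
  (forall t, rcont f t) -> @is_RInt C_R_NormedModule f a b (CI f a b).
Proof. intros H. apply (RInt_correct (V := C_R_CompleteNormedModule)), CI_ex, H. Qed.

Lemma CI_unique (f : R -> C) (a b : R) (l : C) :
  @is_RInt C_R_NormedModule f a b l -> CI f a b = l.
Proof. intros H. apply (is_RInt_unique (V := C_R_CompleteNormedModule)), H. Qed.

Lemma CI_ext (f g : R -> C) (a b : R) : (forall t, f t = g t) -> CI f a b = CI g a b.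
Proof. intros H. apply (RInt_ext (V := C_R_CompleteNormedModule)). intros; apply H. Qed.

Lemma CI_plus (f g : R -> C) (a b : R) : (forall t, rcont f t) -> (forall t, rcont g t) ->
  CI (fun t => f t + g t)%C a b = (CI f a b + CI g a b)%C.
Proof.
  intros Hf Hg. apply (RInt_plus (V := C_R_CompleteNormedModule)); apply CI_ex; assumption.
Qed.

Lemma CI_minus (f g : R -> C) (a b : R) : (forall t, rcont f t) -> (forall t, rcont g t) ->
  CI (fun t => f t - g t)%C a b = (CI f a b - CI g a b)%C.
Proof.
  intros Hf Hg. apply (RInt_minus (V := C_R_CompleteNormedModule)); apply CI_ex; assumption.
Qed.

Lemma CI_Chasles (f : R -> C) (a b c : R) : (forall t, rcont f t) ->
  (CI f a b + CI f b c)%C = CI f a c.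
Proof.
  intros Hf. apply (RInt_Chasles (V := C_R_CompleteNormedModule)); apply CI_ex; assumption.
Qed.

Lemma CI_point (f : R -> C) (a : R) : CI f a a = 0%C.
Proof. apply (RInt_point (V := C_R_CompleteNormedModule)). Qed.

Lemma CI_swap (f : R -> C) (a b : R) : (forall t, rcont f t) -> CI f b a = (- CI f a b)%C.
Proof.
  intros H. assert (E := CI_Chasles f a b a H). rewrite CI_point in E.
  replace (CI f b a) with ((CI f a b + CI f b a) - CI f a b)%C by ring. rewrite E. ring.
Qed.

(** [CI] is linear over the reals while [c] is complex, so the two components are treated
    separately. *)
Lemma CI_scal (c : C) (f : R -> C) (a b : R) : (forall t, rcont f t) ->
  CI (fun t => c * f t)%C a b = (c * CI f a b)%C.
Proof.
  intros Hf. apply CI_unique.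
  assert (H := CI_correct f a b Hf).
  assert (H1 := is_RInt_fct_extend_fst (U := R_NormedModule) (V := R_NormedModule) f a b _ H).
  assert (H2 := is_RInt_fct_extend_snd (U := R_NormedModule) (V := R_NormedModule) f a b _ H).
  apply (is_RInt_fct_extend_pair (U := R_NormedModule) (V := R_NormedModule)).
  - exact (is_RInt_minus _ _ _ _ _ _ (is_RInt_scal _ _ _ (fst c) _ H1) (is_RInt_scal _ _ _ (snd c) _ H2)).
  - exact (is_RInt_plus _ _ _ _ _ _ (is_RInt_scal _ _ _ (fst c) _ H2) (is_RInt_scal _ _ _ (snd c) _ H1)).
Qed.

Lemma CI_const (c : C) (a b : R) : CI (fun _ => c) a b = (c * RtoC (b - a))%C.
Proof. unfold CI. rewrite RInt_const, scal_R_Cmult. apply Cmult_comm. Qed.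

Lemma CI_Re (f : R -> C) (a b : R) : (forall t, rcont f t) ->
  is_RInt (fun t => Re (f t)) a b (Re (CI f a b)).
Proof.
  intros Hf.
  exact (is_RInt_fct_extend_fst (U := R_NormedModule) (V := R_NormedModule) f a b _ (CI_correct f a b Hf)).
Qed.

Lemma CI_Im (f : R -> C) (a b : R) : (forall t, rcont f t) ->
  is_RInt (fun t => Im (f t)) a b (Im (CI f a b)).
Proof.
  intros Hf.
  exact (is_RInt_fct_extend_snd (U := R_NormedModule) (V := R_NormedModule) f a b _ (CI_correct f a b Hf)).
Qed.

Lemma CI_comp_lin (f : R -> C) (u v a b : R) : (forall t, rcont f t) ->
  CI (fun t => RtoC u * f (u * t + v)%R)%C a b = CI f (u * a + v) (u * b + v).
Proof.
  intros Hf. unfold CI. rewrite <- (RInt_comp_lin (V := C_R_CompleteNormedModule) f u v a b (CI_ex _ _ _ Hf)).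
  apply (RInt_ext (V := C_R_CompleteNormedModule)). intros x _. symmetry. apply scal_R_Cmult.
Qed.

Lemma CI_norm (f : R -> C) (g : R -> R) (a b : R) : a <= b -> (forall t, rcont f t) ->
  ex_RInt g a b -> (forall t, a <= t <= b -> Cmod (f t) <= g t) -> Cmod (CI f a b) <= RInt g a b.
Proof.
  intros Hab Hf Hg H. rewrite Cmod_norm.
  apply (norm_RInt_le (V := C_R_NormedModule) f g a b (CI f a b) (RInt g a b) Hab).
  - intros t Ht. rewrite <- Cmod_norm. apply H, Ht.
  - apply CI_correct, Hf.
  - apply (RInt_correct (V := R_CompleteNormedModule)), Hg.
Qed.

Lemma CI_norm_const (f : R -> C) (M : R) (a b : R) : (forall t, rcont f t) ->
  (forall t, Rmin a b <= t <= Rmax a b -> Cmod (f t) <= M) -> Cmod (CI f a b) <= M * Rabs (b - a).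
Proof.
  intros Hf.
  assert (Hmain : forall a b, a <= b -> (forall t, a <= t <= b -> Cmod (f t) <= M) ->
    Cmod (CI f a b) <= M * (b - a)).
  { clear a b. intros a b Hab H.
    assert (H' := CI_norm f (fun _ => M) a b Hab Hf (ex_RInt_const a b M) H).
    rewrite RInt_const in H'. unfold scal in H'; simpl in H'; unfold mult in H'; simpl in H'. lra. }
  intros H. destruct (Rle_lt_dec a b) as [Hab|Hab].
  - rewrite Rmin_left, Rmax_right in H by lra. rewrite Rabs_right by lra. apply Hmain; assumption.
  - rewrite Rmin_right, Rmax_left in H by lra. rewrite Rabs_left by lra.
    rewrite (CI_swap f b a Hf), Cmod_opp. replace (- (b - a)) with (a - b) by ring.
    apply Hmain; [lra|assumption].
Qed.

Lemma CI_FTC (P g : C -> C) (p p' : R -> C) (a b : R) :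
  (forall z, has_cderiv P z (g z)) -> (forall z, ccont g z) ->
  (forall t, has_rderiv p t (p' t)) -> (forall t, rcont p' t) ->
  CI (fun t => g (p t) * p' t)%C a b = (P (p b) - P (p a))%C.
Proof.
  intros HP Hg Hp Hp'. apply CI_unique.
  apply (is_RInt_derive (V := C_R_CompleteNormedModule) (fun t => P (p t)) (fun t => g (p t) * p' t)%C).
  - intros t _. apply has_rderiv_is_derive. apply has_rderiv_comp; [apply HP|apply Hp].
  - intros t _. apply rcont_continuous. apply rcont_mult; [|apply Hp'].
    apply rcont_comp; [apply Hg|]. eapply has_rderiv_rcont, Hp.
Qed.

Lemma CI_FTC_line (P g : C -> C) (p d : C) (a b : R) :
  (forall z, has_cderiv P z (g z)) -> (forall z, ccont g z) ->
  (CI (fun t => g (p + RtoC t * d)%C) a b * d = P (p + RtoC b * d) - P (p + RtoC a * d))%C.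
Proof.
  intros HP Hg. rewrite Cmult_comm, <- CI_scal.
  - rewrite <- (CI_FTC P g (fun t => p + RtoC t * d)%C (fun _ => d)); auto.
    + apply CI_ext. intros t. ring.
    + intros t. apply has_rderiv_line.
    + intros t. apply rcont_const.
  - intros t. apply (rcont_comp g); [apply Hg|apply rcont_line].
Qed.

(** * Goursat's lemma and primitives *)

(** The [t n] are left endpoints of nested intervals of length [2^-n]; their supremum is the common
    point. *)
Lemma nested_halving (t : nat -> R) :
  (forall n, t n <= t (S n) <= t n + (/ 2) ^ (S n)) ->
  exists x, forall n, t n <= x <= t n + (/ 2) ^ n.
Proof.
  intros H.
  assert (Hp : forall n, 0 < (/ 2) ^ n) by (intros; apply pow_lt; lra).
  assert (Hinc : forall n k, t n <= t (n + k)%nat).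
  { intros n k; induction k as [|k IH]; [rewrite Nat.add_0_r; lra|].
    rewrite Nat.add_succ_r. specialize (H (n + k)%nat). lra. }
  assert (Hdec : forall n k, t (n + k)%nat + (/ 2) ^ (n + k) <= t n + (/ 2) ^ n).
  { intros n k; induction k as [|k IH]; [rewrite Nat.add_0_r; lra|].
    rewrite Nat.add_succ_r. specialize (H (n + k)%nat). simpl in *. lra. }
  assert (Hall : forall n m, t n <= t m + (/ 2) ^ m).
  { intros n m. specialize (Hinc n m). specialize (Hdec m n).
    rewrite (Nat.add_comm m n) in Hdec. specialize (Hp (n + m)%nat). lra. }
  destruct (completeness (fun x => exists n, x = t n)) as [x [Hub Hlub]].
  - exists (t 0%nat + (/ 2) ^ 0). intros y [n ->]. apply Hall.
  - exists (t 0%nat), 0%nat. reflexivity.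
  - exists x. intros n. split.
    + apply Hub. exists n. reflexivity.
    + apply Hlub. intros y [m ->]. apply Hall.
Qed.

(** The bisection argument of Goursat's lemma, detached from integrals: [N t u h] is any quantity
    attached to the square with corner [(t, u)] and side [h]. If [N 0 0 1 = c > 0], some quarter
    always keeps a fourth of the value, so [N >= c h^2] along nested squares, against the bound
    [o(h^2)] at their common point. *)
Lemma quartering (N : R -> R -> R -> R) :
  (forall t u h, N t u h <= N t u (h / 2) + N (t + h / 2) u (h / 2)
                         + N t (u + h / 2) (h / 2) + N (t + h / 2) (u + h / 2) (h / 2)) ->
  (forall t0 u0, 0 <= t0 <= 1 -> 0 <= u0 <= 1 -> forall eta, 0 < eta -> exists d, 0 < d /\
     forall t u h, 0 < h < d -> t <= t0 <= t + h -> u <= u0 <= u + h -> N t u h <= eta * h ^ 2) ->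
  N 0 0 1 <= 0.
Proof.
  intros Hsub Hloc. apply Rnot_lt_le. intros Hc. set (c := N 0 0 1) in *.
  set (next := fun (h : R) (p : R * R) =>
    (* Keep the first quarter that holds at least a fourth of the value; if three fail,
       subadditivity leaves the last one. *)
    let (t, u) := p in
    if Rle_dec (N t u h) (4 * N t u (h / 2)) then (t, u)
    else if Rle_dec (N t u h) (4 * N (t + h / 2) u (h / 2)) then (t + h / 2, u)
    else if Rle_dec (N t u h) (4 * N t (u + h / 2) (h / 2)) then (t, u + h / 2)
    else (t + h / 2, u + h / 2)).
  assert (Hnext : forall h p, 0 < h ->
    fst p <= fst (next h p) <= fst p + h / 2 /\ snd p <= snd (next h p) <= snd p + h / 2 /\
    N (fst p) (snd p) h <= 4 * N (fst (next h p)) (snd (next h p)) (h / 2)).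
  { intros h [t u] Hh. unfold next.
    destruct (Rle_dec (N t u h) (4 * N t u (h / 2))) as [H1|H1]; [simpl; lra|].
    destruct (Rle_dec (N t u h) (4 * N (t + h / 2) u (h / 2))) as [H2|H2]; [simpl; lra|].
    destruct (Rle_dec (N t u h) (4 * N t (u + h / 2) (h / 2))) as [H3|H3]; [simpl; lra|].
    simpl. specialize (Hsub t u h). lra. }
  set (q := fix q (n : nat) : R * R :=
    match n with O => (0, 0) | S m => next ((/ 2) ^ m) (q m) end).
  assert (Hp : forall n, 0 < (/ 2) ^ n) by (intros; apply pow_lt; lra).
  assert (Hq : forall n, c * ((/ 2) ^ n) ^ 2 <= N (fst (q n)) (snd (q n)) ((/ 2) ^ n)).
  { induction n as [|n IH].
    - simpl. fold c. lra.
    - destruct (Hnext ((/ 2) ^ n) (q n) (Hp n)) as [_ [_ H]].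
      change (q (S n)) with (next ((/ 2) ^ n) (q n)).
      replace ((/ 2) ^ S n) with ((/ 2) ^ n / 2) by (simpl; field). nra. }
  assert (Hh : forall n, (/ 2) ^ n / 2 = (/ 2) ^ S n) by (intros; simpl; field).
  destruct (nested_halving (fun n => fst (q n))) as [t0 Ht0].
  { intros n. rewrite <- Hh. apply (Hnext ((/ 2) ^ n) (q n) (Hp n)). }
  destruct (nested_halving (fun n => snd (q n))) as [u0 Hu0].
  { intros n. rewrite <- Hh. apply (Hnext ((/ 2) ^ n) (q n) (Hp n)). }
  destruct (Hloc t0 u0) with (eta := c / 2) as [d [Hd Hl]]; [| |lra|].
  { specialize (Ht0 0%nat). simpl in Ht0. lra. }
  { specialize (Hu0 0%nat). simpl in Hu0. lra. }
  destruct (pow_lt_1_zero (/ 2)) with (y := d) as [n Hn]; [rewrite Rabs_right; lra|exact Hd|].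
  specialize (Hn n (Nat.le_refl n)). rewrite Rabs_right in Hn by (specialize (Hp n); lra).
  specialize (Hl _ _ _ (conj (Hp n) Hn) (Ht0 n) (Hu0 n)). simpl in Hl.
  specialize (Hq n). specialize (Hp n).
  assert (0 < ((/ 2) ^ n) ^ 2) by (apply pow_lt; exact Hp). simpl in *. nra.
Qed.

(** The counterclockwise boundary integral when [x0 < x1] and [y0 < y1], and its signed extension
    otherwise; thus the subdivision identities below carry no order hypotheses. *)
Definition rectI (f : C -> C) (x0 x1 y0 y1 : R) : C :=
  (CI (fun x => f (x, y0)) x0 x1 - CI (fun x => f (x, y1)) x0 x1
   + Ci * (CI (fun y => f (x1, y)) y0 y1 - CI (fun y => f (x0, y)) y0 y1))%C.

Lemma horizontal_line (x y : R) : (x, y) = ((0, y) + RtoC x * 1)%C.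
Proof. unfold RtoC, Cplus, Cmult; simpl; f_equal; ring. Qed.

Lemma vertical_line (x y : R) : (x, y) = (RtoC x + RtoC y * Ci)%C.
Proof. unfold RtoC, Ci, Cplus, Cmult; simpl; f_equal; ring. Qed.

Section ContinuousIntegrand.

Variable f : C -> C.
Hypothesis Hf : forall z, ccont f z.

Lemma rcont_horizontal (y t : R) : rcont (fun x => f (x, y)) t.
Proof.
  apply rcont_ext with (f := fun x => f ((0, y) + RtoC x * 1)%C).
  { intros x. now rewrite <- horizontal_line. }
  apply (rcont_comp f); [apply Hf|apply rcont_line].
Qed.

Lemma rcont_vertical (x t : R) : rcont (fun y => f (x, y)) t.
Proof.
  apply rcont_ext with (f := fun y => f (RtoC x + RtoC y * Ci)%C).
  { intros y. now rewrite <- vertical_line. }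
  apply (rcont_comp f); [apply Hf|apply rcont_line].
Qed.

Lemma rectI_split_x (x0 x1 x2 y0 y1 : R) :
  rectI f x0 x2 y0 y1 = (rectI f x0 x1 y0 y1 + rectI f x1 x2 y0 y1)%C.
Proof.
  unfold rectI.
  rewrite <- (CI_Chasles (fun x => f (x, y0)) x0 x1 x2 (rcont_horizontal y0)).
  rewrite <- (CI_Chasles (fun x => f (x, y1)) x0 x1 x2 (rcont_horizontal y1)). ring.
Qed.

Lemma rectI_split_y (x0 x1 y0 y1 y2 : R) :
  rectI f x0 x1 y0 y2 = (rectI f x0 x1 y0 y1 + rectI f x0 x1 y1 y2)%C.
Proof.
  unfold rectI.
  rewrite <- (CI_Chasles (fun y => f (x0, y)) y0 y1 y2 (rcont_vertical x0)).
  rewrite <- (CI_Chasles (fun y => f (x1, y)) y0 y1 y2 (rcont_vertical x1)). ring.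
Qed.

Lemma rectI_bound (M x0 x1 y0 y1 : R) :
  (forall x y, Rmin x0 x1 <= x <= Rmax x0 x1 -> Rmin y0 y1 <= y <= Rmax y0 y1 ->
     Cmod (f (x, y)) <= M) ->
  Cmod (rectI f x0 x1 y0 y1) <= 2 * M * (Rabs (x1 - x0) + Rabs (y1 - y0)).
Proof.
  intros HM.
  assert (Hx0 : Rmin x0 x1 <= x0 <= Rmax x0 x1) by (split; [apply Rmin_l|apply Rmax_l]).
  assert (Hx1 : Rmin x0 x1 <= x1 <= Rmax x0 x1) by (split; [apply Rmin_r|apply Rmax_r]).
  assert (Hy0 : Rmin y0 y1 <= y0 <= Rmax y0 y1) by (split; [apply Rmin_l|apply Rmax_l]).
  assert (Hy1 : Rmin y0 y1 <= y1 <= Rmax y0 y1) by (split; [apply Rmin_r|apply Rmax_r]).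
  assert (B1 := CI_norm_const (fun x => f (x, y0)) M x0 x1 (rcont_horizontal y0)
                  (fun x Hx => HM x y0 Hx Hy0)).
  assert (B2 := CI_norm_const (fun x => f (x, y1)) M x0 x1 (rcont_horizontal y1)
                  (fun x Hx => HM x y1 Hx Hy1)).
  assert (B3 := CI_norm_const (fun y => f (x1, y)) M y0 y1 (rcont_vertical x1)
                  (fun y Hy => HM x1 y Hx1 Hy)).
  assert (B4 := CI_norm_const (fun y => f (x0, y)) M y0 y1 (rcont_vertical x0)
                  (fun y Hy => HM x0 y Hx0 Hy)).
  unfold rectI. eapply Rle_trans; [apply Cmod_triangle|].
  rewrite Cmod_mult, Cmod_Ci.
  eapply Rle_trans; [apply Rplus_le_compat; [apply Cmod_sub_le|
    apply Rmult_le_compat_l; [lra|apply Cmod_sub_le]]|]. lra.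
Qed.

Lemma rectI_primitive (P : C -> C) (x0 x1 y0 y1 : R) :
  (forall z, has_cderiv P z (f z)) -> rectI f x0 x1 y0 y1 = 0%C.
Proof.
  intros HP.
  assert (Hh : forall y, CI (fun x => f (x, y)) x0 x1 = (P (x1, y) - P (x0, y))%C).
  { intros y. rewrite (horizontal_line x0), (horizontal_line x1).
    rewrite <- (CI_FTC_line P f (0, y) 1 x0 x1 HP Hf), Cmult_1_r.
    apply CI_ext. intros t. now rewrite <- horizontal_line. }
  assert (Hv : forall x, (CI (fun y => f (x, y)) y0 y1 * Ci)%C = (P (x, y1) - P (x, y0))%C).
  { intros x. rewrite (vertical_line x y0), (vertical_line x y1).
    rewrite <- (CI_FTC_line P f (RtoC x) Ci y0 y1 HP Hf). f_equal.
    apply CI_ext. intros t. now rewrite <- vertical_line. }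
  unfold rectI. rewrite !Hh.
  replace (Ci * (CI (fun y => f (x1, y)) y0 y1 - CI (fun y => f (x0, y)) y0 y1))%C with
    (CI (fun y => f (x1, y)) y0 y1 * Ci - CI (fun y => f (x0, y)) y0 y1 * Ci)%C by ring.
  rewrite !Hv. ring.
Qed.

End ContinuousIntegrand.

Lemma rectI_minus (f g : C -> C) (x0 x1 y0 y1 : R) :
  (forall z, ccont f z) -> (forall z, ccont g z) ->
  rectI (fun z => f z - g z)%C x0 x1 y0 y1 = (rectI f x0 x1 y0 y1 - rectI g x0 x1 y0 y1)%C.
Proof.
  intros Hf Hg. unfold rectI.
  rewrite !CI_minus; try (intros; apply rcont_horizontal; assumption);
    try (intros; apply rcont_vertical; assumption).
  ring.
Qed.

Lemma ccont_affine (p q z : C) : ccont (fun u => p + q * u)%C z.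
Proof.
  apply ccont_plus; [apply ccont_const|]. apply ccont_mult; [apply ccont_const|apply ccont_id].
Qed.

(** Lets the first order Taylor polynomial be subtracted from an integrand without changing its
    boundary integral. *)
Lemma rectI_affine (p q : C) (x0 x1 y0 y1 : R) : rectI (fun u => p + q * u)%C x0 x1 y0 y1 = 0%C.
Proof.
  apply (rectI_primitive _ (ccont_affine p q) (fun u => p * u + q * / 2 * (u * u))%C).
  intros z. eapply has_cderiv_eq.
  - apply has_cderiv_plus; apply has_cderiv_scal; [apply has_cderiv_id|].
    apply has_cderiv_mult; apply has_cderiv_id.
  - cbv beta. field.
Qed.

Lemma between_scaled (x0 a t h x t0 : R) : 0 <= h ->
  Rmin (x0 + a * t) (x0 + a * (t + h)) <= x <= Rmax (x0 + a * t) (x0 + a * (t + h)) ->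
  t <= t0 <= t + h -> Rabs (x - (x0 + a * t0)) <= Rabs a * h.
Proof.
  intros Hh Hx Ht. destruct (Rle_lt_dec 0 a) as [Ha|Ha].
  - rewrite Rmin_left, Rmax_right in Hx by nra. rewrite (Rabs_right a) by lra.
    apply Rabs_le. split; nra.
  - rewrite Rmin_right, Rmax_left in Hx by nra. rewrite (Rabs_left a) by lra.
    apply Rabs_le. split; nra.
Qed.

Lemma goursat (f : C -> C) (x0 x1 y0 y1 : R) :
  (forall z, ccont f z) ->
  (forall x y, Rmin x0 x1 <= x <= Rmax x0 x1 -> Rmin y0 y1 <= y <= Rmax y0 y1 ->
     exists l, has_cderiv f (x, y) l) ->
  rectI f x0 x1 y0 y1 = 0%C.
Proof.
  intros Hf Hd. apply Cmod_eq_0. apply Rle_antisym; [|apply Cmod_ge_0].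
  set (a := x1 - x0). set (b := y1 - y0).
  (* The rectangle is parametrized by the unit square with signed side lengths [a] and [b], so that
     a single scale [h] governs both directions. *)
  set (N := fun t u h => Cmod (rectI f (x0 + a * t) (x0 + a * (t + h)) (y0 + b * u) (y0 + b * (u + h)))).
  replace (Cmod (rectI f x0 x1 y0 y1)) with (N 0 0 1)
    by (unfold N, a, b; do 2 f_equal; ring).
  apply quartering.
  - intros t u h. unfold N.
    rewrite (rectI_split_x f Hf _ (x0 + a * (t + h / 2))), (rectI_split_y f Hf _ _ _ (y0 + b * (u + h / 2))).
    rewrite (rectI_split_y f Hf (x0 + a * (t + h / 2)) _ _ (y0 + b * (u + h / 2))).
    replace (t + h / 2 + h / 2) with (t + h) by field.
    replace (u + h / 2 + h / 2) with (u + h) by field.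
    eapply Rle_trans; [apply Cmod_triangle|].
    eapply Rle_trans; [apply Rplus_le_compat; apply Cmod_triangle|]. lra.
  - intros t0 u0 Ht0 Hu0 eta He.
    set (p := (x0 + a * t0, y0 + b * u0)).
    destruct (Hd (x0 + a * t0) (y0 + b * u0)) as [l Hl].
    { unfold a, Rmin, Rmax. destruct (Rle_dec x0 x1); split; nra. }
    { unfold b, Rmin, Rmax. destruct (Rle_dec y0 y1); split; nra. }
    fold p in Hl.
    (* [D h] bounds both the distance to [p] within the piece of scale [h] and half its perimeter.
       The tolerance [eta / (2 D^2)] for the derivative therefore gives exactly [eta h^2] in
       [rectI_bound]. *)
    set (D := Rabs a + Rabs b + 1).
    assert (HD : 1 <= D) by (unfold D; assert (Ha := Rabs_pos a); assert (Hb := Rabs_pos b); lra).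
    assert (HDD : 0 < 2 * (D * D)) by nra.
    destruct (Hl (eta / (2 * (D * D)))) as [d [Hd0 Hl']]. { apply Rdiv_lt_0_compat; lra. }
    exists (d / D). split; [apply Rdiv_lt_0_compat; lra|].
    intros t u h [Hh0 Hh] Ht Hu. unfold N.
    set (q := (f p - l * p)%C).
    replace (rectI f (x0 + a * t) (x0 + a * (t + h)) (y0 + b * u) (y0 + b * (u + h)))
      with (rectI (fun z => f z - (q + l * z))%C (x0 + a * t) (x0 + a * (t + h)) (y0 + b * u) (y0 + b * (u + h))).
    2:{ rewrite rectI_minus; [|exact Hf|intros; apply ccont_affine]. rewrite rectI_affine. ring. }
    assert (Hdh : D * h < d).
    { apply Rmult_lt_compat_l with (r := D) in Hh; [|lra].
      replace (D * (d / D)) with d in Hh by (field; lra). exact Hh. }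
    eapply Rle_trans; [apply (rectI_bound _ (fun z => ccont_minus _ _ z (Hf z) (ccont_affine q l z))
       (eta / (2 * (D * D)) * (D * h)))|].
    + intros x y Hx Hy.
      assert (Bx := between_scaled x0 a t h x t0 (Rlt_le _ _ Hh0) Hx Ht).
      assert (By := between_scaled y0 b u h y u0 (Rlt_le _ _ Hh0) Hy Hu).
      assert (Hxy : Cmod ((x, y) - p) <= D * h).
      { eapply Rle_trans; [apply Cmod_le_Re_Im|]. unfold p; simpl. unfold Rminus in Bx, By.
        unfold D. lra. }
      replace (f (x, y) - (q + l * (x, y)))%C with (f (x, y) - f p - l * ((x, y) - p))%C
        by (unfold q; ring).
      eapply Rle_trans; [apply Hl'; lra|].
      apply Rmult_le_compat_l; [|exact Hxy]. apply Rlt_le, Rdiv_lt_0_compat; lra.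
    + replace (x0 + a * (t + h) - (x0 + a * t)) with (a * h) by ring.
      replace (y0 + b * (u + h) - (y0 + b * u)) with (b * h) by ring.
      rewrite !Rabs_mult, (Rabs_right h) by lra.
      apply Rle_trans with (2 * (eta / (2 * (D * D)) * (D * h)) * (D * h)).
      * apply Rmult_le_compat_l.
        -- assert (Hk : 0 <= eta / (2 * (D * D))) by (apply Rlt_le, Rdiv_lt_0_compat; lra).
           apply Rmult_le_pos; [lra|]. apply Rmult_le_pos; [exact Hk|]. apply Rmult_le_pos; lra.
        -- unfold D. nra.
      * right. field. lra.
Qed.

Lemma ccont_bounded (f : C -> C) (z : C) : ccont f z ->
  exists d, 0 < d /\ forall u, Cmod (u - z) < d -> Cmod (f u) <= Cmod (f z) + 1.
Proof.
  intros H. destruct (H 1 Rlt_0_1) as [d [Hd H']]. exists d; split; [exact Hd|].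
  intros u Hu. specialize (H' u Hu). assert (T := Cmod_sub_ge (f u) (f z)). lra.
Qed.

(** The rectangle is shrunk by a factor [s] towards the exceptional corner. The rest splits into two
    rectangles that avoid this point, and the small one contributes [O(s)] because [f] is bounded
    near the corner. *)
Lemma goursat_corner (f : C -> C) (px py x y : R) :
  (forall z, ccont f z) -> (forall z, z <> (px, py) -> exists l, has_cderiv f z l) ->
  rectI f px x py y = 0%C.
Proof.
  intros Hf Hd.
  destruct (Req_dec x px) as [Ex|Ex].
  { subst x. unfold rectI. rewrite !CI_point. ring. }
  destruct (Req_dec y py) as [Ey|Ey].
  { subst y. unfold rectI. rewrite !CI_point. ring. }
  apply Cmod_eq_0, Rle_antisym; [|apply Cmod_ge_0]. apply le_epsilon. intros eps He. rewrite Rplus_0_l.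
  set (p := (px, py)). destruct (ccont_bounded f p (Hf p)) as [d [Hd0 HM]].
  set (M := Cmod (f p) + 1) in *. assert (HM0 : 1 <= M) by (unfold M; assert (H := Cmod_ge_0 (f p)); lra).
  set (D := Rabs (x - px) + Rabs (y - py)).
  assert (HD : 0 < D). { unfold D. assert (0 < Rabs (x - px)) by (apply Rabs_pos_lt; lra).
    assert (H' := Rabs_pos (y - py)). lra. }
  (* [s * D < d] keeps the small rectangle where [|f| <= M]; the last bound is its perimeter
     estimate. *)
  assert (Hs : exists s, 0 < s <= 1 /\ s * D < d /\ s * (2 * M * D) <= eps).
  { exists (Rmin 1 (Rmin (d / D / 2) (eps / (2 * M * D)))).
    assert (H1 : 0 < d / D / 2) by (apply Rdiv_lt_0_compat; [apply Rdiv_lt_0_compat; lra|lra]).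
    assert (HMD : 0 < 2 * M * D) by nra.
    assert (H2 : 0 < eps / (2 * M * D)) by (apply Rdiv_lt_0_compat; nra).
    set (m := Rmin 1 (Rmin (d / D / 2) (eps / (2 * M * D)))).
    assert (Hm1 : m <= 1) by apply Rmin_l.
    assert (Hm2 : m <= d / D / 2) by (eapply Rle_trans; [apply Rmin_r|apply Rmin_l]).
    assert (Hm3 : m <= eps / (2 * M * D)) by (eapply Rle_trans; [apply Rmin_r|apply Rmin_r]).
    assert (Hm0 : 0 < m) by (unfold m; apply Rmin_pos; [lra|apply Rmin_pos; assumption]).
    split; [lra|]. split.
    - apply Rle_lt_trans with (d / D / 2 * D); [apply Rmult_le_compat_r; lra|].
      replace (d / D / 2 * D) with (d / 2) by (field; lra). lra.
    - apply Rle_trans with (eps / (2 * M * D) * (2 * M * D)); [apply Rmult_le_compat_r; lra|].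
      right. field. lra. }
  destruct Hs as [s [Hs [Hs1 Hs2]]].
  set (x' := px + s * (x - px)). set (y' := py + s * (y - py)).
  rewrite (rectI_split_x f Hf px x' x), (rectI_split_y f Hf px x' py y' y).
  rewrite (goursat f x' x py y Hf), (goursat f px x' y' y Hf).
  - rewrite !Cplus_0_r. eapply Rle_trans; [apply (rectI_bound f Hf M)|].
    + intros u v Hu Hv. apply HM. eapply Rle_lt_trans; [apply Cmod_le_Re_Im|].
      unfold p; simpl. eapply Rle_lt_trans; [|exact Hs1]. unfold D.
      rewrite Rmult_plus_distr_l. apply Rplus_le_compat.
      * unfold x' in Hu. unfold Rmin, Rmax in Hu. destruct (Rle_dec px (px + s * (x - px))).
        -- rewrite (Rabs_right (x - px)) by nra. apply Rabs_le. lra.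
        -- rewrite (Rabs_left (x - px)) by nra. apply Rabs_le. lra.
      * unfold y' in Hv. unfold Rmin, Rmax in Hv. destruct (Rle_dec py (py + s * (y - py))).
        -- rewrite (Rabs_right (y - py)) by nra. apply Rabs_le. lra.
        -- rewrite (Rabs_left (y - py)) by nra. apply Rabs_le. lra.
    + unfold x', y'.
      replace (px + s * (x - px) - px) with (s * (x - px)) by ring.
      replace (py + s * (y - py) - py) with (s * (y - py)) by ring.
      rewrite !Rabs_mult, (Rabs_right s) by lra. unfold D in Hs2. lra.
  - intros u v Hu Hv. apply Hd. intros E. injection E as E1 E2. subst v.
    unfold y', Rmin, Rmax in Hv. destruct (Rle_dec (py + s * (y - py)) y); nra.
  - intros u v Hu Hv. apply Hd. intros E. injection E as E1 E2. subst u.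
    unfold x', Rmin, Rmax in Hu. destruct (Rle_dec (px + s * (x - px)) x); nra.
Qed.

(* Chasles' relation holds for signed rectangles, so any rectangle splits at the exceptional point,
   wherever that point lies. *)
Lemma goursat_punctured (f : C -> C) (p : C) (x0 x1 y0 y1 : R) :
  (forall z, ccont f z) -> (forall z, z <> p -> exists l, has_cderiv f z l) ->
  rectI f x0 x1 y0 y1 = 0%C.
Proof.
  intros Hf Hd. destruct p as [px py].
  assert (H := fun x y => goursat_corner f px py x y Hf Hd).
  assert (H2 : forall x, rectI f px x y0 y1 = 0%C).
  { intros x. assert (E := rectI_split_y f Hf px x py y0 y1). rewrite !H in E.
    rewrite E. ring. }
  assert (E := rectI_split_x f Hf px x0 x1 y0 y1). rewrite !H2 in E.
  rewrite E. ring.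
Qed.

(** The primitive integrates along the real axis and then vertically. Only vanishing of rectangle
    integrals and continuity of [f] enter the computation of its derivative, so it is differentiable
    at [p] as well. *)
Lemma primitive_punctured (f : C -> C) (p : C) :
  (forall z, ccont f z) -> (forall z, z <> p -> exists l, has_cderiv f z l) ->
  exists P, forall z, has_cderiv P z (f z).
Proof.
  intros Hf Hd.
  exists (fun z => CI (fun x => f (x, 0)) 0 (Re z) + Ci * CI (fun y => f (Re z, y)) 0 (Im z))%C.
  intros [x y] eps He. simpl.
  destruct (Hf (x, y) (eps / 2)) as [d [Hd0 H]]; [lra|].
  exists d. split; [exact Hd0|]. intros [u v] Huv. simpl.
  set (h := ((u, v) - (x, y))%C) in *.
  (* This rectangle moves the horizontal step from [x] to [u] from height 0 up to height [y], so
     that the increment of the primitive becomes an integral over a path close to [(x, y)]. *)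
  assert (Hg := goursat_punctured f p x u 0 y Hf Hd). unfold rectI in Hg.
  assert (E1 := CI_Chasles (fun t => f (t, 0)) 0 x u (rcont_horizontal f Hf 0)).
  assert (E2 := CI_Chasles (fun t => f (u, t)) 0 y v (rcont_vertical f Hf u)).
  set (c := f (x, y)) in *.
  assert (Hc1 : CI (fun t => f (t, y) - c)%C x u = (CI (fun t => f (t, y)) x u - c * RtoC (u - x))%C).
  { rewrite CI_minus, CI_const; [reflexivity|apply rcont_horizontal, Hf|intros; apply rcont_const]. }
  assert (Hc2 : CI (fun t => f (u, t) - c)%C y v = (CI (fun t => f (u, t)) y v - c * RtoC (v - y))%C).
  { rewrite CI_minus, CI_const; [reflexivity|apply rcont_vertical, Hf|intros; apply rcont_const]. }
  replace (_ - _ - _)%C with (CI (fun t => f (t, y) - c)%C x u + Ci * CI (fun t => f (u, t) - c)%C y v)%C.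
  2:{ rewrite Hc1, Hc2, <- E1, <- E2.
      replace h with (RtoC (u - x) + Ci * RtoC (v - y))%C
        by (apply injective_projections; unfold h; simpl; ring).
      match goal with |- @eq _ ?l ?r => change (@eq C l r) end.
      match type of Hg with ?G = _ => transitivity (
        CI (fun t => f (t, y)) x u - c * RtoC (u - x) + Ci * (CI (fun t => f (u, t)) y v - c * RtoC (v - y)) + G)%C;
        [rewrite Hg; ring|ring] end. }
  assert (Hre : Rabs (u - x) <= Cmod h) by (apply (re_le_Cmod h)).
  assert (Him : Rabs (v - y) <= Cmod h) by (apply (im_le_Cmod h)).
  assert (B1 : Cmod (CI (fun t => f (t, y) - c)%C x u) <= eps / 2 * Rabs (u - x)).
  { apply CI_norm_const.
    - intros t. apply rcont_minus; [apply rcont_horizontal, Hf|apply rcont_const].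
    - intros t Ht. apply Rlt_le, H. eapply Rle_lt_trans; [|exact Huv].
      eapply Rle_trans; [|exact Hre].
      eapply Rle_trans; [apply Cmod_le_Re_Im|]. simpl. rewrite Rplus_opp_r, Rabs_R0, Rplus_0_r.
      unfold Rmin, Rmax in Ht. destruct (Rle_dec x u).
      + rewrite !Rabs_right; lra.
      + rewrite !Rabs_left1; lra. }
  assert (B2 : Cmod (CI (fun t => f (u, t) - c)%C y v) <= eps / 2 * Rabs (v - y)).
  { apply CI_norm_const.
    - intros t. apply rcont_minus; [apply rcont_vertical, Hf|apply rcont_const].
    - intros t Ht. apply Rlt_le, H. eapply Rle_lt_trans; [|exact Huv].
      unfold Cmod. apply sqrt_le_1_alt. simpl. apply Rplus_le_compat_l. rewrite !Rmult_1_r.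
      apply Rsqr_le_abs_1. unfold Rmin, Rmax in Ht. destruct (Rle_dec y v).
      + rewrite !Rabs_right; lra.
      + rewrite !Rabs_left1; lra. }
  eapply Rle_trans; [apply Cmod_triangle|]. rewrite Cmod_mult, Cmod_Ci. nra.
Qed.

(** * The complex exponential and the sinc function *)

Lemma CI_FTC_R (f f' : R -> C) (a b : R) :
  (forall t, has_rderiv f t (f' t)) -> (forall t, rcont f' t) -> CI f' a b = (f b - f a)%C.
Proof.
  intros H H'. apply CI_unique. apply (is_RInt_derive (V := C_R_CompleteNormedModule) f f').
  - intros t _. apply has_rderiv_is_derive, H.
  - intros t _. apply rcont_continuous, H'.
Qed.

Definition cexp (z : C) : C := (exp (Re z) * cos (Im z), exp (Re z) * sin (Im z)).

Lemma cexp_plus (a b : C) : cexp (a + b) = (cexp a * cexp b)%C.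
Proof.
  destruct a as [x y], b as [u v].
  apply injective_projections; unfold cexp; simpl; rewrite exp_plus.
  - rewrite cos_plus. ring.
  - rewrite sin_plus. ring.
Qed.

Lemma cexp_0 : cexp 0 = 1%C.
Proof. apply injective_projections; unfold cexp; simpl; rewrite exp_0, ?cos_0, ?sin_0; ring. Qed.

Lemma Cmod_cexp (z : C) : Cmod (cexp z) = exp (Re z).
Proof.
  unfold Cmod, cexp; simpl.
  replace (_ + _) with ((exp (Re z)) ^ 2 * (Rsqr (sin (Im z)) + Rsqr (cos (Im z))))
    by (unfold Rsqr; simpl; ring).
  rewrite sin2_cos2, Rmult_1_r. apply sqrt_pow2, Rlt_le, exp_pos.
Qed.

Lemma Re_le_Cmod (z : C) : Re z <= Cmod z.
Proof. eapply Rle_trans; [apply Rle_abs|apply re_le_Cmod]. Qed.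

Lemma Cmod_cexp_le (z : C) : Cmod (cexp z) <= exp (Cmod z).
Proof.
  rewrite Cmod_cexp. destruct (Re_le_Cmod z) as [H|H]; [apply Rlt_le, exp_increasing, H|rewrite H; lra].
Qed.

Lemma exp_le (a b : R) : a <= b -> exp a <= exp b.
Proof. intros [H|H]; [apply Rlt_le, exp_increasing, H|rewrite H; lra]. Qed.

Lemma has_rderiv_cexp (h : C) (t : R) :
  has_rderiv (fun s => cexp (RtoC s * h)) t (h * cexp (RtoC t * h)).
Proof.
  destruct h as [a b].
  assert (E : forall s, cexp (RtoC s * (a, b)) = (exp (s * a) * cos (s * b), exp (s * a) * sin (s * b))).
  { intros s. unfold cexp; simpl.
    replace (s * a - 0 * b) with (s * a) by ring. replace (s * b + 0 * a) with (s * b) by ring. reflexivity. }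
  assert (H : has_rderiv (fun s => (exp (s * a) * cos (s * b), exp (s * a) * sin (s * b))) t
    (a * (exp (t * a) * cos (t * b)) - b * (exp (t * a) * sin (t * b)),
     a * (exp (t * a) * sin (t * b)) + b * (exp (t * a) * cos (t * b)))).
  { apply has_rderiv_pair; auto_derive; auto; ring. }
  intros eps He. destruct (H eps He) as [d [Hd H']]. exists d; split; [exact Hd|].
  intros s Hs. specialize (H' s Hs). rewrite !E. exact H'.
Qed.

Lemma rcont_cexp (h : C) (t : R) : rcont (fun s => cexp (RtoC s * h)) t.
Proof. eapply has_rderiv_rcont, has_rderiv_cexp. Qed.

Lemma Cmod_scaled (t : R) (h : C) : 0 <= t <= 1 -> Cmod (RtoC t * h) <= Cmod h.
Proof.
  intros Ht. rewrite Cmod_mult, Cmod_R, Rabs_right by lra. assert (H := Cmod_ge_0 h). nra.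
Qed.

(** By the fundamental theorem on the segment from 0 to [h], [exp(h) - 1] is the integral of
    [h exp(t h)] over [[0, 1]]. Integrating the resulting bound again gives the second and third
    order remainders; the factorials are dropped, being irrelevant for differentiability. *)
Lemma cexp_remainder1 (h : C) : Cmod (cexp h - 1) <= Cmod h * exp (Cmod h).
Proof.
  assert (E := CI_FTC_R (fun t => cexp (RtoC t * h)) (fun t => h * cexp (RtoC t * h))%C 0 1
     (has_rderiv_cexp h) (fun t => rcont_mult _ _ t (rcont_const h t) (rcont_cexp h t))).
  cbv beta in E. rewrite Cmult_0_l, cexp_0, Cmult_1_l in E. rewrite <- E.
  eapply Rle_trans; [apply CI_norm_const with (M := Cmod h * exp (Cmod h))|].
  - intros t. apply rcont_mult; [apply rcont_const|apply rcont_cexp].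
  - rewrite Rmin_left, Rmax_right by lra. intros t Ht. rewrite Cmod_mult.
    apply Rmult_le_compat_l; [apply Cmod_ge_0|].
    eapply Rle_trans; [apply Cmod_cexp_le|]. apply exp_le, Cmod_scaled, Ht.
  - rewrite Rminus_0_r, Rabs_R1. lra.
Qed.

Lemma has_rderiv_plus (f g : R -> C) (t : R) (a b : C) :
  has_rderiv f t a -> has_rderiv g t b -> has_rderiv (fun s => f s + g s)%C t (a + b).
Proof.
  rewrite !has_rderiv_is_derive. exact (is_derive_plus (V := C_R_NormedModule) f g t a b).
Qed.

Lemma has_rderiv_RtoC (f : R -> R) (t a : R) :
  is_derive f t a -> has_rderiv (fun s => RtoC (f s)) t (RtoC a).
Proof. intros H. apply has_rderiv_pair; [exact H|auto_derive; auto]. Qed.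

Lemma has_rderiv_scal (c : C) (f : R -> C) (t : R) (a : C) :
  has_rderiv f t a -> has_rderiv (fun s => c * f s)%C t (c * a).
Proof.
  intros H. apply (has_rderiv_comp (fun u => c * u)%C f t c a); [|exact H].
  eapply has_cderiv_eq; [apply has_cderiv_scal, has_cderiv_id|ring].
Qed.

Lemma rcont_RtoC (t : R) : rcont (fun s => RtoC s) t.
Proof. apply (has_rderiv_rcont _ _ (RtoC 1)). apply has_rderiv_RtoC. auto_derive; auto. Qed.

Lemma cexp_remainder2 (h : C) : Cmod (cexp h - 1 - h) <= Cmod h ^ 2 * exp (Cmod h).
Proof.
  assert (Hc : forall t, rcont (fun t => h * (cexp (RtoC t * h) - 1))%C t).
  { intros t. apply rcont_mult; [apply rcont_const|]. apply rcont_minus; [apply rcont_cexp|apply rcont_const]. }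
  assert (E := CI_FTC_R (fun t => cexp (RtoC t * h) + (- h) * RtoC t)%C
                 (fun t => h * (cexp (RtoC t * h) - 1))%C 0 1).
  cbv beta in E. rewrite Cmult_0_l, cexp_0, Cmult_1_l in E.
  replace (cexp h - 1 - h)%C with (cexp h + - h * 1 - (1 + - h * 0))%C by ring.
  rewrite <- E; [|clear E|exact Hc].
  - eapply Rle_trans; [apply CI_norm_const with (M := Cmod h ^ 2 * exp (Cmod h)); [exact Hc|]|].
    + rewrite Rmin_left, Rmax_right by lra. intros t Ht. rewrite Cmod_mult. simpl.
      rewrite Rmult_1_r, Rmult_assoc.
      apply Rmult_le_compat_l; [apply Cmod_ge_0|].
      eapply Rle_trans; [apply cexp_remainder1|].
      apply Rmult_le_compat; [apply Cmod_ge_0|apply Rlt_le, exp_pos|apply Cmod_scaled, Ht|].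
      apply exp_le, Cmod_scaled, Ht.
    + rewrite Rminus_0_r, Rabs_R1. lra.
  - intros t. replace (h * (cexp (RtoC t * h) - 1))%C with (h * cexp (RtoC t * h) + (- h) * RtoC 1)%C by ring.
    apply has_rderiv_plus; [apply has_rderiv_cexp|]. apply has_rderiv_scal, has_rderiv_RtoC.
    auto_derive; auto.
Qed.

Lemma cexp_remainder3 (h : C) :
  Cmod (cexp h - 1 - h - RtoC (/ 2) * (h * h)) <= Cmod h ^ 3 * exp (Cmod h).
Proof.
  assert (Hc : forall t, rcont (fun t => h * (cexp (RtoC t * h) - 1 - RtoC t * h))%C t).
  { intros t. apply rcont_mult; [apply rcont_const|].
    apply rcont_minus; [apply rcont_minus; [apply rcont_cexp|apply rcont_const]|].
    apply rcont_mult; [apply rcont_RtoC|apply rcont_const]. }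
  assert (E := CI_FTC_R (fun t => cexp (RtoC t * h) + ((- h) * RtoC t + (- (h * h)) * RtoC (/ 2 * t ^ 2)))%C
                 (fun t => h * (cexp (RtoC t * h) - 1 - RtoC t * h))%C 0 1).
  cbv beta in E. rewrite Cmult_0_l, cexp_0, Cmult_1_l in E.
  replace (/ 2 * 1 ^ 2) with (/ 2) in E by ring. replace (/ 2 * 0 ^ 2) with 0 in E by ring.
  replace (cexp h - 1 - h - RtoC (/ 2) * (h * h))%C with
   (cexp h + (- h * 1 + - (h * h) * RtoC (/ 2)) - (1 + (- h * 0 + - (h * h) * 0)))%C by ring.
  rewrite <- E; [|clear E|exact Hc].
  - eapply Rle_trans; [apply CI_norm_const with (M := Cmod h ^ 3 * exp (Cmod h)); [exact Hc|]|].
    + rewrite Rmin_left, Rmax_right by lra. intros t Ht. rewrite Cmod_mult.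
      replace (Cmod h ^ 3) with (Cmod h * Cmod h ^ 2) by ring. rewrite Rmult_assoc.
      apply Rmult_le_compat_l; [apply Cmod_ge_0|].
      eapply Rle_trans; [apply cexp_remainder2|].
      apply Rmult_le_compat; [apply pow_le, Cmod_ge_0|apply Rlt_le, exp_pos| |].
      * apply pow_incr. split; [apply Cmod_ge_0|apply Cmod_scaled, Ht].
      * apply exp_le, Cmod_scaled, Ht.
    + rewrite Rminus_0_r, Rabs_R1. lra.
  - intros t. replace (h * (cexp (RtoC t * h) - 1 - RtoC t * h))%C
      with (h * cexp (RtoC t * h) + ((- h) * RtoC 1 + (- (h * h)) * RtoC t))%C by ring.
    apply has_rderiv_plus; [apply has_rderiv_cexp|]. apply has_rderiv_plus.
    + apply has_rderiv_scal, has_rderiv_RtoC. auto_derive; auto.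
    + apply has_rderiv_scal, has_rderiv_RtoC. auto_derive; auto. field.
Qed.

Lemma has_cderiv_quadratic (f : C -> C) (z l : C) (K : R) : 0 <= K ->
  (forall u, Cmod (u - z) <= 1 -> Cmod (f u - f z - l * (u - z)) <= K * Cmod (u - z) ^ 2) ->
  has_cderiv f z l.
Proof.
  intros HK H eps He. exists (Rmin 1 (eps / (K + 1))).
  split; [apply Rmin_pos; [lra|apply Rdiv_lt_0_compat; lra]|].
  intros u Hu.
  assert (Hu1 : Cmod (u - z) < 1) by (eapply Rlt_le_trans; [exact Hu|apply Rmin_l]).
  assert (Hu2 : Cmod (u - z) < eps / (K + 1)) by (eapply Rlt_le_trans; [exact Hu|apply Rmin_r]).
  apply Rlt_div_r in Hu2; [|lra].
  eapply Rle_trans; [apply H; lra|]. assert (Hp := Cmod_ge_0 (u - z)). nra.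
Qed.

Lemma has_cderiv_cexp (z : C) : has_cderiv cexp z (cexp z).
Proof.
  apply (has_cderiv_quadratic _ _ _ (exp (Re z) * exp 1)).
  { apply Rmult_le_pos; apply Rlt_le, exp_pos. }
  intros u Hu. set (h := (u - z)%C) in *.
  replace u with (z + h)%C by (unfold h; ring). rewrite cexp_plus.
  replace (cexp z * cexp h - cexp z - cexp z * h)%C with (cexp z * (cexp h - 1 - h))%C by ring.
  rewrite Cmod_mult, Cmod_cexp, Rmult_assoc.
  apply Rmult_le_compat_l; [apply Rlt_le, exp_pos|].
  eapply Rle_trans; [apply cexp_remainder2|]. rewrite Rmult_comm.
  apply Rmult_le_compat_r; [apply pow_le, Cmod_ge_0|]. apply exp_le, Hu.
Qed.

Lemma csin_cexp (z : C) : (2 * Ci * csin z = cexp (Ci * z) - cexp (- (Ci * z)))%C.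
Proof.
  destruct z as [x y].
  apply injective_projections; unfold cexp, csin, sinh, cosh; simpl;
    replace (0 * x - 1 * y) with (- y) by ring; replace (0 * y + 1 * x) with x by ring;
    rewrite Ropp_involutive, ?cos_neg, ?sin_neg; field.
Qed.

Lemma csin_diff (z : C) : exists l, has_cderiv csin z l.
Proof.
  eexists. apply has_cderiv_ext with
    (f := fun z => (/ (2 * Ci) * (cexp (Ci * z) - cexp (- (1) * (Ci * z))))%C).
  - intros u. replace (- (1) * (Ci * u))%C with (- (Ci * u))%C by ring. rewrite <- csin_cexp. field.
    apply Ci_nz.
  - apply has_cderiv_scal, has_cderiv_minus.
    + apply (has_cderiv_comp cexp); [apply has_cderiv_cexp|]. apply has_cderiv_scal, has_cderiv_id.
    + apply (has_cderiv_comp cexp); [apply has_cderiv_cexp|].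
      apply has_cderiv_scal, has_cderiv_scal, has_cderiv_id.
Qed.

Lemma Cmod_Ci_mult (z : C) : Cmod (Ci * z) = Cmod z.
Proof. rewrite Cmod_mult, Cmod_Ci. ring. Qed.

Lemma Cmod_2Ci_csin (z : C) : Cmod (csin z) = Cmod (cexp (Ci * z) - cexp (- (Ci * z))) / 2.
Proof.
  rewrite <- csin_cexp, !Cmod_mult, Cmod_Ci, Cmod_R, Rabs_right by lra. field.
Qed.

Lemma csin_bound_Im (z : C) : Cmod (csin z) <= exp (Rabs (Im z)).
Proof.
  rewrite Cmod_2Ci_csin. assert (H := Cmod_sub_le (cexp (Ci * z)) (cexp (- (Ci * z)))).
  rewrite !Cmod_cexp in H.
  assert (H1 : exp (Re (Ci * z)) <= exp (Rabs (Im z))).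
  { apply exp_le. destruct z as [x y]; simpl. replace (0 * x - 1 * y) with (- y) by ring.
    rewrite <- Rabs_Ropp. apply Rle_abs. }
  assert (H2 : exp (Re (- (Ci * z))) <= exp (Rabs (Im z))).
  { apply exp_le. destruct z as [x y]; simpl. replace (- (0 * x - 1 * y)) with y by ring. apply Rle_abs. }
  lra.
Qed.

Lemma csin_bound (z : C) : Cmod (csin z) <= Cmod z * exp (Cmod z).
Proof.
  rewrite Cmod_2Ci_csin.
  replace (cexp (Ci * z) - cexp (- (Ci * z)))%C
    with ((cexp (Ci * z) - 1) - (cexp (- (Ci * z)) - 1))%C by ring.
  assert (H := Cmod_sub_le (cexp (Ci * z) - 1) (cexp (- (Ci * z)) - 1)).
  assert (H1 := cexp_remainder1 (Ci * z)). assert (H2 := cexp_remainder1 (- (Ci * z))).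
  rewrite Cmod_opp in H2. rewrite Cmod_Ci_mult in *. lra.
Qed.

(** Subtracting the expansions at [iz] and [-iz] cancels the quadratic terms. The cubic error is
    what leaves a quadratic one after division by [z], as needed for the derivative of [sincD] at
    0. *)
Lemma csin_remainder (z : C) : Cmod (csin z - z) <= Cmod z ^ 3 * exp (Cmod z).
Proof.
  assert (H1 := cexp_remainder3 (Ci * z)). assert (H2 := cexp_remainder3 (- (Ci * z))).
  rewrite Cmod_opp in H2. rewrite Cmod_Ci_mult in *.
  set (a := (cexp (Ci * z) - 1 - Ci * z - RtoC (/ 2) * (Ci * z * (Ci * z)))%C) in *.
  set (b := (cexp (- (Ci * z)) - 1 - - (Ci * z) - RtoC (/ 2) * (- (Ci * z) * - (Ci * z)))%C) in *.
  assert (E : (2 * Ci * (csin z - z))%C = (a - b)%C).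
  { replace (2 * Ci * (csin z - z))%C with (2 * Ci * csin z - 2 * Ci * z)%C by ring.
    rewrite csin_cexp. unfold a, b. ring. }
  assert (E' : 2 * Cmod (csin z - z) = Cmod (a - b)).
  { rewrite <- E, !Cmod_mult, Cmod_Ci, Cmod_R, Rabs_right by lra. ring. }
  assert (H := Cmod_sub_le a b). lra.
Qed.

Lemma csin_0 : csin 0 = 0%C.
Proof.
  apply injective_projections; unfold csin; simpl; rewrite ?sin_0, ?sinh_0; ring.
Qed.

Lemma CPI_neq_0 : RtoC PI <> 0%C.
Proof. intros E. injection E. assert (H := PI_RGT_0). lra. Qed.

(** Multiplied out, the relation also holds at [z = 0], so identities for [sincD] can be derived
    from it without dividing by [z]. *)
Lemma csin_sincD (D : R) (z : C) : csin (RtoC (PI * D) * z) = (RtoC PI * z * sincD D z)%C.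
Proof.
  unfold sincD. destruct (excluded_middle_informative (z = 0%C)) as [->|Hz].
  - rewrite Cmult_0_r, csin_0. ring.
  - field. split; [exact Hz|apply CPI_neq_0].
Qed.

Lemma sincD_0 (D : R) : sincD D 0 = RtoC D.
Proof. unfold sincD. destruct (excluded_middle_informative _) as [_|H]; [reflexivity|now elim H]. Qed.

Section Sinc.

Variable D : R.
Hypothesis HD : 0 < D.
Let tau := PI * D.

Lemma tau_pos : 0 < tau.
Proof. apply Rmult_lt_0_compat; [apply PI_RGT_0|exact HD]. Qed.

(** Two complementary estimates: this one gives decay [1/|z|] along horizontal lines but says
    nothing at 0, while [sincD_bound] gives the exponential type uniformly, including near 0. *)
Lemma sincD_bound_Im (z : C) : PI * Cmod z * Cmod (sincD D z) <= exp (tau * Rabs (Im z)).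
Proof.
  assert (H := csin_bound_Im (RtoC (PI * D) * z)). rewrite csin_sincD, !Cmod_mult in H.
  rewrite Cmod_R, (Rabs_right PI), im_scal_l, Rabs_mult in H by (left; apply PI_RGT_0).
  fold tau in H. rewrite (Rabs_right tau) in H by (left; apply tau_pos). exact H.
Qed.

Lemma sincD_bound (z : C) : Cmod (sincD D z) <= D * exp (tau * Cmod z).
Proof.
  destruct (Ceq_dec z 0) as [->|Hz].
  - rewrite sincD_0, Cmod_0, Rmult_0_r, exp_0, Cmod_R, Rabs_right; lra.
  - assert (H := csin_bound (RtoC (PI * D) * z)). rewrite csin_sincD, !Cmod_mult in H.
    assert (Hpi := PI_RGT_0). assert (Ht := tau_pos). apply Cmod_gt_0 in Hz.
    rewrite !Cmod_R, (Rabs_right PI), (Rabs_right (PI * D)) in H by (fold tau; lra).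
    fold tau in H. unfold tau at 1 in H.
    apply Rmult_le_reg_l with (PI * Cmod z); [apply Rmult_lt_0_compat; assumption|]. lra.
Qed.

Lemma has_cderiv_sincD_0 : has_cderiv (sincD D) 0 0.
Proof.
  assert (Hpi := PI_RGT_0). assert (Ht := tau_pos).
  apply (has_cderiv_quadratic _ _ _ (tau ^ 3 * exp tau / PI)).
  { apply Rdiv_le_0_compat; [|lra]. apply Rmult_le_pos; [apply pow_le; lra|apply Rlt_le, exp_pos]. }
  intros u Hu. rewrite Cmult_0_l, sincD_0.
  replace (u - 0)%C with u in * by ring. replace (sincD D u - RtoC D - 0)%C with (sincD D u - RtoC D)%C by ring.
  destruct (Ceq_dec u 0) as [->|Hu0].
  { rewrite sincD_0. replace (RtoC D - RtoC D)%C with (RtoC 0) by ring. rewrite Cmod_0. simpl. lra. }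
  apply Cmod_gt_0 in Hu0.
  assert (H := csin_remainder (RtoC (PI * D) * u)). rewrite csin_sincD in H.
  replace (RtoC PI * u * sincD D u - RtoC (PI * D) * u)%C
    with (RtoC PI * u * (sincD D u - RtoC D))%C in H by (rewrite RtoC_mult; ring).
  rewrite !Cmod_mult, !Cmod_R, (Rabs_right PI), (Rabs_right (PI * D)) in H by (fold tau; lra).
  fold tau in H.
  assert (He : exp (tau * Cmod u) <= exp tau) by (apply exp_le; nra).
  apply Rmult_le_reg_l with (PI * Cmod u); [apply Rmult_lt_0_compat; assumption|].
  eapply Rle_trans; [exact H|]. rewrite Rpow_mult_distr.
  replace (PI * Cmod u * (tau ^ 3 * exp tau / PI * Cmod u ^ 2)) with (tau ^ 3 * Cmod u ^ 3 * exp tau)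
    by (field; lra).
  apply Rmult_le_compat_l; [|exact He].
  apply Rmult_le_pos; apply pow_le; lra.
Qed.

Lemma sincD_diff (z : C) : exists l, has_cderiv (sincD D) z l.
Proof.
  destruct (Ceq_dec z 0) as [->|Hz].
  - exists 0%C. apply has_cderiv_sincD_0.
  - destruct (csin_diff (RtoC (PI * D) * z)) as [l Hl].
    eexists. apply has_cderiv_ext_loc with (f := fun u => (csin (RtoC (PI * D) * u) * (/ RtoC PI * / u))%C) (r := Cmod z).
    + apply Cmod_gt_0, Hz.
    + intros u Hu. unfold sincD. destruct (excluded_middle_informative (u = 0%C)) as [->|Hu0].
      * exfalso. replace (0 - z)%C with (- z)%C in Hu by ring. rewrite Cmod_opp in Hu. lra.
      * field. split; [apply Hu0|apply CPI_neq_0].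
    + apply has_cderiv_mult.
      * apply (has_cderiv_comp csin); [exact Hl|]. apply has_cderiv_scal, has_cderiv_id.
      * apply has_cderiv_scal, has_cderiv_inv, Hz.
Qed.

End Sinc.

Lemma csin_opp (z : C) : csin (- z) = (- csin z)%C.
Proof.
  destruct z as [x y]. apply injective_projections; unfold csin, sinh, cosh; simpl;
    rewrite ?sin_neg, ?cos_neg, Ropp_involutive; field.
Qed.

Lemma csin_conj (z : C) : csin (Cconj z) = Cconj (csin z).
Proof.
  destruct z as [x y]. apply injective_projections; unfold csin, sinh, cosh; simpl;
    rewrite ?Ropp_involutive; field.
Qed.

Lemma sincD_opp (D : R) (z : C) : sincD D (- z) = sincD D z.
Proof.
  unfold sincD. destruct (excluded_middle_informative (- z = 0%C)%C) as [H|H];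
    destruct (excluded_middle_informative (z = 0%C)) as [H'|H'].
  - reflexivity.
  - elim H'. replace z with (- - z)%C by ring. rewrite H. ring.
  - elim H. rewrite H'. ring.
  - replace (RtoC (PI * D) * - z)%C with (- (RtoC (PI * D) * z))%C by ring.
    rewrite csin_opp. field. split; [exact H'|apply CPI_neq_0].
Qed.

Lemma sincD_conj (D : R) (z : C) : sincD D (Cconj z) = Cconj (sincD D z).
Proof.
  unfold sincD. destruct (excluded_middle_informative (Cconj z = 0%C)%C) as [H|H];
    destruct (excluded_middle_informative (z = 0%C)) as [H'|H'].
  - apply injective_projections; simpl; ring.
  - elim H'. rewrite <- (Cconj_conj z), H. apply injective_projections; simpl; ring.
  - elim H. rewrite H'. apply injective_projections; simpl; ring.
  - assert (HR : forall r : R, Cconj (RtoC r) = RtoC r) by (intros; apply injective_projections; simpl; ring).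
    rewrite Cdiv_conj, !Cmult_conj, !HR, <- csin_conj, Cmult_conj, HR; [reflexivity|].
    apply Cmult_neq_0; [apply CPI_neq_0|exact H'].
Qed.

(** * Difference quotients and complex differentiability *)

(** When [G w = 0] and [l] is the derivative of [G] at [w], this is continuous at [w] and inherits
    differentiability elsewhere, which is exactly what [primitive_punctured] asks for. *)
Definition dquot (G : C -> C) (w l z : C) : C :=
  if excluded_middle_informative (z = w) then l else (G z / (z - w))%C.

Lemma dquot_mult (G : C -> C) (w l z : C) : G w = 0%C -> (dquot G w l z * (z - w))%C = G z.
Proof.
  intros H0. unfold dquot. destruct (excluded_middle_informative (z = w)) as [->|Hz].
  - rewrite H0. ring.
  - field. apply Cminus_eq_contra, Hz.
Qed.

Lemma dquot_ccont (G : C -> C) (w l : C) : G w = 0%C -> has_cderiv G w l ->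
  ccont (dquot G w l) w.
Proof.
  intros H0 H eps He. destruct (H (eps / 2)) as [d [Hd H']]; [lra|].
  exists d; split; [exact Hd|]. intros u Hu. unfold dquot.
  destruct (excluded_middle_informative (w = w)) as [_|E]; [|now elim E].
  destruct (excluded_middle_informative (u = w)) as [E|E].
  - replace (l - l)%C with (RtoC 0) by ring. rewrite Cmod_0. exact He.
  - specialize (H' u Hu). rewrite H0 in H'. apply Cminus_eq_contra in E.
    assert (Hm := E). apply Cmod_gt_0 in Hm.
    replace (G u / (u - w) - l)%C with ((G u - 0 - l * (u - w)) * / (u - w))%C by (field; exact E).
    rewrite Cmod_mult, Cmod_inv by exact E.
    apply Rle_lt_trans with (eps / 2); [|lra]. apply Rle_div_l; assumption.
Qed.

Lemma dquot_diff (G : C -> C) (w l z : C) : z <> w -> (exists a, has_cderiv G z a) ->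
  exists a, has_cderiv (dquot G w l) z a.
Proof.
  intros Hz [a Ha]. eexists.
  apply has_cderiv_ext_loc with (f := fun u => (G u * / (u - w))%C) (r := Cmod (z - w)).
  - apply Cmod_gt_0, Cminus_eq_contra, Hz.
  - intros u Hu. unfold dquot. destruct (excluded_middle_informative (u = w)) as [->|E]; [|reflexivity].
    exfalso. rewrite Cmod_sub_sym in Hu. lra.
  - apply has_cderiv_mult; [exact Ha|].
    apply (has_cderiv_comp Cinv); [apply has_cderiv_inv, Cminus_eq_contra, Hz|].
    apply has_cderiv_minus; [apply has_cderiv_id|apply has_cderiv_const].
Qed.

Definition cdiff (f : C -> C) (z : C) : Prop := exists l, has_cderiv f z l.

Lemma cdiff_ccont (f : C -> C) (z : C) : cdiff f z -> ccont f z.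
Proof. intros [l H]. apply (has_cderiv_ccont _ _ _ H). Qed.

Lemma cdiff_const (c z : C) : cdiff (fun _ => c) z.
Proof. eexists. apply has_cderiv_const. Qed.

Lemma cdiff_id (z : C) : cdiff (fun u => u) z.
Proof. eexists. apply has_cderiv_id. Qed.

Lemma cdiff_minus (f g : C -> C) (z : C) : cdiff f z -> cdiff g z -> cdiff (fun u => f u - g u)%C z.
Proof. intros [a Ha] [b Hb]. eexists. apply has_cderiv_minus; eassumption. Qed.

Lemma cdiff_mult (f g : C -> C) (z : C) : cdiff f z -> cdiff g z -> cdiff (fun u => f u * g u)%C z.
Proof. intros [a Ha] [b Hb]. eexists. apply has_cderiv_mult; eassumption. Qed.

Lemma cdiff_comp (f g : C -> C) (z : C) : cdiff f (g z) -> cdiff g z -> cdiff (fun u => f (g u)) z.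
Proof. intros [a Ha] [b Hb]. eexists. apply (has_cderiv_comp f g); eassumption. Qed.

Lemma cdiff_cexp (g : C -> C) (z : C) : cdiff g z -> cdiff (fun u => cexp (g u)) z.
Proof. apply cdiff_comp. eexists. apply has_cderiv_cexp. Qed.

Ltac cdiff_tac := repeat first [assumption | apply cdiff_const | apply cdiff_id
  | apply cdiff_minus | apply cdiff_mult | apply cdiff_cexp].

(** * Rotation of the contour in a sector *)

(** For nonnegative [g], the Cauchy criterion at [+oo]; tails at [-oo] are expressed through
    [g (- t)]. *)
Definition tail_small (g : R -> R) : Prop :=
  forall eta, 0 < eta -> exists N, forall a b, N <= a -> a <= b -> RInt g a b <= eta.

Lemma ex_RInt_Cmod (f : R -> C) (a b : R) : (forall t, rcont f t) -> ex_RInt (fun t => Cmod (f t)) a b.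
Proof.
  intros H. apply (ex_RInt_continuous (V := R_CompleteNormedModule)). intros z _. apply rcont_Cmod, H.
Qed.

Lemma tail_small_dom (f : R -> C) (g : R -> R) (r : R) : (forall t, rcont f t) ->
  (forall a b, r <= a -> a <= b -> ex_RInt g a b) ->
  (forall t, r <= t -> Cmod (f t) <= g t) -> tail_small g -> tail_small (fun t => Cmod (f t)).
Proof.
  intros Hf Hg H Ht eta He. destruct (Ht eta He) as [N HN]. exists (Rmax N r).
  intros a b Ha Hab.
  assert (Ha1 : N <= a) by (eapply Rle_trans; [apply Rmax_l|exact Ha]).
  assert (Ha2 : r <= a) by (eapply Rle_trans; [apply Rmax_r|exact Ha]).
  eapply Rle_trans; [|apply (HN a b); assumption].
  apply RInt_le; [exact Hab|apply ex_RInt_Cmod, Hf|apply Hg; assumption|].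
  intros t Ht'. apply H. lra.
Qed.

Lemma RInt_exp_neg (M a b : R) : is_RInt (fun t => M * exp (- t)) a b (M * exp (- a) - M * exp (- b)).
Proof.
  replace (M * exp (- a) - M * exp (- b)) with (minus (- (M * exp (- b))) (- (M * exp (- a))))
    by (unfold minus, plus, opp; simpl; ring).
  apply (is_RInt_derive (V := R_CompleteNormedModule) (fun t => - (M * exp (- t)))).
  - intros x _. auto_derive; auto. ring.
  - intros x _. apply (ex_derive_continuous (V := R_NormedModule)). auto_derive; auto.
Qed.

Lemma exp_neg_le_inv (T : R) : 0 < T -> exp (- T) <= / T.
Proof.
  intros HT. rewrite exp_Ropp. apply Rinv_le_contravar; [exact HT|].
  assert (H := exp_ineq1_le T). lra.
Qed.

Lemma tail_small_exp (M : R) : 0 <= M -> tail_small (fun t => M * exp (- t)).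
Proof.
  intros HM eta He. exists ((M + 1) / eta). intros a b Ha Hab.
  rewrite (is_RInt_unique _ _ _ _ (RInt_exp_neg M a b)).
  assert (Hp : 0 < (M + 1) / eta) by (apply Rdiv_lt_0_compat; lra).
  assert (H1 := exp_neg_le_inv a ltac:(lra)). assert (H2 := exp_pos (- b)).
  assert (H3 : M * exp (- a) <= eta).
  { apply Rle_trans with ((M + 1) * / a).
    - apply Rmult_le_compat; [lra|apply Rlt_le, exp_pos|lra|exact H1].
    - apply Rle_div_l; [lra|]. apply Rle_div_l in Ha; [|lra]. lra. }
  nra.
Qed.

Lemma CI_mult_le (f g : R -> C) (c a b : R) : a <= b -> 0 <= c ->
  (forall t, rcont f t) -> (forall t, rcont g t) ->
  (forall t, a <= t <= b -> Cmod (g t) <= c) ->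
  Cmod (CI (fun t => f t * g t)%C a b) <= c * RInt (fun t => Cmod (f t)) a b.
Proof.
  intros Hab Hc Hf Hg H.
  assert (Hex := ex_RInt_Cmod f a b Hf).
  replace (c * RInt (fun t => Cmod (f t)) a b) with (RInt (fun t => scal c (Cmod (f t))) a b)
    by (rewrite (RInt_scal (V := R_CompleteNormedModule)) by exact Hex; reflexivity).
  apply CI_norm; [exact Hab|intros t; apply rcont_mult; auto|apply (ex_RInt_scal (V := R_NormedModule)), Hex|].
  intros t Ht. rewrite Cmod_mult, Rmult_comm. apply Rmult_le_compat_r; [apply Cmod_ge_0|apply H, Ht].
Qed.

Lemma RInt_Cmod_pos (f : R -> C) (a b : R) : a <= b -> (forall t, rcont f t) ->
  0 <= RInt (fun t => Cmod (f t)) a b.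
Proof.
  intros Hab Hf. apply RInt_ge_0; [exact Hab|apply ex_RInt_Cmod, Hf|]. intros; apply Cmod_ge_0.
Qed.

Lemma gaussian_beats_exp (M A eps N eta : R) : 0 <= M -> 0 <= A -> 0 < eps -> 0 < eta ->
  exists T, N <= T /\ 0 < T /\ M * exp (A * T - eps * T ^ 2) * T <= eta.
Proof.
  intros HM HA He Ht.
  (* [(A + 2) / eps] makes the exponent at most [-2 T]. Of the two factors [exp (- T)], one absorbs
     [T]; the other is at most [1 / T], and [M / eta] finishes. *)
  set (T := Rmax N (Rmax 1 (Rmax ((A + 2) / eps) (M / eta)))).
  assert (H1 : N <= T) by apply Rmax_l.
  assert (H2 : 1 <= T) by (eapply Rle_trans; [apply Rmax_l|apply Rmax_r]).
  assert (H3 : (A + 2) / eps <= T).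
  { eapply Rle_trans; [|apply Rmax_r]. eapply Rle_trans; [|apply Rmax_r]. apply Rmax_l. }
  assert (H4 : M / eta <= T).
  { eapply Rle_trans; [|apply Rmax_r]. eapply Rle_trans; [|apply Rmax_r]. apply Rmax_r. }
  exists T. split; [exact H1|split; [lra|]].
  apply Rle_div_l in H3; [|lra]. apply Rle_div_l in H4; [|lra].
  apply Rle_trans with (M * (exp (- T) * exp (- T)) * T).
  - apply Rmult_le_compat_r; [lra|]. apply Rmult_le_compat_l; [exact HM|].
    rewrite <- exp_plus. apply exp_le. nra.
  - assert (E := exp_neg_le_inv T ltac:(lra)). assert (P := exp_pos (- T)).
    assert (E1 : exp (- T) * T <= 1).
    { apply Rle_trans with (/ T * T); [apply Rmult_le_compat_r; lra|]. right; field; lra. }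
    apply Rle_trans with (M * exp (- T)); [|].
    + replace (M * (exp (- T) * exp (- T)) * T) with (M * exp (- T) * (exp (- T) * T)) by ring.
      rewrite <- (Rmult_1_r (M * exp (- T))) at 2. apply Rmult_le_compat_l; [|exact E1].
      apply Rmult_le_pos; lra.
    + apply Rle_trans with (M * / T); [apply Rmult_le_compat_l; lra|]. apply Rle_div_l; lra.
Qed.

Lemma rcont_ray (f : C -> C) (b : C) (t : R) : (forall z, ccont f z) -> rcont (fun s => f (RtoC s * b)%C) t.
Proof.
  intros Hf. apply rcont_ext with (f := fun s => f (0 + RtoC s * b)%C).
  { intros s. now rewrite Cplus_0_l. }
  apply (rcont_comp f); [apply Hf|apply rcont_line].
Qed.

Lemma CI_ray (f P : C -> C) (b : C) (N : R) : (forall z, ccont f z) -> (forall z, has_cderiv P z (f z)) ->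
  (b * CI (fun t => f (RtoC t * b)) 0 N)%C = (P (RtoC N * b) - P 0)%C.
Proof.
  intros Hf HP. assert (E := CI_FTC_line P f 0 b 0 N HP Hf).
  rewrite Cmult_comm. replace (RtoC N * b)%C with (0 + RtoC N * b)%C by ring.
  replace (P 0%C) with (P (0 + RtoC 0 * b)%C) by (f_equal; ring). rewrite <- E. f_equal.
  apply CI_ext. intros t. f_equal. ring.
Qed.

Section Sector.

Variables (f : C -> C) (p : C) (k : R).
Hypothesis Hf : forall z, ccont f z.
Hypothesis Hd : forall z, z <> p -> cdiff f z.

Let b : C := (1, k).
(* On the segment from [T] to [T(1 + ik)] the real part of [(1 - ik) z^2] is at least [T^2]. *)
Let reg (eps : R) (z : C) : C := cexp (RtoC (- eps) * ((1, - k) * (z * z))).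

Lemma reg_cdiff (eps : R) (z : C) : cdiff (reg eps) z.
Proof. unfold reg. cdiff_tac. Qed.

Lemma regularized_ccont (eps : R) (z : C) : ccont (fun z => f z * reg eps z)%C z.
Proof. apply ccont_mult; [apply Hf|apply cdiff_ccont, reg_cdiff]. Qed.

Lemma Cmod_reg_segment (eps T s : R) : 0 <= eps -> 0 <= s * (2 * k * T - s) ->
  Cmod (reg eps (T, s)) <= exp (- (eps * T ^ 2)).
Proof.
  intros He Hs. unfold reg. rewrite Cmod_cexp. apply exp_le.
  assert (H := Rmult_le_pos _ _ He Hs). simpl.
  lra.
Qed.

(** On the ray, [(1 - ik)(1 + ik)^2 = (1 + k^2)(1 + ik)] has positive real part. The factor [1 - ik]
    turns [z^2] so that its arguments over the sector run between [-arctan k] and [arctan k]; this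
    works however steep the ray is. *)
Lemma Cmod_reg_ray (eps t : R) (z : C) : 0 <= eps -> z = RtoC t \/ z = (RtoC t * b)%C ->
  Cmod (reg eps z) <= 1.
Proof.
  intros He Hz. unfold reg. rewrite Cmod_cexp. apply Rle_trans with (exp 0); [apply exp_le|rewrite exp_0; lra].
  assert (Ht : 0 <= eps * t ^ 2) by (apply Rmult_le_pos; [lra|apply pow2_ge_0]).
  assert (Hk : 0 <= eps * (t ^ 2 * k ^ 2)).
  { apply Rmult_le_pos; [lra|]. apply Rmult_le_pos; apply pow2_ge_0. }
  destruct Hz as [->| ->]; unfold b; simpl; simpl in Ht, Hk; lra.
Qed.

Lemma b_Cmod_ge_1 : 1 <= Cmod b.
Proof.
  assert (H := re_le_Cmod b). unfold b in *; simpl in H. rewrite Rabs_R1 in H. exact H.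
Qed.

(** A primitive of the regularized function reduces the difference of the two edges to the vertical
    segment from [T] to [T(1 + ik)], where Gaussian decay beats the growth. A single [T] beyond each
    [N] suffices later, and it may depend on [eps]. *)
Lemma regularized_rotation (A M r0 N delta eps : R) :
  0 <= A -> 0 <= M -> 0 < eps -> 0 < delta ->
  (forall z, r0 <= Cmod z -> Cmod (f z) <= M * exp (A * Cmod z)) ->
  exists T, N <= T /\
    Cmod (CI (fun t => f (RtoC t) * reg eps (RtoC t))%C 0 T
          - b * CI (fun t => f (RtoC t * b) * reg eps (RtoC t * b))%C 0 T) <= delta.
Proof.
  intros HA HM He Hdel Hg.
  set (g := fun z => (f z * reg eps z)%C).
  assert (Hgc : forall z, ccont g z) by (intros z; apply regularized_ccont).
  destruct (primitive_punctured g p Hgc) as [P HP].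
  { intros z Hz. apply cdiff_mult; [apply Hd, Hz|apply reg_cdiff]. }
  assert (Hk := Rabs_pos k).
  (* On the segment [|z| <= (1 + |k|) T], and its length is [|k| T]. *)
  destruct (gaussian_beats_exp (M * Rabs k) (A * (1 + Rabs k)) eps (Rmax N r0) delta)
    as [T [HT1 [HT2 HT3]]]; [nra|nra|exact He|exact Hdel|].
  exists T.
  assert (HTN : N <= T) by (eapply Rle_trans; [apply Rmax_l|exact HT1]).
  assert (HTr : r0 <= T) by (eapply Rle_trans; [apply Rmax_r|exact HT1]).
  split; [exact HTN|].
  assert (E1 := CI_ray g P 1 T Hgc HP). assert (E2 := CI_ray g P b T Hgc HP).
  replace (CI (fun t => f (RtoC t) * reg eps (RtoC t))%C 0 T) with (P (RtoC T) - P 0)%C.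
  2:{ rewrite Cmult_1_l, Cmult_1_r in E1. rewrite <- E1. apply CI_ext. intros t. unfold g.
      now rewrite Cmult_1_r. }
  change (fun t => (f (RtoC t * b) * reg eps (RtoC t * b))%C) with (fun t => g (RtoC t * b)%C).
  rewrite E2.
  assert (E3 := CI_FTC_line P g (RtoC T) Ci 0 (k * T) HP Hgc).
  replace (RtoC T + RtoC 0 * Ci)%C with (RtoC T) in E3 by ring.
  replace (RtoC T + RtoC (k * T) * Ci)%C with (RtoC T * b)%C in E3
    by (unfold b; apply injective_projections; simpl; ring).
  replace (P (RtoC T) - P 0 - (P (RtoC T * b) - P 0))%C
    with (- (P (RtoC T * b) - P (RtoC T)))%C by ring.
  rewrite Cmod_opp, <- E3, Cmod_mult, Cmod_Ci, Rmult_1_r.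
  eapply Rle_trans; [apply (CI_norm_const _ (M * exp (A * (1 + Rabs k) * T - eps * T ^ 2)))|].
  - intros t. apply (rcont_comp g); [apply Hgc|apply rcont_line].
  - intros s Hs. rewrite <- vertical_line. unfold g. rewrite Cmod_mult.
    replace (A * (1 + Rabs k) * T - eps * T ^ 2) with (A * (1 + Rabs k) * T + - (eps * T ^ 2)) by ring.
    rewrite exp_plus, <- Rmult_assoc.
    assert (Hsk : Rabs s <= Rabs k * T /\ 0 <= s * (2 * k * T - s)).
    { unfold Rmin, Rmax in Hs. destruct (Rle_dec 0 (k * T)) as [HkT|HkT].
      - assert (0 <= k) by nra. rewrite !Rabs_right by lra. split; nra.
      - assert (k < 0) by nra. rewrite (Rabs_left k) by lra. rewrite Rabs_left1 by lra. split; nra. }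
    destruct Hsk as [Hs1 Hs2].
    apply Rmult_le_compat; [apply Cmod_ge_0|apply Cmod_ge_0| |].
    + assert (Hz1 : T <= Cmod (T, s)).
      { assert (H := re_le_Cmod (T, s)). simpl in H. rewrite Rabs_right in H by lra. exact H. }
      assert (Hz2 : Cmod (T, s) <= (1 + Rabs k) * T).
      { eapply Rle_trans; [apply Cmod_le_Re_Im|]. simpl. rewrite (Rabs_right T) by lra. lra. }
      eapply Rle_trans; [apply Hg; lra|]. apply Rmult_le_compat_l; [exact HM|]. apply exp_le.
      rewrite Rmult_assoc. apply Rmult_le_compat_l; assumption.
    + apply Cmod_reg_segment; lra.
  - rewrite Rminus_0_r, Rabs_mult, (Rabs_right T) by lra.
    replace (M * exp (A * (1 + Rabs k) * T - eps * T ^ 2) * (Rabs k * T))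
      with (M * Rabs k * exp (A * (1 + Rabs k) * T - eps * T ^ 2) * T) by ring. exact HT3.
Qed.

(** On the part of either edge given by [0 <= t <= N], the regularizer tends to 1 uniformly as [eps]
    tends to 0. *)
Lemma reg_near_1 (eps t N : R) (z : C) : 0 <= eps <= 1 -> 0 <= t <= N ->
  z = RtoC t \/ z = (RtoC t * b)%C ->
  Cmod (reg eps z - 1) <= eps * (Cmod b ^ 3 * N ^ 2 * exp (Cmod b ^ 3 * N ^ 2)).
Proof.
  intros He Ht Hz. set (K := Cmod b ^ 3 * N ^ 2). assert (Hb := b_Cmod_ge_1).
  assert (HK : 0 <= K) by (apply Rmult_le_pos; apply pow_le; lra).
  unfold reg. eapply Rle_trans; [apply cexp_remainder1|].
  rewrite !Cmod_mult, Cmod_R, Rabs_Ropp, (Rabs_right eps) by lra.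
  assert (Hq : Cmod (1, - k) = Cmod b).
  { rewrite <- (Cmod_conj b). reflexivity. }
  rewrite Hq.
  assert (Hzb : Cmod z <= N * Cmod b).
  { destruct Hz as [->| ->]; rewrite ?Cmod_mult, Cmod_R, Rabs_right by lra; nra. }
  assert (Hz0 := Cmod_ge_0 z).
  assert (HzK : Cmod b * (Cmod z * Cmod z) <= K).
  { replace K with (Cmod b * ((N * Cmod b) * (N * Cmod b))) by (unfold K; ring).
    apply Rmult_le_compat_l; [lra|]. apply Rmult_le_compat; assumption. }
  assert (Hpos : 0 <= Cmod b * (Cmod z * Cmod z)) by (apply Rmult_le_pos; [lra|nra]).
  set (y := Cmod b * (Cmod z * Cmod z)) in *.
  rewrite Rmult_assoc. apply Rmult_le_compat_l; [lra|].
  apply Rmult_le_compat; [exact Hpos|apply Rlt_le, exp_pos|exact HzK|]. apply exp_le. nra.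
Qed.

Lemma CI_regularize (h : R -> C) (g : R -> C) (c N : R) : 0 <= N -> 0 <= c ->
  (forall t, rcont h t) -> (forall t, rcont g t) ->
  (forall t, 0 <= t <= N -> Cmod (g t - 1) <= c) ->
  Cmod (CI (fun t => h t * g t)%C 0 N - CI h 0 N) <= c * RInt (fun t => Cmod (h t)) 0 N.
Proof.
  intros HN Hc Hh Hgc H.
  rewrite <- CI_minus; [|intros t; apply rcont_mult; auto|exact Hh].
  rewrite (CI_ext _ (fun t => h t * (g t - 1))%C) by (intros; ring).
  apply CI_mult_le; auto. intros t. apply rcont_minus; [auto|apply rcont_const].
Qed.

(** The order of choices carries the argument: [N] is fixed by the tails, then [eps] in terms of
    [N], then [T >= N] in terms of [eps]. The piece from [N] to [T] stays small uniformly in [eps],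
    because the regularizer is bounded by 1 on both edges. Four errors of [eta / 4] result: the
    rotation up to [T], one tail on each edge, and the removal of the regularizer on [[0, N]]. *)
Lemma sector_rotation (A M r0 : R) :
  0 <= A -> 0 <= M ->
  (forall z, r0 <= Cmod z -> Cmod (f z) <= M * exp (A * Cmod z)) ->
  tail_small (fun t => Cmod (f (RtoC t))) ->
  tail_small (fun t => Cmod (f (RtoC t * b)%C)) ->
  forall eta, 0 < eta -> exists N0, forall N, N0 <= N ->
    Cmod (CI (fun t => f (RtoC t)) 0 N - b * CI (fun t => f (RtoC t * b)%C) 0 N) <= eta.
Proof.
  intros HA HM Hg Ht1 Ht2 eta He.
  assert (Hb := b_Cmod_ge_1).
  destruct (Ht1 (eta / 4)) as [N1 HN1]; [lra|].
  destruct (Ht2 (eta / 4 / Cmod b)) as [N2 HN2]; [apply Rdiv_lt_0_compat; lra|].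
  exists (Rmax 0 (Rmax N1 N2)). intros N HN.
  assert (HN0 : 0 <= N) by (eapply Rle_trans; [apply Rmax_l|exact HN]).
  assert (HN1' : N1 <= N).
  { eapply Rle_trans; [|exact HN]. eapply Rle_trans; [|apply Rmax_r]. apply Rmax_l. }
  assert (HN2' : N2 <= N).
  { eapply Rle_trans; [|exact HN]. eapply Rle_trans; [|apply Rmax_r]. apply Rmax_r. }
  set (f1 := fun t => f (RtoC t)). set (f2 := fun t => f (RtoC t * b)%C).
  assert (Hf1 : forall t, rcont f1 t) by (intros t; apply (rcont_comp f); [apply Hf|apply rcont_RtoC]).
  assert (Hf2 : forall t, rcont f2 t) by (intros t; apply rcont_ray, Hf).
  set (I1 := RInt (fun t => Cmod (f1 t)) 0 N). set (I2 := RInt (fun t => Cmod (f2 t)) 0 N).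
  assert (HI1 : 0 <= I1) by (apply RInt_Cmod_pos; assumption).
  assert (HI2 : 0 <= I2) by (apply RInt_Cmod_pos; assumption).
  set (K := Cmod b ^ 3 * N ^ 2 * exp (Cmod b ^ 3 * N ^ 2)).
  assert (HK : 0 <= K).
  { apply Rmult_le_pos; [|apply Rlt_le, exp_pos]. apply Rmult_le_pos; apply pow_le; lra. }
  (* [eps * L] dominates the joint cost, on both edges, of replacing the regularizer by 1; the
     summand 1 keeps [L] positive. *)
  set (L := K * (I1 + Cmod b * I2) + 1).
  assert (HL : 1 <= L).
  { unfold L. assert (0 <= K * (I1 + Cmod b * I2)); [|lra].
    apply Rmult_le_pos; [exact HK|]. apply Rplus_le_le_0_compat; [exact HI1|]. apply Rmult_le_pos; lra. }
  set (eps := Rmin 1 (eta / 4 / L)).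
  assert (Heps0 : 0 < eps).
  { unfold eps. apply Rmin_pos; [lra|]. apply Rdiv_lt_0_compat; lra. }
  assert (Heps1 : eps <= 1) by apply Rmin_l.
  assert (HepsL : eps * L <= eta / 4).
  { apply Rle_trans with (eta / 4 / L * L); [apply Rmult_le_compat_r; [lra|apply Rmin_r]|].
    right; field; lra. }
  destruct (regularized_rotation A M r0 N (eta / 4) eps) as [T [HT Hrot]]; try assumption; try lra.
  set (g1 := fun t => reg eps (RtoC t)). set (g2 := fun t => reg eps (RtoC t * b)%C).
  assert (Hrc : forall z, ccont (reg eps) z) by (intros z; apply cdiff_ccont, reg_cdiff).
  assert (Hg1 : forall t, rcont g1 t) by (intros t; apply (rcont_comp (reg eps)); [apply Hrc|apply rcont_RtoC]).
  assert (Hg2 : forall t, rcont g2 t) by (intros t; apply rcont_ray, Hrc).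
  change (fun t => (f (RtoC t) * reg eps (RtoC t))%C) with (fun t => (f1 t * g1 t)%C) in Hrot.
  change (fun t => (f (RtoC t * b) * reg eps (RtoC t * b))%C) with (fun t => (f2 t * g2 t)%C) in Hrot.
  assert (Hm1 : forall t, rcont (fun t => f1 t * g1 t)%C t) by (intros; apply rcont_mult; auto).
  assert (Hm2 : forall t, rcont (fun t => f2 t * g2 t)%C t) by (intros; apply rcont_mult; auto).
  assert (B1 : Cmod (CI (fun t => f1 t * g1 t)%C N T) <= eta / 4).
  { eapply Rle_trans; [apply (CI_mult_le f1 g1 1); try assumption; try lra|].
    - intros t _. apply (Cmod_reg_ray eps t); [lra|left; reflexivity].
    - rewrite Rmult_1_l. apply HN1; lra. }
  assert (B2 : Cmod (b * CI (fun t => f2 t * g2 t)%C N T) <= eta / 4).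
  { rewrite Cmod_mult. apply Rle_trans with (Cmod b * (eta / 4 / Cmod b)); [|right; field; lra].
    apply Rmult_le_compat_l; [lra|].
    eapply Rle_trans; [apply (CI_mult_le f2 g2 1); try assumption; try lra|].
    - intros t _. apply (Cmod_reg_ray eps t); [lra|right; reflexivity].
    - rewrite Rmult_1_l. apply HN2; lra. }
  assert (HeK : 0 <= eps * K) by (apply Rmult_le_pos; lra).
  assert (B3 := CI_regularize f1 g1 (eps * K) N HN0 HeK Hf1 Hg1
    (fun t Ht => reg_near_1 eps t N _ (conj (Rlt_le _ _ Heps0) Heps1) Ht (or_introl eq_refl))).
  assert (B4 := CI_regularize f2 g2 (eps * K) N HN0 HeK Hf2 Hg2
    (fun t Ht => reg_near_1 eps t N _ (conj (Rlt_le _ _ Heps0) Heps1) Ht (or_intror eq_refl))).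
  fold I1 in B3. fold I2 in B4.
  rewrite <- (CI_Chasles _ 0 N T Hm1), <- (CI_Chasles _ 0 N T Hm2) in Hrot.
  set (u1 := CI (fun t => f1 t * g1 t)%C 0 N) in *. set (u2 := CI (fun t => f2 t * g2 t)%C 0 N) in *.
  set (v1 := CI (fun t => f1 t * g1 t)%C N T) in *. set (v2 := CI (fun t => f2 t * g2 t)%C N T) in *.
  replace (CI f1 0 N - b * CI f2 0 N)%C with
    ((u1 + v1 - b * (u2 + v2)) - v1 + b * v2 - (u1 - CI f1 0 N) + b * (u2 - CI f2 0 N))%C by ring.
  eapply Rle_trans; [apply Cmod_triangle|].
  eapply Rle_trans; [apply Rplus_le_compat_r, Cmod_sub_le|].
  eapply Rle_trans; [apply Rplus_le_compat_r, Rplus_le_compat_r, Cmod_triangle|].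
  eapply Rle_trans; [apply Rplus_le_compat_r, Rplus_le_compat_r, Rplus_le_compat_r, Cmod_sub_le|].
  rewrite (Cmod_mult b (u2 - CI f2 0 N)).
  assert (B4' : Cmod b * Cmod (u2 - CI f2 0 N) <= Cmod b * (eps * K * I2)) by (apply Rmult_le_compat_l; lra).
  assert (eps * L = eps * K * I1 + Cmod b * (eps * K * I2) + eps) by (unfold L; ring).
  lra.
Qed.

End Sector.

Lemma rcont_opp (f : R -> C) (t : R) : (forall t, rcont f t) -> rcont (fun s => f (- s)) t.
Proof.
  intros Hf eps He. destruct (Hf (- t) eps He) as [d [Hd H]]. exists d; split; [exact Hd|].
  intros s Hs. apply H. replace (- s - - t) with (- (s - t)) by ring. now rewrite Rabs_Ropp.
Qed.

Lemma CI_reflect (f : R -> C) (a b : R) : (forall t, rcont f t) ->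
  CI (fun t => f (- t)%R) a b = CI f (- b) (- a).
Proof.
  intros Hf. assert (E := CI_comp_lin f (-1) 0 a b Hf).
  replace (-1 * a + 0) with (- a) in E by ring. replace (-1 * b + 0) with (- b) in E by ring.
  rewrite CI_scal in E.
  2:{ intros t. apply rcont_ext with (f := fun t => f (- t)%R).
      - intros s. f_equal. ring.
      - apply rcont_opp, Hf. }
  rewrite (CI_ext _ (fun t => f (- t)%R)) in E by (intros t; f_equal; ring).
  rewrite (CI_swap f (- b) (- a) Hf) in E.
  replace (CI (fun t => f (- t)%R) a b) with (- (RtoC (-1) * CI (fun t => f (- t)%R) a b))%C
    by (replace (RtoC (-1)) with (- (1))%C by (apply injective_projections; simpl; ring); ring).
  rewrite E. ring.
Qed.

Lemma CI_sym (f : R -> C) (N : R) : (forall t, rcont f t) ->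
  CI f (- N) N = (CI f 0 N + CI (fun t => f (- t)%R) 0 N)%C.
Proof.
  intros Hf. rewrite (CI_reflect f 0 N Hf), Ropp_0, Cplus_comm. symmetry. apply CI_Chasles, Hf.
Qed.

(** * Vanishing of Fourier integrals at and above the exponential type *)

(** The bound is asked only outside a disc: a difference quotient inherits it from its numerator
    where [|z - w| >= 1], and no estimate near the removable point has to be made. *)
Definition growth_le (f : C -> C) (tau : R) : Prop :=
  forall eps, 0 < eps -> exists M r0, 0 <= M /\
    forall z, r0 <= Cmod z -> Cmod (f z) <= M * exp ((tau + eps) * Cmod z).

Definition vanishing_integral (f : R -> C) : Prop :=
  forall eta, 0 < eta -> exists N0, forall N, N0 <= N -> Cmod (CI f (- N) N) <= eta.

Section HalfPlane.

Variables (Q : C -> C) (p : C) (tau : R).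
Hypothesis Hc : forall z, ccont Q z.
Hypothesis Hd : forall z, z <> p -> cdiff Q z.
Hypothesis Htau : 0 < tau.
Hypothesis Hg : growth_le Q tau.
Hypothesis Ht1 : tail_small (fun t => Cmod (Q (RtoC t))).
Hypothesis Ht2 : tail_small (fun t => Cmod (Q (RtoC (- t)%R))).

Lemma Cmod_cexp_real (s x : R) : Cmod (cexp (Ci * RtoC s * RtoC x)) = 1.
Proof. rewrite Cmod_cexp. transitivity (exp 0); [f_equal; simpl; ring|apply exp_0]. Qed.

Lemma tail_small_ext (f g : R -> R) : (forall t, f t = g t) -> tail_small f -> tail_small g.
Proof.
  intros E H eta He. destruct (H eta He) as [N HN]. exists N. intros a b Ha Hab.
  rewrite <- (RInt_ext (V := R_CompleteNormedModule) f g) by (intros; apply E). apply HN; assumption.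
Qed.

(** Both half-lines are rotated onto steep rays from 0. Along these a primitive is available, so the
    two ray integrals combine into the integral over the horizontal segment joining their ends at
    height [N k]. There the integrand is at most [M exp (- N)], against a length of [2 N]. *)
Lemma vanishing_above_type (tau' : R) : tau < tau' ->
  vanishing_integral (fun t => Q (RtoC t) * cexp (Ci * RtoC tau' * RtoC t))%C.
Proof.
  intros Hlt eta He.
  destruct (Hg ((tau' - tau) / 2)) as [M [r0 [HM HMg]]]; [lra|].
  set (s := tau + (tau' - tau) / 2) in *.
  assert (Hs : tau < s < tau') by (unfold s; lra).
  (* At height [t k] between the rays, [|z| <= t (1 + k)], so the modulus is at most
     [M exp (t (s (1 + k) - tau' k))]. This [k] makes the exponent exactly [- t]. *)
  set (k := (s + 1) / (tau' - s)).
  assert (Hk : 0 < k) by (apply Rdiv_lt_0_compat; lra).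
  assert (Hks : tau' * k = s * (1 + k) + 1).
  { replace (tau' * k) with (s * k + (tau' - s) * k) by ring.
    replace ((tau' - s) * k) with (s + 1) by (unfold k; field; lra). ring. }
  set (f := fun z => (Q z * cexp (Ci * RtoC tau' * z))%C).
  assert (Hfc : forall z, ccont f z).
  { intros z. apply ccont_mult; [apply Hc|]. apply cdiff_ccont. cdiff_tac. }
  assert (Hfd : forall z, z <> p -> cdiff f z).
  { intros z Hz. assert (Hz' := Hd z Hz). unfold f. cdiff_tac. }
  assert (Hmod : forall z, Cmod (f z) = Cmod (Q z) * exp (- tau' * Im z)).
  { intros [x y]. unfold f. rewrite Cmod_mult, Cmod_cexp. do 2 f_equal. simpl. ring. }
  assert (Hfg : forall z, r0 <= Cmod z -> Cmod (f z) <= M * exp ((s + tau') * Cmod z)).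
  { intros z Hz. rewrite Hmod.
    replace ((s + tau') * Cmod z) with (s * Cmod z + tau' * Cmod z) by ring.
    rewrite exp_plus, <- Rmult_assoc.
    apply Rmult_le_compat; [apply Cmod_ge_0|apply Rlt_le, exp_pos|apply HMg, Hz|].
    apply exp_le. assert (Hi := im_le_Cmod z).
    assert (- Im z <= Cmod z) by (eapply Rle_trans; [|exact Hi]; rewrite <- Rabs_Ropp; apply Rle_abs).
    nra. }
  (* Valid on the whole horizontal chord at height [t k]: its ends give the tails along the rays,
     its interior the closing segment. *)
  assert (Hcone : forall t x, r0 <= t * k -> 0 <= t -> Rabs x <= t -> Cmod (f (x, t * k)) <= M * exp (- t)).
  { intros t x Hr Ht0 Hx. rewrite Hmod. simpl.
    assert (Hz1 : t * k <= Cmod (x, t * k)).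
    { assert (Hi := im_le_Cmod (x, t * k)). simpl in Hi. rewrite Rabs_right in Hi by nra. exact Hi. }
    assert (Hz2 : Cmod (x, t * k) <= t * (1 + k)).
    { eapply Rle_trans; [apply Cmod_le_Re_Im|]. simpl. rewrite (Rabs_right (t * k)) by nra. lra. }
    apply Rle_trans with (M * exp (s * (t * (1 + k))) * exp (- tau' * (t * k))).
    - apply Rmult_le_compat_r; [apply Rlt_le, exp_pos|].
      eapply Rle_trans; [apply HMg; lra|]. apply Rmult_le_compat_l; [exact HM|].
      apply exp_le. apply Rmult_le_compat_l; lra.
    - rewrite Rmult_assoc, <- exp_plus. right. do 2 f_equal.
      replace (s * (t * (1 + k)) + - tau' * (t * k)) with (t * (s * (1 + k) - tau' * k)) by ring.
      rewrite Hks. ring. }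
  assert (Hlift : forall t, r0 / k <= t -> r0 <= t * k) by (intros t Ht; apply Rle_div_l in Ht; lra).
  assert (Htail : forall e, Rabs e = 1 ->
    tail_small (fun t => Cmod (f (RtoC t * (e, k))%C))).
  { intros e He1.
    apply tail_small_dom with (g := fun t => M * exp (- t)) (r := Rmax 0 (r0 / k)).
    - intros t. apply rcont_ray, Hfc.
    - intros a b _ _. eexists. apply RInt_exp_neg.
    - intros t Ht.
      assert (Ht0 : 0 <= t) by (eapply Rle_trans; [apply Rmax_l|exact Ht]).
      assert (Htr : r0 / k <= t) by (eapply Rle_trans; [apply Rmax_r|exact Ht]).
      replace (RtoC t * (e, k))%C with (t * e, t * k) by (apply injective_projections; simpl; ring).
      apply Hcone; [apply Hlift, Htr|exact Ht0|]. rewrite Rabs_mult, He1, Rabs_right; lra.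
    - apply tail_small_exp, HM. }
  assert (R1 := sector_rotation f p k Hfc Hfd (s + tau') M r0 ltac:(lra) HM Hfg).
  destruct R1 with (eta := eta / 4) as [N1 HN1]; clear R1; [| |lra|].
  { apply (tail_small_ext (fun t => Cmod (Q (RtoC t)))); [|exact Ht1].
    intros t. rewrite Hmod. simpl. rewrite Rmult_0_r, exp_0. ring. }
  { apply Htail, Rabs_R1. }
  (* The left half-line is the right one for [f(-z)], and the ray through [-1 + ik] becomes the one
     through [1 - ik], hence the parameter [- k]. *)
  set (fm := fun z => f (- (1) * z)%C).
  assert (Hfmc : forall z, ccont fm z).
  { intros z. apply (ccont_comp f); [apply Hfc|]. apply cdiff_ccont. cdiff_tac. }
  assert (R2 := sector_rotation fm (- p) (- k) Hfmc).
  destruct R2 with (A := s + tau') (M := M) (r0 := r0) (eta := eta / 4) as [N2 HN2];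
    clear R2; [|lra|exact HM| | | |lra|].
  { intros z Hz. apply (cdiff_comp f (fun z => - (1) * z)%C); [|cdiff_tac]. apply Hfd. intros E. apply Hz.
    rewrite <- E. ring. }
  { intros z Hz. unfold fm. assert (Em : Cmod (- (1) * z) = Cmod z).
    { rewrite Cmod_mult, Cmod_m1. ring. }
    rewrite <- Em in Hz |- *. apply Hfg, Hz. }
  { apply (tail_small_ext (fun t => Cmod (Q (RtoC (- t)%R)))); [|exact Ht2].
    intros t. unfold fm. replace (- (1) * RtoC t)%C with (RtoC (- t)%R) by (rewrite RtoC_opp; ring).
    rewrite Hmod. simpl. rewrite Rmult_0_r, exp_0. ring. }
  { apply (tail_small_ext (fun t => Cmod (f (RtoC t * (-1, k))%C))).
    - intros t. unfold fm. do 2 f_equal. apply injective_projections; simpl; ring.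
    - apply Htail. rewrite Rabs_left; lra. }
  destruct (primitive_punctured f p Hfc Hfd) as [P HP].
  set (N3 := Rmax 1 (r0 / k)).
  exists (Rmax (Rmax N1 N2) (Rmax N3 (64 * (M + 1) / eta))). intros N HN.
  assert (HNa : Rmax N1 N2 <= N) by (eapply Rle_trans; [apply Rmax_l|exact HN]).
  assert (HNb : Rmax N3 (64 * (M + 1) / eta) <= N) by (eapply Rle_trans; [apply Rmax_r|exact HN]).
  specialize (HN1 N ltac:(eapply Rle_trans; [apply Rmax_l|exact HNa])).
  specialize (HN2 N ltac:(eapply Rle_trans; [apply Rmax_r|exact HNa])).
  assert (HN3 : N3 <= N) by (eapply Rle_trans; [apply Rmax_l|exact HNb]).
  assert (HN4 : 64 * (M + 1) / eta <= N) by (eapply Rle_trans; [apply Rmax_r|exact HNb]).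
  assert (HNr : r0 / k <= N).
  { eapply Rle_trans; [|exact HN3]. apply Rmax_r. }
  assert (HN0 : 1 <= N) by (eapply Rle_trans; [apply Rmax_l|exact HN3]).
  assert (E1 := CI_ray f P (1, k) N Hfc HP). assert (E2 := CI_ray f P (-1, k) N Hfc HP).
  assert (E3 : ((1, (- k)%R) * CI (fun t => fm (RtoC t * (1, (- k)%R))%C) 0 N)%C
    = (- ((-1, k) * CI (fun t => f (RtoC t * (-1, k))%C) 0 N))%C).
  { replace (1, (- k)%R) with (- (-1, k))%C at 1 by (apply injective_projections; simpl; ring).
    replace (CI (fun t => fm (RtoC t * (1, (- k)%R))%C) 0 N) with (CI (fun t => f (RtoC t * (-1, k))%C) 0 N).
    - ring.
    - apply CI_ext. intros t. unfold fm. f_equal. apply injective_projections; simpl; ring. }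
  rewrite E3, E2 in HN2. rewrite E1 in HN1.
  assert (E4 := CI_FTC_line P f (0, N * k) 1 (- N) N HP Hfc).
  rewrite <- !horizontal_line, Cmult_1_r in E4.
  replace (RtoC N * (1, k))%C with (N, (N * k)%R) in HN1 by (apply injective_projections; simpl; ring).
  replace (RtoC N * (-1, k))%C with ((- N)%R, (N * k)%R) in HN2 by (apply injective_projections; simpl; ring).
  assert (B : Cmod (P (N, (N * k)%R) - P ((- N)%R, (N * k)%R)) <= eta / 4).
  { rewrite <- E4. eapply Rle_trans; [apply (CI_norm_const _ (M * exp (- N)))|].
    - intros t. apply (rcont_comp f); [apply Hfc|apply rcont_line].
    - rewrite Rmin_left, Rmax_right by lra. intros t Ht. rewrite <- horizontal_line.
      apply Hcone; [apply Hlift, HNr|lra|]. apply Rabs_le. lra.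
    - replace (N - - N) with (2 * N) by ring. rewrite Rabs_right by lra.
      (* One factor absorbs the length [2 N]; the other is made small by [HN4], whose constant 64 is
         generous. *)
      replace (exp (- N)) with (exp (- (N / 2)) * exp (- (N / 2))) by (rewrite <- exp_plus; f_equal; field).
      assert (X := exp_neg_le_inv (N / 2) ltac:(lra)). assert (Y := exp_pos (- (N / 2))).
      assert (Z : exp (- (N / 2)) * N <= 2).
      { apply Rle_trans with (/ (N / 2) * N); [apply Rmult_le_compat_r; lra|]. right; field; lra. }
      set (y := exp (- (N / 2))) in *.
      apply Rle_trans with (M * y * 4).
      + replace (M * (y * y) * (2 * N)) with (M * y * (2 * (y * N))) by ring.
        apply Rmult_le_compat_l; [apply Rmult_le_pos; lra|lra].
      + apply Rle_div_l in HN4; [|lra].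
        assert (X2 : y * N <= 2) by lra.
        assert (My : M * y * (64 * (M + 1)) <= 2 * (M * eta)).
        { apply Rle_trans with (M * y * (N * eta)); [apply Rmult_le_compat_l; [apply Rmult_le_pos; lra|lra]|].
          replace (M * y * (N * eta)) with (M * eta * (y * N)) by ring.
          rewrite (Rmult_comm 2). apply Rmult_le_compat_l; [apply Rmult_le_pos; lra|lra]. }
        assert (My0 : 0 <= M * y) by (apply Rmult_le_pos; lra).
        apply Rmult_le_reg_r with (M + 1); [lra|]. nra. }
  rewrite CI_sym.
  2:{ intros t. apply (rcont_comp f); [apply Hfc|apply rcont_RtoC]. }
  change (fun t => (Q (RtoC t) * cexp (Ci * RtoC tau' * RtoC t))%C) with (fun t => f (RtoC t)).
  change (fun t => (Q (RtoC (- t)%R) * cexp (Ci * RtoC tau' * RtoC (- t)%R))%C) with (fun t => f (RtoC (- t)%R)).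
  replace (CI (fun t => f (RtoC (- t)%R)) 0 N) with (CI (fun t => fm (RtoC t)) 0 N).
  2:{ apply CI_ext. intros t. unfold fm. f_equal. rewrite RtoC_opp. ring. }
  set (i1 := CI (fun t => f (RtoC t)) 0 N) in *. set (i2 := CI (fun t => fm (RtoC t)) 0 N) in *.
  replace (i1 + i2)%C with ((i1 - (P (N, (N * k)%R) - P 0)) + (i2 - - (P ((- N)%R, (N * k)%R) - P 0))
    + (P (N, (N * k)%R) - P ((- N)%R, (N * k)%R)))%C by ring.
  eapply Rle_trans; [apply Cmod_triangle|].
  eapply Rle_trans; [apply Rplus_le_compat_r, Cmod_triangle|]. lra.
Qed.

(** Dominated convergence by hand, using that the exponentials have modulus 1 on the line, so that
    tails are small uniformly in the frequency. First [N] is fixed, then [h] so small that passing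
    from frequency [tau + h] to [tau] changes the integral over [[-N, N]] by at most [eta / 4], and
    only then [T], in terms of [h]. *)
Lemma vanishing_at_type :
  vanishing_integral (fun t => Q (RtoC t) * cexp (Ci * RtoC tau * RtoC t))%C.
Proof.
  intros eta He.
  destruct (Ht1 (eta / 4)) as [N1 HN1]; [lra|]. destruct (Ht2 (eta / 4)) as [N2 HN2]; [lra|].
  exists (Rmax 0 (Rmax N1 N2)). intros N HN.
  assert (HN0 : 0 <= N) by (eapply Rle_trans; [apply Rmax_l|exact HN]).
  assert (HNa : N1 <= N).
  { eapply Rle_trans; [|exact HN]. eapply Rle_trans; [|apply Rmax_r]. apply Rmax_l. }
  assert (HNb : N2 <= N).
  { eapply Rle_trans; [|exact HN]. eapply Rle_trans; [|apply Rmax_r]. apply Rmax_r. }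
  set (q := fun t => Q (RtoC t)).
  assert (Hq : forall t, rcont q t) by (intros t; apply (rcont_comp Q); [apply Hc|apply rcont_RtoC]).
  set (e := fun s t => cexp (Ci * RtoC s * RtoC t)).
  assert (Hec : forall s t, rcont (e s) t).
  { intros s t. apply (rcont_comp (fun z => cexp (Ci * RtoC s * z))); [|apply rcont_RtoC].
    apply cdiff_ccont. cdiff_tac. }
  set (I := RInt (fun t => Cmod (q t)) (- N) N).
  assert (HI : 0 <= I) by (apply RInt_Cmod_pos; [lra|exact Hq]).
  set (K := N * exp N).
  assert (HK : 0 <= K) by (apply Rmult_le_pos; [lra|apply Rlt_le, exp_pos]).
  set (h := Rmin 1 (eta / 4 / (K * I + 1))).
  assert (HKI : 0 <= K * I) by (apply Rmult_le_pos; assumption).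
  assert (Hh0 : 0 < h) by (apply Rmin_pos; [lra|apply Rdiv_lt_0_compat; lra]).
  assert (Hh1 : h <= 1) by apply Rmin_l.
  assert (HhK : h * (K * I + 1) <= eta / 4).
  { apply Rle_trans with (eta / 4 / (K * I + 1) * (K * I + 1)); [apply Rmult_le_compat_r; [lra|apply Rmin_r]|].
    right; field; lra. }
  destruct (vanishing_above_type (tau + h) ltac:(lra) (eta / 4) ltac:(lra)) as [N3 HN3].
  set (T := Rmax N N3). assert (HT : N <= T) by apply Rmax_l.
  specialize (HN3 T (Rmax_r _ _)).
  change (fun t => (Q (RtoC t) * cexp (Ci * RtoC (tau + h) * RtoC t))%C) with (fun t => (q t * e (tau + h)%R t)%C) in HN3.
  change (fun t => (Q (RtoC t) * cexp (Ci * RtoC tau * RtoC t))%C) with (fun t => (q t * e tau t)%C).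
  assert (Hm : forall s t, rcont (fun t => q t * e s t)%C t) by (intros; apply rcont_mult; auto).
  assert (He1 : forall s t, Cmod (e s t) <= 1) by (intros s t; unfold e; rewrite Cmod_cexp_real; lra).
  rewrite <- (CI_Chasles _ (- T) (- N) T (Hm (tau + h))), <- (CI_Chasles _ (- N) N T (Hm (tau + h))) in HN3.
  assert (B1 : Cmod (CI (fun t => q t * e (tau + h)%R t)%C N T) <= eta / 4).
  { eapply Rle_trans; [apply (CI_mult_le q (e (tau + h)) 1); auto; lra|]. rewrite Rmult_1_l. apply HN1; lra. }
  assert (B2 : Cmod (CI (fun t => q t * e (tau + h)%R t)%C (- T) (- N)) <= eta / 4).
  { rewrite <- (CI_reflect _ N T (Hm (tau + h))).
    eapply Rle_trans; [apply (CI_mult_le (fun t => q (- t)) (fun t => e (tau + h) (- t)) 1); auto; try lra|].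
    - intros t. apply rcont_opp, Hq.
    - intros t. apply rcont_opp, Hec.
    - rewrite Rmult_1_l. apply HN2; lra. }
  assert (B3 : Cmod (CI (fun t => q t * e tau t)%C (- N) N - CI (fun t => q t * e (tau + h)%R t)%C (- N) N) <= eta / 4).
  { rewrite <- CI_minus by auto.
    rewrite (CI_ext _ (fun t => q t * (e tau t - e (tau + h)%R t))%C) by (intros; ring).
    eapply Rle_trans; [apply (CI_mult_le q _ (h * K)); auto; try lra|].
    - apply Rmult_le_pos; lra.
    - intros t. apply rcont_minus; apply Hec.
    - intros t Ht.
      replace (e tau t - e (tau + h)%R t)%C with (- (e tau t * (cexp (Ci * RtoC h * RtoC t) - 1)))%C.
      2:{ unfold e. replace (Ci * RtoC (tau + h) * RtoC t)%C with
            (Ci * RtoC tau * RtoC t + Ci * RtoC h * RtoC t)%C by (rewrite RtoC_plus; ring).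
          rewrite cexp_plus. ring. }
      rewrite Cmod_opp, Cmod_mult. unfold e. rewrite Cmod_cexp_real, Rmult_1_l.
      eapply Rle_trans; [apply cexp_remainder1|].
      rewrite !Cmod_mult, Cmod_Ci, !Cmod_R, (Rabs_right h), Rmult_1_l by lra.
      assert (Hta : Rabs t <= N) by (apply Rabs_le; lra). assert (Hta0 := Rabs_pos t).
      unfold K. rewrite Rmult_assoc. apply Rmult_le_compat_l; [lra|].
      apply Rmult_le_compat; [lra|apply Rlt_le, exp_pos|lra|]. apply exp_le. nra.
    - fold I. lra. }
  set (a := CI (fun t => q t * e (tau + h)%R t)%C (- N) N) in *.
  set (b1 := CI (fun t => q t * e (tau + h)%R t)%C N T) in *.
  set (b2 := CI (fun t => q t * e (tau + h)%R t)%C (- T) (- N)) in *.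
  set (c := CI (fun t => q t * e tau t)%C (- N) N) in *.
  replace c with ((c - a) + (b2 + (a + b1)) - b1 - b2)%C by ring.
  eapply Rle_trans; [apply Cmod_sub_le|].
  eapply Rle_trans; [apply Rplus_le_compat_r, Cmod_sub_le|].
  eapply Rle_trans; [apply Rplus_le_compat_r, Rplus_le_compat_r, Cmod_triangle|]. lra.
Qed.

End HalfPlane.

(** * Improper integrals over the line *)

(** Contour arguments control symmetric intervals only, so limits are first taken in this sense. *)
Definition sym_lim (f : R -> C) (l : C) : Prop :=
  forall eta, 0 < eta -> exists N0, forall N, N0 <= N -> Cmod (CI f (- N) N - l) <= eta.

Lemma vanishing_sym_lim (f : R -> C) : vanishing_integral f -> sym_lim f 0.
Proof.
  intros H eta He. destruct (H eta He) as [N0 HN0]. exists N0. intros N HN.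
  replace (CI f (- N) N - 0)%C with (CI f (- N) N) by ring. apply HN0, HN.
Qed.

Lemma sym_lim_ext (f g : R -> C) (l : C) : (forall t, f t = g t) -> sym_lim f l -> sym_lim g l.
Proof.
  intros E H eta He. destruct (H eta He) as [N0 HN0]. exists N0. intros N HN.
  rewrite <- (CI_ext f g) by exact E. apply HN0, HN.
Qed.

Lemma sym_lim_plus (f g : R -> C) (a b : C) : (forall t, rcont f t) -> (forall t, rcont g t) ->
  sym_lim f a -> sym_lim g b -> sym_lim (fun t => f t + g t)%C (a + b).
Proof.
  intros Hf Hg Ha Hb eta He.
  destruct (Ha (eta / 2)) as [N1 H1]; [lra|]. destruct (Hb (eta / 2)) as [N2 H2]; [lra|].
  exists (Rmax N1 N2). intros N HN.
  specialize (H1 N (Rle_trans _ _ _ (Rmax_l _ _) HN)). specialize (H2 N (Rle_trans _ _ _ (Rmax_r _ _) HN)).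
  rewrite CI_plus by assumption.
  replace (CI f (- N) N + CI g (- N) N - (a + b))%C with ((CI f (- N) N - a) + (CI g (- N) N - b))%C by ring.
  eapply Rle_trans; [apply Cmod_triangle|]. lra.
Qed.

Lemma sym_lim_scal (c : C) (f : R -> C) (a : C) : (forall t, rcont f t) ->
  sym_lim f a -> sym_lim (fun t => c * f t)%C (c * a).
Proof.
  intros Hf Ha eta He. assert (Hc := Cmod_ge_0 c).
  destruct (Ha (eta / (Cmod c + 1))) as [N0 H0]; [apply Rdiv_lt_0_compat; lra|].
  exists N0. intros N HN. specialize (H0 N HN). rewrite CI_scal by assumption.
  replace (c * CI f (- N) N - c * a)%C with (c * (CI f (- N) N - a))%C by ring. rewrite Cmod_mult.
  apply Rle_trans with ((Cmod c + 1) * (eta / (Cmod c + 1))); [|right; field; lra].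
  apply Rmult_le_compat; [lra|apply Cmod_ge_0|lra|exact H0].
Qed.

Lemma sym_lim_reflect (f : R -> C) (l : C) : (forall t, rcont f t) ->
  sym_lim f l -> sym_lim (fun t => f (- t)%R) l.
Proof.
  intros Hf H eta He. destruct (H eta He) as [N0 HN0]. exists N0. intros N HN.
  rewrite CI_reflect by exact Hf. rewrite Ropp_involutive. apply HN0, HN.
Qed.

Lemma RInt_inv_sq (c a b : R) : 0 < a -> a <= b ->
  is_RInt (fun t => c * / t ^ 2) a b (c * / a - c * / b).
Proof.
  intros Ha Hab.
  replace (c * / a - c * / b) with (minus (- (c * / b)) (- (c * / a)))
    by (unfold minus, plus, opp; simpl; ring).
  apply (is_RInt_derive (V := R_CompleteNormedModule) (fun t => - (c * / t))).
  - rewrite Rmin_left, Rmax_right by lra. intros x Hx. auto_derive; [lra|]. field. lra.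
  - rewrite Rmin_left, Rmax_right by lra. intros x Hx.
    apply (ex_derive_continuous (V := R_NormedModule)). auto_derive. nra.
Qed.

Lemma tail_small_inv_sq (c : R) : 0 <= c -> tail_small (fun t => c * / t ^ 2).
Proof.
  intros Hc eta He. exists (Rmax 1 (c / eta)). intros a b Ha Hab.
  assert (Ha1 : 1 <= a) by (eapply Rle_trans; [apply Rmax_l|exact Ha]).
  assert (Ha2 : c / eta <= a) by (eapply Rle_trans; [apply Rmax_r|exact Ha]).
  rewrite (is_RInt_unique _ _ _ _ (RInt_inv_sq c a b ltac:(lra) Hab)).
  apply Rle_div_l in Ha2; [|lra].
  assert (0 < / b) by (apply Rinv_0_lt_compat; lra).
  assert (c * / a <= eta) by (apply Rle_div_l; lra). nra.
Qed.

Lemma tail_small_plus (f g : R -> R) (r : R) :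
  (forall a b, r <= a -> a <= b -> ex_RInt f a b) -> (forall a b, r <= a -> a <= b -> ex_RInt g a b) ->
  tail_small f -> tail_small g -> tail_small (fun t => f t + g t).
Proof.
  intros Hf Hg H1 H2 eta He.
  destruct (H1 (eta / 2)) as [N1 HN1]; [lra|]. destruct (H2 (eta / 2)) as [N2 HN2]; [lra|].
  exists (Rmax r (Rmax N1 N2)). intros a b Ha Hab.
  assert (Har : r <= a) by (eapply Rle_trans; [apply Rmax_l|exact Ha]).
  assert (Ha' : Rmax N1 N2 <= a) by (eapply Rle_trans; [apply Rmax_r|exact Ha]).
  rewrite (RInt_plus (V := R_CompleteNormedModule)) by (try apply Hf; try apply Hg; assumption).
  specialize (HN1 a b (Rle_trans _ _ _ (Rmax_l _ _) Ha') Hab).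
  specialize (HN2 a b (Rle_trans _ _ _ (Rmax_r _ _) Ha') Hab).
  unfold plus; simpl. lra.
Qed.

Lemma is_RInt_gen_intro (g : R -> R) (l : R) : (forall a b, ex_RInt g a b) ->
  (forall eta, 0 < eta -> exists N, forall a b, a <= - N -> N <= b -> Rabs (RInt g a b - l) <= eta) ->
  is_RInt_gen g (Rbar_locally m_infty) (Rbar_locally p_infty) l.
Proof.
  intros Hex H P [eps HP].
  destruct (H (eps / 2)) as [N HN]; [destruct eps; simpl; lra|].
  exists (fun a => a < - N) (fun b => N < b).
  - exists (- N). auto.
  - exists N. auto.
  - intros a b Ha Hb. exists (RInt g a b). split; [apply (RInt_correct (V := R_CompleteNormedModule)), Hex|].
    apply HP. change (Rabs (RInt g a b - l) < eps).
    eapply Rle_lt_trans; [apply HN; lra|]. destruct eps; simpl; lra.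
Qed.

Lemma RInt_reflect (g : R -> R) (a b : R) : (forall a b, ex_RInt g a b) ->
  RInt (fun t => g (- t)) a b = RInt g (- b) (- a).
Proof.
  intros Hex.
  assert (E := RInt_comp_lin (V := R_CompleteNormedModule) g (-1) 0 b a (Hex _ _)).
  replace (-1 * a + 0) with (- a) in E by ring. replace (-1 * b + 0) with (- b) in E by ring.
  assert (Hex' := ex_RInt_comp_lin (V := R_NormedModule) g (-1) 0 b a (Hex _ _)).
  rewrite <- E, <- (opp_RInt_swap (V := R_CompleteNormedModule) _ a b) by (apply ex_RInt_swap; exact Hex').
  rewrite <- (RInt_opp (V := R_CompleteNormedModule)) by (apply ex_RInt_swap; exact Hex').
  apply (RInt_ext (V := R_CompleteNormedModule)). intros x _.
  unfold scal, opp; simpl; unfold mult; simpl. replace (-1 * x + 0) with (- x) by ring. ring.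
Qed.

(** Two partial integrals that share an endpoint are both within [eta / 2] of [l]; their difference
    is a tail. *)
Lemma is_RInt_gen_tails (g : R -> R) (l : R) : (forall a b, ex_RInt g a b) ->
  is_RInt_gen g (Rbar_locally m_infty) (Rbar_locally p_infty) l ->
  tail_small g /\ tail_small (fun t => g (- t)).
Proof.
  intros Hex H.
  assert (Hcore : forall eta, 0 < eta -> exists N, 0 < N /\ forall a b, N <= a -> N <= b ->
    Rabs (RInt g (- a) b - l) < eta / 2).
  { intros eta He. assert (He2 : 0 < eta / 2) by lra.
    destruct (H (fun y => Rabs (y - l) < eta / 2)) as [P1 P2 [M1 HM1] [M2 HM2] HP].
    { exists (mkposreal _ He2). intros y Hy. exact Hy. }
    exists (Rabs M1 + Rabs M2 + 1). assert (H1 := Rabs_pos M1). assert (H2 := Rabs_pos M2).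
    split; [lra|]. intros a b Ha Hb.
    destruct (HP (- a) b) as [y [Hy1 Hy2]].
    - apply HM1. assert (- M1 <= Rabs M1) by (rewrite <- Rabs_Ropp; apply Rle_abs). lra.
    - apply HM2. assert (M2 <= Rabs M2) by apply Rle_abs. lra.
    - simpl in Hy1. rewrite (is_RInt_unique _ _ _ _ Hy1). exact Hy2. }
  split; intros eta He; destruct (Hcore eta He) as [N [HN0 HN]]; exists N; intros a b Ha Hab.
  - assert (E := RInt_Chasles (V := R_CompleteNormedModule) g (- N) a b (Hex _ _) (Hex _ _)).
    assert (H1 := HN N a (Rle_refl N) Ha). assert (H2 := HN N b (Rle_refl N) (Rle_trans _ _ _ Ha Hab)).
    apply Rabs_def2 in H1. apply Rabs_def2 in H2. unfold plus in E; simpl in E. lra.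
  - rewrite RInt_reflect by exact Hex.
    assert (E := RInt_Chasles (V := R_CompleteNormedModule) g (- b) (- a) N (Hex _ _) (Hex _ _)).
    assert (H1 := HN a N Ha (Rle_refl N)). assert (H2 := HN b N (Rle_trans _ _ _ Ha Hab) (Rle_refl N)).
    apply Rabs_def2 in H1. apply Rabs_def2 in H2. unfold plus in E; simpl in E. lra.
Qed.

(** Small absolute tails free the two endpoints from each other, as the two-filter integral in
    [int_R] demands. *)
Lemma sym_lim_gen (f : R -> C) (l : C) : (forall t, rcont f t) ->
  tail_small (fun t => Cmod (f t)) -> tail_small (fun t => Cmod (f (- t)%R)) -> sym_lim f l ->
  is_RInt_gen (fun t => Re (f t)) (Rbar_locally m_infty) (Rbar_locally p_infty) (Re l) /\
  is_RInt_gen (fun t => Im (f t)) (Rbar_locally m_infty) (Rbar_locally p_infty) (Im l).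
Proof.
  intros Hf Ht1 Ht2 H.
  assert (Hcore : forall eta, 0 < eta -> exists N, forall a b, a <= - N -> N <= b -> Cmod (CI f a b - l) <= eta).
  { intros eta He.
    destruct (H (eta / 3)) as [N1 H1]; [lra|]. destruct (Ht1 (eta / 3)) as [N2 H2]; [lra|].
    destruct (Ht2 (eta / 3)) as [N3 H3]; [lra|].
    set (N := Rmax N1 (Rmax N2 N3)). exists N. intros a b Ha Hb.
    assert (HN2 : N2 <= N) by (eapply Rle_trans; [apply Rmax_l|apply Rmax_r]).
    assert (HN3 : N3 <= N) by (eapply Rle_trans; [apply Rmax_r|apply Rmax_r]).
    specialize (H1 N (Rmax_l _ _)).
    assert (B2 : Cmod (CI f N b) <= eta / 3).
    { eapply Rle_trans; [apply CI_norm with (g := fun t => Cmod (f t)); auto|].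
      - apply ex_RInt_Cmod, Hf.
      - intros; lra.
      - apply H2; lra. }
    assert (B3 : Cmod (CI f a (- N)) <= eta / 3).
    { replace a with (- - a) by ring. rewrite <- (CI_reflect f N (- a) Hf).
      eapply Rle_trans; [apply CI_norm with (g := fun t => Cmod (f (- t)%R)); auto|].
      - lra.
      - intros t. apply rcont_opp, Hf.
      - apply (ex_RInt_Cmod (fun t => f (- t)%R)). intros t. apply rcont_opp, Hf.
      - intros; lra.
      - apply H3; lra. }
    rewrite <- (CI_Chasles f a (- N) b Hf), <- (CI_Chasles f (- N) N b Hf).
    replace (CI f a (- N) + (CI f (- N) N + CI f N b) - l)%C with
      ((CI f (- N) N - l) + CI f a (- N) + CI f N b)%C by ring.
    eapply Rle_trans; [apply Cmod_triangle|].
    eapply Rle_trans; [apply Rplus_le_compat_r, Cmod_triangle|]. lra. }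
  split.
  - apply is_RInt_gen_intro.
    + intros a b. eexists. apply CI_Re, Hf.
    + intros eta He. destruct (Hcore eta He) as [N HN]. exists N. intros a b Ha Hb.
      rewrite (is_RInt_unique _ _ _ _ (CI_Re f a b Hf)).
      eapply Rle_trans; [|apply (HN a b Ha Hb)].
      assert (X := re_le_Cmod (CI f a b - l)). unfold Cminus in X. rewrite re_plus, re_opp in X. exact X.
  - apply is_RInt_gen_intro.
    + intros a b. eexists. apply CI_Im, Hf.
    + intros eta He. destruct (Hcore eta He) as [N HN]. exists N. intros a b Ha Hb.
      rewrite (is_RInt_unique _ _ _ _ (CI_Im f a b Hf)).
      eapply Rle_trans; [|apply (HN a b Ha Hb)].
      assert (X := im_le_Cmod (CI f a b - l)). unfold Cminus in X. rewrite im_plus, im_opp in X. exact X.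
Qed.

(** Completeness is applied to the integrals over [[-n, n]]. Positivity places every larger interval
    within [eta] of [[-N, N]], so the limit does not depend on how the endpoints move. *)
Lemma tails_ex_RInt_gen (g : R -> R) : (forall a b, ex_RInt g a b) -> (forall t, 0 <= g t) ->
  tail_small g -> tail_small (fun t => g (- t)) ->
  ex_RInt_gen g (Rbar_locally m_infty) (Rbar_locally p_infty).
Proof.
  intros Hex Hpos Ht1 Ht2.
  assert (Hcore : forall eta, 0 < eta -> exists N, 0 <= N /\ forall a b a' b', a <= - N -> N <= b -> a' <= - N -> N <= b' ->
    Rabs (RInt g a b - RInt g a' b') <= eta).
  { intros eta He.
    destruct (Ht1 (eta / 2)) as [N2 H2]; [lra|]. destruct (Ht2 (eta / 2)) as [N3 H3]; [lra|].
    set (N := Rmax 0 (Rmax N2 N3)). exists N. split; [apply Rmax_l|].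
    assert (HN2 : N2 <= N) by (eapply Rle_trans; [apply Rmax_l|apply Rmax_r]).
    assert (HN3 : N3 <= N) by (eapply Rle_trans; [apply Rmax_r|apply Rmax_r]).
    assert (Hab : forall a b, a <= - N -> N <= b -> 0 <= RInt g a b - RInt g (- N) N <= eta).
    { intros a b Ha Hb.
      assert (E1 := RInt_Chasles (V := R_CompleteNormedModule) g a (- N) b (Hex _ _) (Hex _ _)).
      assert (E2 := RInt_Chasles (V := R_CompleteNormedModule) g (- N) N b (Hex _ _) (Hex _ _)).
      unfold plus in E1, E2; simpl in E1, E2.
      assert (P1 : 0 <= RInt g a (- N)) by (apply RInt_ge_0; auto).
      assert (P2 : 0 <= RInt g N b) by (apply RInt_ge_0; auto).
      assert (B1 : RInt g N b <= eta / 2) by (apply H2; lra).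
      assert (B2 : RInt g a (- N) <= eta / 2).
      { replace a with (- - a) by ring. rewrite <- (RInt_reflect g N (- a) Hex). apply H3; lra. }
      lra. }
    intros a b a' b' Ha Hb Ha' Hb'. assert (X := Hab a b Ha Hb). assert (Y := Hab a' b' Ha' Hb').
    apply Rabs_le. lra. }
  assert (Hlim : ex_finite_lim_seq (fun n => RInt g (- INR n) (INR n))).
  { apply ex_lim_seq_cauchy_corr. intros eps. destruct (Hcore (eps / 2)) as [N [HN0 HN]]; [destruct eps; simpl; lra|].
    destruct (nfloor_ex N HN0) as [n0 Hn0]. exists (S n0). intros n m Hn Hm.
    apply le_INR in Hn. apply le_INR in Hm. rewrite S_INR in Hn, Hm.
    eapply Rle_lt_trans; [apply HN; lra|]. destruct eps; simpl; lra. }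
  destruct Hlim as [l Hl]. exists l. apply is_RInt_gen_intro; [exact Hex|].
  intros eta He. destruct (Hcore (eta / 2)) as [N [HN0 HN]]; [lra|]. exists N. intros a b Ha Hb.
  apply is_lim_seq_spec in Hl. assert (He2 : 0 < eta / 2) by lra.
  destruct (Hl (mkposreal _ He2)) as [n1 Hn1]. simpl in Hn1.
  destruct (nfloor_ex N HN0) as [n0 Hn0]. set (n := (n1 + S n0)%nat).
  specialize (Hn1 n ltac:(unfold n; lia)).
  assert (HnN : N <= INR n).
  { assert (Hle : (S n0 <= n)%nat) by (unfold n; lia). apply le_INR in Hle. rewrite S_INR in Hle. lra. }
  specialize (HN a b (- INR n) (INR n) Ha Hb ltac:(lra) HnN).
  replace (RInt g a b - l) with ((RInt g a b - RInt g (- INR n) (INR n)) + (RInt g (- INR n) (INR n) - l)) by ring.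
  eapply Rle_trans; [apply Rabs_triang|]. lra.
Qed.

(** * The reproducing property of sinc *)

Section Kernel.

Variable D : R.
Hypothesis HD : 0 < D.
Let tau := PI * D.
Let S := sincD D.

Lemma S_cdiff (g : C -> C) (z : C) : cdiff g z -> cdiff (fun u => S (g u)) z.
Proof. intros H. apply (cdiff_comp S g); [apply sincD_diff, HD|exact H]. Qed.

Lemma rcont_S_shift (w : C) (t : R) : rcont (fun t => S (RtoC t - w)) t.
Proof.
  apply (rcont_comp (fun z => S (z - w))); [|apply rcont_RtoC].
  apply cdiff_ccont, S_cdiff. cdiff_tac.
Qed.

Lemma sinc_shift_bound (x : R) (w : C) : 0 < Rabs x -> 2 * Cmod w <= Rabs x ->
  Cmod (S (RtoC x - w)%C) <= exp (tau * Cmod w) * / Rabs x.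
Proof.
  intros Hx Hw. assert (Ht := tau_pos D HD). fold tau in Ht.
  assert (H := sincD_bound_Im D HD (RtoC x - w)). fold tau S in H.
  assert (Hge : Rabs x / 2 <= Cmod (RtoC x - w)).
  { assert (T := Cmod_sub_ge (RtoC x) w). rewrite Cmod_R in T. lra. }
  assert (Hexp : exp (tau * Rabs (Im (RtoC x - w))) <= exp (tau * Cmod w)).
  { apply exp_le, Rmult_le_compat_l; [lra|]. destruct w as [u v]. simpl.
    replace (0 + - v) with (- v) by ring. rewrite Rabs_Ropp. apply (im_le_Cmod (u, v)). }
  (* [PI / 2 > 1] absorbs the factor 2 lost in [|x - w| >= |x| / 2]. *)
  assert (Hpi := PI2_3_2).
  assert (Hs := Cmod_ge_0 (S (RtoC x - w))).
  apply Rle_div_r; [exact Hx|].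
  apply Rle_trans with (PI * Cmod (RtoC x - w) * Cmod (S (RtoC x - w))); [|lra].
  rewrite Rmult_comm. apply Rmult_le_compat_r; [exact Hs|]. unfold PI2 in Hpi. nra.
Qed.

(** Put [E(z) = S(z) exp(i tau z)], so [E(0) = D], and [f(z) = (E(z) - D) / z]. The even part of [f]
    is [i PI S^2], the pole term being odd, while the integral of [f] over [[-N, N]] tends to
    [i PI D]: on the upper semicircle [E] is [O(1/N)] and the constant [D] contributes the angle
    [PI]. *)
Lemma sinc_sq_integral_0 : sym_lim (fun t => S (RtoC t) * S (RtoC t))%C (RtoC D).
Proof.
  set (E := fun z => (S z * cexp (Ci * RtoC tau * z))%C).
  set (l := (RtoC D * (Ci * RtoC tau))%C).
  set (G := fun z => (E z - RtoC D)%C).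
  assert (HEd : forall z, cdiff E z).
  { intros z. apply cdiff_mult; [apply sincD_diff, HD|]. cdiff_tac. }
  assert (HGd : forall z, cdiff G z) by (intros z; apply cdiff_minus; [apply HEd|apply cdiff_const]).
  assert (HG0 : G 0%C = 0%C).
  { unfold G, E, S. rewrite sincD_0, Cmult_0_r, cexp_0. ring. }
  assert (HGl : has_cderiv G 0 l).
  { eapply has_cderiv_eq.
    - apply has_cderiv_minus; [|apply has_cderiv_const]. apply has_cderiv_mult.
      + apply has_cderiv_sincD_0, HD.
      + apply (has_cderiv_comp cexp); [apply has_cderiv_cexp|]. apply has_cderiv_scal, has_cderiv_id.
    - cbv beta. unfold S. rewrite sincD_0, Cmult_0_r, cexp_0. unfold l. ring. }
  set (f := dquot G 0 l).
  assert (Hfd : forall z : C, z <> 0%C -> cdiff f z) by (intros z Hz; apply dquot_diff; [exact Hz|apply HGd]).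
  assert (Hfc : forall z, ccont f z).
  { intros z. destruct (Ceq_dec z 0) as [->|Hz]; [apply dquot_ccont; assumption|apply cdiff_ccont, Hfd, Hz]. }
  destruct (primitive_punctured f 0 Hfc Hfd) as [P HP].
  assert (Hfz : forall z, (f z * z)%C = G z).
  { intros z. replace z with (z - 0)%C at 2 by ring. apply dquot_mult, HG0. }
  (* The right side has modulus at most 2 in the closed upper half-plane, whence the decay of [E]
     there. *)
  assert (HE : forall z, (2 * Ci * RtoC PI * z * E z)%C = (cexp (Ci * RtoC tau * z) * cexp (Ci * RtoC tau * z) - 1)%C).
  { intros z. assert (X := csin_cexp (RtoC tau * z)). unfold tau in X at 1. rewrite csin_sincD in X. fold S in X.
    unfold E.
    replace (2 * Ci * RtoC PI * z * (S z * cexp (Ci * RtoC tau * z)))%C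
      with (2 * Ci * (RtoC PI * z * S z) * cexp (Ci * RtoC tau * z))%C by ring.
    rewrite X. replace (Ci * (RtoC tau * z))%C with (Ci * RtoC tau * z)%C by ring.
    replace (RtoC 1) with (cexp (Ci * RtoC tau * z) * cexp (- (Ci * RtoC tau * z)))%C; [ring|].
    rewrite <- cexp_plus, Cplus_opp_r. apply cexp_0. }
  (* [S] is even, so [f(z) + f(-z)] retains [S(z) (exp(i tau z) - exp(-i tau z)) / z]; at 0 both
     sides reduce to [2 l]. *)
  assert (Heven : forall z, (f z + f (- z))%C = (2 * Ci * RtoC PI * (S z * S z))%C).
  { intros z. destruct (Ceq_dec z 0) as [->|Hz].
    - replace (- 0)%C with (RtoC 0) by ring. unfold f, dquot.
      destruct (excluded_middle_informative (RtoC 0 = 0%C)) as [_|X]; [|now elim X].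
      unfold S. rewrite sincD_0. unfold l, tau. rewrite RtoC_mult. ring.
    - assert (X : ((f z + f (- z)) * z)%C = (2 * Ci * RtoC PI * (S z * S z) * z)%C).
      { replace ((f z + f (- z)) * z)%C with (f z * z - f (- z) * - z)%C by ring. rewrite !Hfz. unfold G, E.
        unfold S at 2. rewrite sincD_opp. fold S.
        assert (Y := csin_cexp (RtoC tau * z)). unfold tau in Y at 1. rewrite csin_sincD in Y. fold S in Y.
        replace (Ci * RtoC tau * - z)%C with (- (Ci * (RtoC tau * z)))%C by ring.
        replace (Ci * RtoC tau * z)%C with (Ci * (RtoC tau * z))%C by ring.
        transitivity (S z * (cexp (Ci * (RtoC tau * z)) - cexp (- (Ci * (RtoC tau * z)))))%C; [ring|].
        rewrite <- Y. ring. }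
      replace (f z + f (- z))%C with ((f z + f (- z)) * z * / z)%C by (field; exact Hz).
      rewrite X. field. exact Hz. }
  assert (Hcf : forall t, rcont (fun t => f (RtoC t)) t)
    by (intros t; apply (rcont_comp f); [apply Hfc|apply rcont_RtoC]).
  assert (Hsym : sym_lim (fun t => f (RtoC t)) (Ci * RtoC (PI * D))%C).
  { intros eta He. exists (Rmax 1 (/ eta)). intros N HN.
    assert (HN1 : 1 <= N) by (eapply Rle_trans; [apply Rmax_l|exact HN]).
    assert (HN2 : / eta <= N) by (eapply Rle_trans; [apply Rmax_r|exact HN]).
    assert (E1 := CI_FTC_line P f 0 1 (- N) N HP Hfc). rewrite Cmult_1_r, !Cplus_0_l, !Cmult_1_r in E1.
    rewrite (CI_ext _ (fun t => f (0 + RtoC t * 1)%C)) by (intros t; f_equal; ring). rewrite E1.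
    set (g := fun th : R => (N * cos th, N * sin th)).
    set (g' := fun th : R => (- (N * sin th), N * cos th)).
    assert (Hg : forall t, has_rderiv g t (g' t)).
    { intros t. apply has_rderiv_pair; auto_derive; auto; ring. }
    assert (Hg' : forall t, rcont g' t).
    { intros t. apply (has_rderiv_rcont _ _ (- (N * cos t), - (N * sin t))).
      apply has_rderiv_pair; auto_derive; auto; ring. }
    assert (E2 := CI_FTC P f g g' 0 PI HP Hfc Hg Hg').
    (* On the circle [dz = i z d(theta)], which cancels the denominator of [f]. *)
    assert (Egi : forall t, g' t = (Ci * g t)%C).
    { intros t. apply injective_projections; unfold g, g'; simpl; ring. }
    assert (Hgc : forall t, rcont (fun t => E (g t)) t).
    { intros t. apply (rcont_comp E); [apply cdiff_ccont, HEd|]. eapply has_rderiv_rcont, Hg. }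
    rewrite (CI_ext _ (fun t => Ci * (E (g t) - RtoC D))%C) in E2.
    2:{ intros t. rewrite Egi. replace (f (g t) * (Ci * g t))%C with (Ci * (f (g t) * g t))%C by ring.
        now rewrite Hfz. }
    rewrite CI_scal, CI_minus, CI_const in E2; try assumption; try (intros; apply rcont_const).
    2:{ intros t. apply rcont_minus; [apply Hgc|apply rcont_const]. }
    assert (Eg0 : g 0 = RtoC N).
    { unfold g. rewrite cos_0, sin_0. apply injective_projections; simpl; ring. }
    assert (EgPI : g PI = RtoC (- N)).
    { unfold g. rewrite cos_PI, sin_PI. apply injective_projections; simpl; ring. }
    rewrite Eg0, EgPI in E2.
    replace (P (RtoC N) - P (RtoC (- N)) - Ci * RtoC (PI * D))%C with (- (Ci * CI (fun t => E (g t)) 0 PI))%C.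
    2:{ replace (P (RtoC N) - P (RtoC (- N)))%C with (- (P (RtoC (- N)) - P (RtoC N)))%C by ring.
        rewrite <- E2, Rminus_0_r, RtoC_mult. ring. }
    rewrite Cmod_opp, Cmod_Ci_mult. assert (Hpi := PI_RGT_0).
    eapply Rle_trans; [apply (CI_norm_const _ (/ (PI * N)) 0 PI Hgc)|].
    - rewrite Rmin_left, Rmax_right by lra. intros t Ht.
      assert (X := f_equal Cmod (HE (g t))). rewrite !Cmod_mult, Cmod_Ci, !Cmod_R in X.
      rewrite (Rabs_right 2), (Rabs_right PI) in X by lra.
      assert (Hgn : Cmod (g t) = N).
      { unfold g, Cmod; simpl.
        replace (_ + _) with (N ^ 2 * (Rsqr (sin t) + Rsqr (cos t))) by (unfold Rsqr; simpl; ring).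
        rewrite sin2_cos2, Rmult_1_r. apply sqrt_pow2. lra. }
      rewrite Hgn in X.
      assert (Y : Cmod (cexp (Ci * RtoC tau * g t)) <= 1).
      { rewrite Cmod_cexp. apply Rle_trans with (exp 0); [|rewrite exp_0; lra]. apply exp_le.
        assert (Hs := sin_ge_0 t ltac:(lra) ltac:(lra)). assert (Htp := tau_pos D HD). fold tau in Htp.
        unfold g; simpl. assert (0 <= tau * (N * sin t)) by (apply Rmult_le_pos; [lra|apply Rmult_le_pos; lra]).
        lra. }
      assert (Y0 := Cmod_ge_0 (cexp (Ci * RtoC tau * g t))).
      assert (Z := Cmod_sub_le (cexp (Ci * RtoC tau * g t) * cexp (Ci * RtoC tau * g t)) 1).
      rewrite Cmod_1, Cmod_mult in Z.
      assert (HPN : 0 < PI * N) by (apply Rmult_lt_0_compat; lra).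
      apply Rmult_le_reg_l with (PI * N); [exact HPN|]. rewrite Rinv_r by lra. nra.
    - rewrite Rminus_0_r, Rabs_right by lra.
      replace (/ (PI * N) * PI) with (/ N) by (field; lra).
      rewrite <- (Rinv_inv eta). apply Rinv_le_contravar; [apply Rinv_0_lt_compat, He|exact HN2]. }
  assert (Hsum := sym_lim_plus _ _ _ _ Hcf (fun t => rcont_opp _ t Hcf) Hsym (sym_lim_reflect _ _ Hcf Hsym)).
  assert (H2 : (2 * Ci * RtoC PI)%C <> 0%C).
  { apply Cmult_neq_0; [apply Cmult_neq_0; [|apply Ci_nz]|apply CPI_neq_0]. intros X. injection X. lra. }
  assert (Hfin := sym_lim_scal (/ (2 * Ci * RtoC PI))%C _ _
    (fun t => rcont_plus _ _ t (Hcf t) (rcont_opp _ t Hcf)) Hsum).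
  replace (RtoC D) with (/ (2 * Ci * RtoC PI) * (Ci * RtoC (PI * D) + Ci * RtoC (PI * D)))%C.
  - eapply sym_lim_ext; [|exact Hfin]. intros t. cbv beta.
    replace (RtoC (- t)) with (- RtoC t)%C by (rewrite RtoC_opp; ring).
    rewrite Heven. field. split; [apply CPI_neq_0|apply Ci_nz].
  - rewrite RtoC_mult. field. split; [apply CPI_neq_0|apply Ci_nz].
Qed.

(** A shift by a complex [w] only moves the end points: the integral over [[-N, N]] changes by the
    integrals of [S^2] over two segments of length [|w|] at [N] and [-N], where [S] is [O(1/N)]. *)
Lemma sinc_sq_integral (w : C) :
  sym_lim (fun t => S (RtoC t - w) * S (RtoC t - w))%C (RtoC D).
Proof.
  set (g := fun z => (S z * S z)%C).
  assert (Hgd : forall z, cdiff g z) by (intros z; apply cdiff_mult; apply sincD_diff, HD).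
  assert (Hgc : forall z, ccont g z) by (intros z; apply cdiff_ccont, Hgd).
  destruct (primitive_punctured g 0 Hgc (fun z _ => Hgd z)) as [P HP].
  intros eta He. destruct (sinc_sq_integral_0 (eta / 2)) as [N1 HN1]; [lra|].
  set (W := exp (tau * Cmod w)). assert (HW : 0 < W) by apply exp_pos.
  assert (Hw := Cmod_ge_0 w). assert (Ht := tau_pos D HD). fold tau in Ht.
  (* Each end segment contributes at most [|w| (W / N)^2 = B / N^2], with [W] accounting for the
     distance from the real line. *)
  set (B := Cmod w * (W * W)). assert (HB : 0 <= B) by (apply Rmult_le_pos; [lra|nra]).
  exists (Rmax (Rmax N1 1) (Rmax (2 * Cmod w) (4 * B / eta))). intros N HN.
  assert (HNa : Rmax N1 1 <= N) by (eapply Rle_trans; [apply Rmax_l|exact HN]).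
  assert (HNb : Rmax (2 * Cmod w) (4 * B / eta) <= N) by (eapply Rle_trans; [apply Rmax_r|exact HN]).
  specialize (HN1 N (Rle_trans _ _ _ (Rmax_l _ _) HNa)).
  assert (HNc : 1 <= N) by (eapply Rle_trans; [apply Rmax_r|exact HNa]).
  assert (HNw : 2 * Cmod w <= N) by (eapply Rle_trans; [apply Rmax_l|exact HNb]).
  assert (HNe : 4 * B / eta <= N) by (eapply Rle_trans; [apply Rmax_r|exact HNb]).
  assert (E1 := CI_FTC_line P g 0 1 (- N) N HP Hgc). rewrite Cmult_1_r, !Cplus_0_l, !Cmult_1_r in E1.
  rewrite (CI_ext _ (fun t => g (0 + RtoC t * 1)%C)) in HN1 by (intros t; unfold g; do 2 f_equal; ring).
  rewrite E1 in HN1.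
  assert (E2 := CI_FTC_line P g (- w) 1 (- N) N HP Hgc). rewrite Cmult_1_r, !Cmult_1_r in E2.
  rewrite (CI_ext _ (fun t => g (- w + RtoC t * 1)%C)) by (intros t; unfold g; do 2 f_equal; ring).
  rewrite E2.
  assert (Hshift : forall x, Rabs x = N -> Cmod (P (- w + RtoC x)%C - P (RtoC x)) <= eta / 4).
  { intros x Hx.
    assert (E3 := CI_FTC_line P g (RtoC x) (- w) 0 1 HP Hgc).
    replace (RtoC x + 1 * - w)%C with (- w + RtoC x)%C in E3 by ring.
    replace (RtoC x + 0 * - w)%C with (RtoC x) in E3 by ring.
    rewrite <- E3, Cmod_mult, Cmod_opp.
    assert (X : Cmod (CI (fun t => g (RtoC x + RtoC t * - w)%C) 0 1) <= (W * / N) * (W * / N) * Rabs (1 - 0)).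
    { apply CI_norm_const.
      - intros t. apply (rcont_comp g); [apply Hgc|apply rcont_line].
      - rewrite Rmin_left, Rmax_right by lra. intros t Ht'.
        replace (RtoC x + RtoC t * - w)%C with (RtoC x - RtoC t * w)%C by ring.
        assert (Hsw := Cmod_scaled t w Ht').
        assert (Y := sinc_shift_bound x (RtoC t * w) ltac:(lra) ltac:(lra)). rewrite Hx in Y.
        assert (Z : Cmod (S (RtoC x - RtoC t * w)%C) <= W * / N).
        { eapply Rle_trans; [exact Y|]. apply Rmult_le_compat_r; [apply Rlt_le, Rinv_0_lt_compat; lra|].
          apply exp_le, Rmult_le_compat_l; lra. }
        unfold g. rewrite Cmod_mult. apply Rmult_le_compat; try apply Cmod_ge_0; assumption. }
    rewrite Rminus_0_r, Rabs_R1, Rmult_1_r in X.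
    apply Rle_trans with (W * / N * (W * / N) * Cmod w); [apply Rmult_le_compat_r; assumption|].
    apply Rle_div_l in HNe; [|lra].
    replace (W * / N * (W * / N) * Cmod w) with (B / (N * N)) by (unfold B; field; lra).
    apply Rle_div_l; [nra|]. nra. }
  assert (H1 := Hshift N ltac:(apply Rabs_right; lra)).
  assert (H2 := Hshift (- N) ltac:(rewrite Rabs_Ropp; apply Rabs_right; lra)).
  replace (P (- w + RtoC N) - P (- w + RtoC (- N)) - RtoC D)%C with
    ((P (RtoC N) - P (RtoC (- N)) - RtoC D) + (P (- w + RtoC N) - P (RtoC N))
      - (P (- w + RtoC (- N)) - P (RtoC (- N))))%C by ring.
  eapply Rle_trans; [apply Cmod_sub_le|].
  eapply Rle_trans; [apply Rplus_le_compat_r, Cmod_triangle|]. lra.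
Qed.

Section Reproduction.

Variable F : C -> C.
Hypothesis HF : in_HO D F.

Lemma HO_cdiff (z : C) : cdiff F z.
Proof. destruct HF as [H _]. destruct (H z) as [l Hl]. exists l. apply has_cderiv_is_derive, Hl. Qed.

Lemma HO_rcont (t : R) : rcont (fun t => F (RtoC t)) t.
Proof. apply (rcont_comp F); [apply cdiff_ccont, HO_cdiff|apply rcont_RtoC]. Qed.

Lemma HO_sq_ex (a b : R) : ex_RInt (fun x => Cmod (F (RtoC x)) ^ 2) a b.
Proof.
  apply (ex_RInt_continuous (V := R_CompleteNormedModule)). intros z _.
  apply continuous_ext with (f := fun x => mult (Cmod (F (RtoC x))) (Cmod (F (RtoC x)))).
  - intros x. unfold mult; simpl. ring.
  - apply (continuous_mult (K := R_AbsRing)); apply (rcont_Cmod (fun t => F (RtoC t))), HO_rcont.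
Qed.

Lemma HO_tails : tail_small (fun x => Cmod (F (RtoC x)) ^ 2) /\
  tail_small (fun x => Cmod (F (RtoC (- x)%R)) ^ 2).
Proof.
  destruct HF as [_ [_ [l Hl]]].
  exact (is_RInt_gen_tails (fun x => Cmod (F (RtoC x)) ^ 2) l HO_sq_ex Hl).
Qed.

(* AM-GM: [2 |F| c / x <= |F|^2 + c^2 / x^2] *)
Lemma HO_product_tails (h : R -> C) (c r : R) : 0 < r -> (forall t, rcont h t) ->
  (forall x, r <= Rabs x -> Cmod (h x) <= Cmod (F (RtoC x)) * (c * / Rabs x) + c * / (Rabs x) ^ 2) ->
  0 <= c -> tail_small (fun t => Cmod (h t)) /\ tail_small (fun t => Cmod (h (- t)%R)).
Proof.
  intros Hr Hh Hb Hc0.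
  assert (Hdom : forall x, r <= Rabs x ->
    Cmod (h x) <= Cmod (F (RtoC x)) ^ 2 + (c ^ 2 + c) * / (Rabs x) ^ 2).
  { intros x Hx. eapply Rle_trans; [apply Hb, Hx|].
    replace ((c ^ 2 + c) * / Rabs x ^ 2) with ((c * / Rabs x) ^ 2 + c * / Rabs x ^ 2) by (field; lra).
    set (u := Cmod (F (RtoC x))). set (v := c * / Rabs x).
    assert (0 <= u) by apply Cmod_ge_0.
    assert (0 <= v) by (apply Rmult_le_pos; [lra|apply Rlt_le, Rinv_0_lt_compat; lra]).
    nra. }
  assert (Hc2 : 0 <= c ^ 2 + c) by nra.
  destruct HO_tails as [T1 T2].
  assert (Hinv : forall a b, r <= a -> a <= b -> ex_RInt (fun t => (c ^ 2 + c) * / t ^ 2) a b).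
  { intros a b Ha Hab. eexists. apply RInt_inv_sq; lra. }
  assert (Hneg : forall a b, ex_RInt (fun x => Cmod (F (RtoC (- x)%R)) ^ 2) a b).
  { intros a b. apply (ex_RInt_continuous (V := R_CompleteNormedModule)). intros z _.
    apply continuous_ext with (f := fun x => mult (Cmod (F (RtoC (- x)%R))) (Cmod (F (RtoC (- x)%R)))).
    - intros x. unfold mult; simpl. ring.
    - apply (continuous_mult (K := R_AbsRing));
        apply (rcont_Cmod (fun t => F (RtoC (- t)%R))), (rcont_opp (fun t => F (RtoC t))), HO_rcont. }
  split.
  - apply tail_small_dom with (g := fun t => Cmod (F (RtoC t)) ^ 2 + (c ^ 2 + c) * / t ^ 2) (r := r).
    + exact Hh.
    + intros a b Ha Hab. apply (ex_RInt_plus (V := R_NormedModule)); [apply HO_sq_ex|apply Hinv; assumption].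
    + intros t Ht. assert (X := Hdom t). rewrite Rabs_right in X by lra. apply X, Ht.
    + apply tail_small_plus with (r := r); auto.
      * intros; apply HO_sq_ex.
      * apply tail_small_inv_sq, Hc2.
  - apply tail_small_dom with (g := fun t => Cmod (F (RtoC (- t)%R)) ^ 2 + (c ^ 2 + c) * / t ^ 2) (r := r).
    + intros t. apply rcont_opp, Hh.
    + intros a b Ha Hab. apply (ex_RInt_plus (V := R_NormedModule)); [apply Hneg|apply Hinv; assumption].
    + intros t Ht. assert (X := Hdom (- t)). rewrite Rabs_Ropp, Rabs_right in X by lra. apply X, Ht.
    + apply tail_small_plus with (r := r); auto. apply tail_small_inv_sq, Hc2.
Qed.

Lemma paley_wiener_reproducing (w : C) :
  sym_lim (fun t => F (RtoC t) * S (RtoC t - w))%C (F w).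
Proof.
  set (c := (F w * / RtoC D)%C).
  set (G := fun z => (F z - c * S (z - w))%C).
  assert (HDC : RtoC D <> 0%C) by (intros X; injection X; lra).
  assert (HGd : forall z, cdiff G z).
  { intros z. assert (X := HO_cdiff z). unfold G.
    apply cdiff_minus; [exact X|]. apply cdiff_mult; [cdiff_tac|]. apply S_cdiff. cdiff_tac. }
  assert (HG0 : G w = 0%C).
  { unfold G, c, S. replace (w - w)%C with (RtoC 0) by ring. rewrite sincD_0. field. exact HDC. }
  destruct (HGd w) as [l Hl].
  set (Q := dquot G w l).
  assert (HQd : forall z, z <> w -> cdiff Q z) by (intros z Hz; apply dquot_diff; [exact Hz|apply HGd]).
  assert (HQc : forall z, ccont Q z).
  { intros z. destruct (Ceq_dec z w) as [->|Hz]; [apply dquot_ccont; assumption|apply cdiff_ccont, HQd, Hz]. }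
  assert (HQm : forall z, (Q z * (z - w))%C = G z) by (intros z; apply dquot_mult, HG0).
  assert (Ht := tau_pos D HD). fold tau in Ht.
  assert (Hw := Cmod_ge_0 w). assert (Hcm := Cmod_ge_0 c).
  set (W := exp (tau * Cmod w)). assert (HW : 0 < W) by apply exp_pos.
  (* For [|z| >= |w| + 1] dividing by [z - w] does not increase the modulus, so the bound for [G]
     suffices. *)
  assert (HQg : growth_le Q tau).
  { intros eps He. destruct HF as [_ [Hexp _]]. destruct (Hexp eps He) as [M HM].
    assert (HM0 : 0 <= M).
    { assert (X := HM 0%C). rewrite Cmod_0, Rmult_0_r, exp_0 in X. assert (Y := Cmod_ge_0 (F 0%C)). lra. }
    exists (M + Cmod c * (D * W)), (Cmod w + 1). split.
    { assert (0 <= Cmod c * (D * W)) by (apply Rmult_le_pos; [lra|nra]). lra. }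
    intros z Hz.
    assert (Hzw : 1 <= Cmod (z - w)) by (assert (X := Cmod_sub_ge z w); lra).
    apply Rle_trans with (Cmod (G z)).
    { rewrite <- HQm, Cmod_mult. assert (X := Cmod_ge_0 (Q z)). nra. }
    unfold G. eapply Rle_trans; [apply Cmod_sub_le|]. rewrite Rmult_plus_distr_r.
    apply Rplus_le_compat; [apply HM|]. rewrite Cmod_mult, Rmult_assoc.
    apply Rmult_le_compat_l; [exact Hcm|].
    eapply Rle_trans; [apply sincD_bound, HD|]. fold tau. rewrite Rmult_assoc.
    apply Rmult_le_compat_l; [lra|]. unfold W. rewrite <- exp_plus. apply exp_le.
    assert (X := Cmod_sub_le z w). assert (Y := Cmod_ge_0 z). nra. }
  set (r := Rmax 1 (2 * Cmod w)).
  assert (Hr1 : 1 <= r) by apply Rmax_l. assert (Hrw : 2 * Cmod w <= r) by apply Rmax_r.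
  assert (HQr : forall t, rcont (fun t => Q (RtoC t)) t)
    by (intros t; apply (rcont_comp Q); [apply HQc|apply rcont_RtoC]).
  (* One constant serves for both terms, as [HO_product_tails] expects; its factors 2 come from
     [|x - w| >= |x| / 2]. *)
  assert (HQb : forall x, r <= Rabs x -> Cmod (Q (RtoC x)) <=
    Cmod (F (RtoC x)) * ((2 + 2 * (Cmod c * W)) * / Rabs x) + (2 + 2 * (Cmod c * W)) * / Rabs x ^ 2).
  { intros x Hx.
    assert (HcW : 0 <= Cmod c * W) by (apply Rmult_le_pos; lra).
    assert (Hxw : Rabs x / 2 <= Cmod (RtoC x - w)).
    { assert (X := Cmod_sub_ge (RtoC x) w). rewrite Cmod_R in X. lra. }
    assert (HG : Cmod (G (RtoC x)) <= Cmod (F (RtoC x)) + Cmod c * (W * / Rabs x)).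
    { unfold G. eapply Rle_trans; [apply Cmod_sub_le|]. apply Rplus_le_compat_l. rewrite Cmod_mult.
      apply Rmult_le_compat_l; [exact Hcm|]. apply sinc_shift_bound; lra. }
    rewrite <- HQm, Cmod_mult in HG.
    assert (HQ0 := Cmod_ge_0 (Q (RtoC x))). assert (HF0 := Cmod_ge_0 (F (RtoC x))).
    assert (Hi : 0 < / Rabs x) by (apply Rinv_0_lt_compat; lra).
    assert (HQ : Cmod (Q (RtoC x)) <= (Cmod (F (RtoC x)) + Cmod c * (W * / Rabs x)) * (2 * / Rabs x)).
    { apply Rmult_le_reg_r with (Rabs x / 2); [lra|].
      replace ((Cmod (F (RtoC x)) + Cmod c * (W * / Rabs x)) * (2 * / Rabs x) * (Rabs x / 2))
        with (Cmod (F (RtoC x)) + Cmod c * (W * / Rabs x)) by (field; lra).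
      eapply Rle_trans; [|exact HG]. apply Rmult_le_compat_l; assumption. }
    eapply Rle_trans; [exact HQ|].
    replace (/ Rabs x ^ 2) with (/ Rabs x * / Rabs x) by (field; lra).
    set (i := / Rabs x) in *. set (u := Cmod (F (RtoC x))) in *. set (v := Cmod c * W) in *.
    replace ((u + Cmod c * (W * i)) * (2 * i)) with (2 * (u * i) + 2 * v * (i * i)) by (unfold v; ring).
    replace (u * ((2 + 2 * v) * i) + (2 + 2 * v) * (i * i)) with
      (2 * (u * i) + 2 * v * (i * i) + 2 * v * (u * i) + 2 * (i * i)) by ring.
    assert (0 <= u * i) by (apply Rmult_le_pos; lra). assert (0 <= i * i) by (apply Rmult_le_pos; lra).
    assert (0 <= v * (u * i)) by (apply Rmult_le_pos; assumption). lra. }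
  assert (HcW : 0 <= Cmod c * W) by (apply Rmult_le_pos; lra).
  destruct (HO_product_tails (fun t => Q (RtoC t)) (2 + 2 * (Cmod c * W)) r) as [T1 T2];
    [lra|exact HQr|exact HQb|lra|].
  assert (V1 := vanishing_sym_lim _ (vanishing_at_type Q w tau HQc HQd Ht HQg T1 T2)).
  (* The lower half-plane for [Q] is the upper one for [Q(-z)]; reflecting the integral back yields
     the frequency [- tau]. *)
  set (Qm := fun z => Q (- (1) * z)%C).
  assert (HQmE : forall t : R, Qm (RtoC t) = Q (RtoC (- t)%R)).
  { intros t. unfold Qm. f_equal. rewrite RtoC_opp. ring. }
  assert (V2 : sym_lim (fun t => Qm (RtoC t) * cexp (Ci * RtoC tau * RtoC t))%C 0).
  { apply vanishing_sym_lim. apply (vanishing_at_type Qm (- w) tau).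
    - intros z. apply (ccont_comp Q); [apply HQc|]. apply cdiff_ccont. cdiff_tac.
    - intros z Hz. apply (cdiff_comp Q (fun z => - (1) * z)%C); [|cdiff_tac]. apply HQd.
      intros X. apply Hz. rewrite <- X. ring.
    - exact Ht.
    - intros eps He. destruct (HQg eps He) as [M [r0 [HM0 HM]]]. exists M, r0. split; [exact HM0|].
      intros z Hz. assert (X : Cmod (- (1) * z) = Cmod z) by (rewrite Cmod_mult, Cmod_m1; ring).
      unfold Qm. rewrite <- X in Hz |- *. apply HM, Hz.
    - apply (tail_small_ext (fun t => Cmod (Q (RtoC (- t)%R)))); [|exact T2].
      intros t. now rewrite HQmE.
    - apply (tail_small_ext (fun t => Cmod (Q (RtoC t)))); [|exact T1].
      intros t. rewrite HQmE. now rewrite Ropp_involutive. }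
  assert (Hec : forall s t, rcont (fun t => cexp (s * RtoC t)) t).
  { intros s t. apply (rcont_comp (fun z => cexp (s * z))); [|apply rcont_RtoC]. apply cdiff_ccont. cdiff_tac. }
  apply sym_lim_reflect in V2.
  2:{ intros t. apply rcont_mult; [|apply Hec]. apply rcont_ext with (f := fun t => Q (RtoC (- t)%R)).
      - intros u. now rewrite HQmE.
      - apply (rcont_opp (fun t => Q (RtoC t))), HQr. }
  assert (V2' : sym_lim (fun t => Q (RtoC t) * cexp (- (Ci * RtoC tau) * RtoC t))%C 0).
  { eapply sym_lim_ext; [|exact V2]. intros t. cbv beta. rewrite HQmE, Ropp_involutive. do 2 f_equal.
    rewrite RtoC_opp. ring. }
  (* Pointwise, [F(t) S(t - w) = G(t) S(t - w) + c S(t - w)^2], and the first term equals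
     [Q(t) sin(tau (t - w)) / PI]. The coefficients of [L1] and [L2] write this sine through
     [exp(i tau t)] and [exp(-i tau t)], with the shift by [w] moved into constants. *)
  set (k := (/ (2 * Ci * RtoC PI))%C).
  assert (L1 := sym_lim_scal (k * cexp (- (Ci * RtoC tau * w))) _ _
     (fun t => rcont_mult _ _ t (HQr t) (Hec (Ci * RtoC tau)%C t)) V1).
  assert (L2 := sym_lim_scal (- k * cexp (Ci * RtoC tau * w)) _ _
     (fun t => rcont_mult _ _ t (HQr t) (Hec (- (Ci * RtoC tau))%C t)) V2').
  assert (HSS : forall t, rcont (fun t => S (RtoC t - w) * S (RtoC t - w))%C t)
    by (intros t; apply rcont_mult; apply rcont_S_shift).
  assert (L3 := sym_lim_scal c _ _ HSS (sinc_sq_integral w)).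
  assert (L12 := sym_lim_plus _ _ _ _
    (fun t => rcont_mult _ _ t (rcont_const _ t) (rcont_mult _ _ t (HQr t) (Hec (Ci * RtoC tau)%C t)))
    (fun t => rcont_mult _ _ t (rcont_const _ t) (rcont_mult _ _ t (HQr t) (Hec (- (Ci * RtoC tau))%C t)))
    L1 L2).
  assert (L := sym_lim_plus _ _ _ _
    (fun t => rcont_plus _ _ t
      (rcont_mult _ _ t (rcont_const _ t) (rcont_mult _ _ t (HQr t) (Hec (Ci * RtoC tau)%C t)))
      (rcont_mult _ _ t (rcont_const _ t) (rcont_mult _ _ t (HQr t) (Hec (- (Ci * RtoC tau))%C t))))
    (fun t => rcont_mult _ _ t (rcont_const _ t) (HSS t)) L12 L3).
  replace (F w) with (k * cexp (- (Ci * RtoC tau * w)) * 0 + - k * cexp (Ci * RtoC tau * w) * 0 + c * RtoC D)%C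
    by (unfold c; field; exact HDC).
  eapply sym_lim_ext; [|exact L]. intros t. cbv beta.
  assert (X := csin_cexp (RtoC tau * (RtoC t - w))). unfold tau in X at 1. rewrite csin_sincD in X. fold S in X.
  replace (Ci * (RtoC tau * (RtoC t - w)))%C with (- (Ci * RtoC tau * w) + Ci * RtoC tau * RtoC t)%C in X by ring.
  replace (- (- (Ci * RtoC tau * w) + Ci * RtoC tau * RtoC t))%C
    with (Ci * RtoC tau * w + - (Ci * RtoC tau) * RtoC t)%C in X by ring.
  rewrite !cexp_plus in X.
  transitivity (k * Q (RtoC t) * (cexp (- (Ci * RtoC tau * w)) * cexp (Ci * RtoC tau * RtoC t)
      - cexp (Ci * RtoC tau * w) * cexp (- (Ci * RtoC tau) * RtoC t)) + c * (S (RtoC t - w) * S (RtoC t - w)))%C; [ring|].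
  rewrite <- X.
  transitivity (k * (2 * Ci * RtoC PI) * (Q (RtoC t) * (RtoC t - w)) * S (RtoC t - w)
     + c * (S (RtoC t - w) * S (RtoC t - w)))%C; [ring|].
  rewrite HQm. unfold G, k. field. split; [apply CPI_neq_0|apply Ci_nz].
Qed.

End Reproduction.

End Kernel.

(** * The kernel *)

Lemma Cconj_RtoC (r : R) : Cconj (RtoC r) = RtoC r.
Proof. apply injective_projections; simpl; ring. Qed.

(** Hermitian symmetry. For real [x] it rewrites the conjugated kernel as [KO_formula D x w], an
    expression in sincs without conjugates; it is also what drives uniqueness. *)
Lemma KO_conj (D : R) (w z : C) : Cconj (KO_formula D z w) = KO_formula D w z.
Proof.
  unfold KO_formula.
  rewrite Cminus_conj, !Cmult_conj, <- !sincD_conj, Cminus_conj, !Cconj_conj, Cconj_RtoC.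
  replace (Cconj w - z)%C with (- (z - Cconj w))%C by ring. rewrite sincD_opp. ring.
Qed.

Section KernelSpace.

Variable D : R.
Hypothesis HD : 0 < D.
Let tau := PI * D.

Lemma KO_cdiff (w z : C) : cdiff (KO_formula D w) z.
Proof.
  unfold KO_formula. apply cdiff_minus.
  - apply (S_cdiff D HD). cdiff_tac.
  - apply cdiff_mult; [|cdiff_tac]. apply cdiff_mult; [cdiff_tac|]. apply sincD_diff, HD.
Qed.

Lemma KO_rcont (w : C) (t : R) : rcont (fun t => KO_formula D w (RtoC t)) t.
Proof. apply (rcont_comp (KO_formula D w)); [apply cdiff_ccont, KO_cdiff|apply rcont_RtoC]. Qed.

(** Decay of order [1/|x|] gives both square integrability of the kernel and, against any [F] of the
    space, absolute convergence of the inner product. *)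
Lemma KO_decay (w : C) : exists c r, 0 <= c /\ 1 <= r /\
  forall x, r <= Rabs x -> Cmod (KO_formula D w (RtoC x)) <= c * / Rabs x.
Proof.
  set (k := RtoC (/ (2 + D))). set (v := sincD D (Cconj w)).
  exists (exp (tau * Cmod w) + Cmod k * Cmod v), (Rmax 1 (2 * Cmod w)).
  assert (Hkv : 0 <= Cmod k * Cmod v) by (apply Rmult_le_pos; apply Cmod_ge_0).
  assert (He := exp_pos (tau * Cmod w)).
  split; [lra|]. split; [apply Rmax_l|]. intros x Hx.
  assert (Hx1 : 1 <= Rabs x) by (eapply Rle_trans; [apply Rmax_l|exact Hx]).
  assert (Hx2 : 2 * Cmod w <= Rabs x) by (eapply Rle_trans; [apply Rmax_r|exact Hx]).
  assert (B1 := sinc_shift_bound D HD x (Cconj w) ltac:(lra) ltac:(rewrite Cmod_conj; lra)).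
  rewrite Cmod_conj in B1. fold tau in B1.
  assert (B2 := sinc_shift_bound D HD x 0 ltac:(lra) ltac:(rewrite Cmod_0; lra)).
  rewrite Cmod_0, Rmult_0_r, exp_0 in B2. replace (RtoC x - 0)%C with (RtoC x) in B2 by ring.
  unfold KO_formula. fold k v. eapply Rle_trans; [apply Cmod_sub_le|]. rewrite Rmult_plus_distr_r.
  apply Rplus_le_compat; [exact B1|]. rewrite !Cmod_mult.
  replace (Cmod k * Cmod (sincD D (RtoC x)) * Cmod v) with (Cmod k * Cmod v * Cmod (sincD D (RtoC x))) by ring.
  apply Rmult_le_compat_l; lra.
Qed.

Lemma KO_exp_type (w : C) : exp_type_le (KO_formula D w) tau.
Proof.
  intros eps He. assert (Ht := tau_pos D HD). fold tau in Ht.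
  set (k := RtoC (/ (2 + D))). set (v := sincD D (Cconj w)).
  exists (D * exp (tau * Cmod w) + Cmod k * D * Cmod v). intros z.
  assert (Hz := Cmod_ge_0 z).
  assert (Hez : exp (tau * Cmod z) <= exp ((tau + eps) * Cmod z)) by (apply exp_le; nra).
  unfold KO_formula. fold k v. eapply Rle_trans; [apply Cmod_sub_le|]. rewrite Rmult_plus_distr_r.
  apply Rplus_le_compat.
  - eapply Rle_trans; [apply sincD_bound, HD|]. fold tau. rewrite Rmult_assoc.
    apply Rmult_le_compat_l; [lra|]. rewrite <- exp_plus. apply exp_le.
    assert (X := Cmod_sub_le z (Cconj w)). rewrite Cmod_conj in X. nra.
  - rewrite !Cmod_mult.
    replace (Cmod k * D * Cmod v * exp ((tau + eps) * Cmod z))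
      with (Cmod k * (D * exp ((tau + eps) * Cmod z)) * Cmod v) by ring.
    apply Rmult_le_compat_r; [apply Cmod_ge_0|]. apply Rmult_le_compat_l; [apply Cmod_ge_0|].
    eapply Rle_trans; [apply sincD_bound, HD|]. fold tau. apply Rmult_le_compat_l; lra.
Qed.

Lemma KO_in_HO (w : C) : in_HO D (KO_formula D w).
Proof.
  split; [|split].
  - intros z. destruct (KO_cdiff w z) as [l Hl]. exists l. apply has_cderiv_is_derive, Hl.
  - apply KO_exp_type.
  - destruct (KO_decay w) as [c [r [Hc [Hr Hb]]]].
    set (h := fun t : R => (KO_formula D w (RtoC t) * KO_formula D w (RtoC t))%C).
    assert (Hh : forall t, rcont h t) by (intros t; apply rcont_mult; apply KO_rcont).
    assert (Hsq : forall x, Cmod (h x) = Cmod (KO_formula D w (RtoC x)) ^ 2)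
      by (intros x; unfold h; rewrite Cmod_mult; ring).
    apply (ex_RInt_gen_ext_eq (V := R_NormedModule) (fun t => Cmod (h t)) _ Hsq).
    assert (Hhb : forall x, r <= Rabs x -> Cmod (h x) <= c ^ 2 * / Rabs x ^ 2).
    { intros x Hx. unfold h. rewrite Cmod_mult. specialize (Hb x Hx).
      replace (c ^ 2 * / Rabs x ^ 2) with (c * / Rabs x * (c * / Rabs x)) by (field; lra).
      apply Rmult_le_compat; try apply Cmod_ge_0; exact Hb. }
    assert (Hinv : forall a b, r <= a -> a <= b -> ex_RInt (fun t => c ^ 2 * / t ^ 2) a b).
    { intros a b Ha Hab. eexists. apply RInt_inv_sq; lra. }
    apply tails_ex_RInt_gen.
    + intros a b. apply ex_RInt_Cmod, Hh.
    + intros t. apply Cmod_ge_0.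
    + apply tail_small_dom with (g := fun t => c ^ 2 * / t ^ 2) (r := r); auto.
      * intros t Ht. assert (X := Hhb t). rewrite Rabs_right in X by lra. apply X, Ht.
      * apply tail_small_inv_sq, pow_le, Hc.
    + apply (tail_small_dom (fun t => h (- t)%R) (fun t => c ^ 2 * / t ^ 2) r); auto.
      * intros t. apply rcont_opp, Hh.
      * intros t Ht. assert (X := Hhb (- t)). rewrite Rabs_Ropp, Rabs_right in X by lra. apply X, Ht.
      * apply tail_small_inv_sq, pow_le, Hc.
Qed.

(** On the real line the conjugated kernel is [S(x - w) - S(w) S(x) / (2 + D)]; the Paley-Wiener
    identity at [w] and at 0 evaluates the two terms. *)
Lemma KO_sym_lim (F : C -> C) (w : C) : in_HO D F ->
  sym_lim (fun t => F (RtoC t) * Cconj (KO_formula D w (RtoC t)))%C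
    (F w - RtoC (/ (2 + D)) * sincD D w * F 0%C).
Proof.
  intros HF.
  assert (L1 := paley_wiener_reproducing D HD F HF w).
  assert (L2 := paley_wiener_reproducing D HD F HF 0).
  set (k := (- (RtoC (/ (2 + D)) * sincD D w))%C).
  assert (Hc : forall v t, rcont (fun t => F (RtoC t) * sincD D (RtoC t - v))%C t).
  { intros v t. apply rcont_mult; [apply (HO_rcont D F HF)|apply (rcont_S_shift D HD)]. }
  assert (L3 := sym_lim_scal k _ _ (Hc 0%C) L2).
  assert (L := sym_lim_plus _ _ _ _ (Hc w) (fun t => rcont_mult _ _ t (rcont_const k t) (Hc 0%C t)) L1 L3).
  replace (F w - RtoC (/ (2 + D)) * sincD D w * F 0%C)%C with (F w + k * F 0%C)%C by (unfold k; ring).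
  eapply sym_lim_ext; [|exact L]. intros t. cbv beta. rewrite KO_conj. unfold KO_formula.
  rewrite Cconj_RtoC. replace (RtoC t - 0)%C with (RtoC t) by ring.
  replace (w - RtoC t)%C with (- (RtoC t - w))%C by ring. rewrite sincD_opp. unfold k. ring.
Qed.

(** Stated as convergence rather than as values of [int_R], because uniqueness needs to transfer it
    to the inner product with swapped arguments. *)
Lemma KO_integrals (F : C -> C) (w : C) : in_HO D F ->
  let l := (F w - RtoC (/ (2 + D)) * sincD D w * F 0%C)%C in
  is_RInt_gen (fun x => Re (F (RtoC x) * Cconj (KO_formula D w (RtoC x))))
    (Rbar_locally m_infty) (Rbar_locally p_infty) (Re l) /\
  is_RInt_gen (fun x => Im (F (RtoC x) * Cconj (KO_formula D w (RtoC x))))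
    (Rbar_locally m_infty) (Rbar_locally p_infty) (Im l).
Proof.
  intros HF l. set (h := fun t : R => (F (RtoC t) * Cconj (KO_formula D w (RtoC t)))%C).
  assert (Hh : forall t, rcont h t).
  { intros t. apply rcont_ext with (f := fun t => (F (RtoC t) * KO_formula D (RtoC t) w)%C).
    - intros u. unfold h. now rewrite KO_conj.
    - apply rcont_mult; [apply (HO_rcont D F HF)|]. intros eps He.
      destruct (KO_rcont w t eps He) as [d [Hd H]]. exists d; split; [exact Hd|]. intros s Hs.
      rewrite <- (KO_conj D (RtoC s)), <- (KO_conj D (RtoC t)), <- Cminus_conj, Cmod_conj. apply H, Hs. }
  destruct (KO_decay w) as [c [r [Hc [Hr Hb]]]].
  destruct (HO_product_tails D F HF h c r) as [T1 T2]; [lra|exact Hh| |exact Hc|].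
  - intros x Hx. unfold h. rewrite Cmod_mult, Cmod_conj.
    assert (X : Cmod (F (RtoC x)) * Cmod (KO_formula D w (RtoC x)) <= Cmod (F (RtoC x)) * (c * / Rabs x))
      by (apply Rmult_le_compat_l; [apply Cmod_ge_0|apply Hb, Hx]).
    assert (0 <= c * / Rabs x ^ 2).
    { apply Rmult_le_pos; [exact Hc|]. apply Rlt_le, Rinv_0_lt_compat, pow_lt. lra. }
    lra.
  - apply (sym_lim_gen h l Hh T1 T2). apply KO_sym_lim, HF.
Qed.

(** Origin of the coefficient: with [a] in place of [1 / (2 + D)], the integral loses [a S(w) F(0)]
    and the point mass adds [(1 - a D) S(w) F(0) / 2]. These cancel exactly when [a (2 + D) = 1]. *)
Lemma KO_inner (F : C -> C) (w : C) : in_HO D F -> inner_O F (KO_formula D w) = F w.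
Proof.
  intros HF. destruct (KO_integrals F w HF) as [H1 H2].
  unfold inner_O, int_R.
  rewrite (is_RInt_gen_unique (V := R_CompleteNormedModule) _ _ H1).
  rewrite (is_RInt_gen_unique (V := R_CompleteNormedModule) _ _ H2).
  rewrite KO_conj. unfold KO_formula. rewrite Cconj_RtoC, sincD_0.
  replace (w - 0)%C with w by ring.
  set (l := (F w - RtoC (/ (2 + D)) * sincD D w * F 0%C)%C).
  replace (Re l, Im l) with l by (destruct l; reflexivity). unfold l.
  rewrite !RtoC_inv, RtoC_plus by lra.
  assert (H2D : (2 + RtoC D)%C <> 0%C) by (rewrite <- RtoC_plus; intros X; injection X; lra).
  field. exact H2D.
Qed.

End KernelSpace.

(* K_{O,pi Delta} is the unique reproducing kernel; we state that the formula
   is a reproducing kernel and that every reproducing kernel equals it. *)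
Theorem theorem4 (Delta : R) (hD : 0 < Delta) :
  is_repr_kernel_O Delta (KO_formula Delta) /\
  (forall K : C -> C -> C, is_repr_kernel_O Delta K ->
     forall w z : C, K w z = KO_formula Delta w z).
Proof.
  split.
  - intros w. split; [apply KO_in_HO, hD|]. intros F HF. symmetry. apply KO_inner; assumption.
  - intros K HK w z. destruct (HK w) as [HKw HKrep].
    (* [K w z] is the inner product of [K w] with the formula at [z], while [KO_formula w z] is the
       conjugate of the formula at [z] evaluated at [w], which [K] expresses as the inner product in
       the opposite order. It remains to show conjugate symmetry for this pair. *)
    rewrite <- KO_conj, (HKrep _ (KO_in_HO Delta hD z)), <- (KO_inner Delta hD (K w) z HKw).
    destruct (KO_integrals Delta hD (K w) z HKw) as [H1 H2].
    set (l := (K w z - RtoC (/ (2 + Delta)) * sincD Delta z * K w 0%C)%C) in *.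
    unfold inner_O, int_R.
    rewrite (is_RInt_gen_unique (V := R_CompleteNormedModule) _ _ H1).
    rewrite (is_RInt_gen_unique (V := R_CompleteNormedModule) _ _ H2).
    (* Swapping the arguments keeps the real part and negates the imaginary part, so the swapped
       integrals converge because the original ones do. *)
    assert (Hre : forall u v : C, Re (u * Cconj v) = Re (v * Cconj u))
      by (intros u v; rewrite !re_mult, !re_conj, !im_conj; ring).
    assert (Him : forall u v : C, opp (Im (u * Cconj v)) = Im (v * Cconj u))
      by (intros u v; rewrite !im_mult, !re_conj, !im_conj; unfold opp; simpl; ring).
    assert (E1 : RInt_gen (fun x => Re (KO_formula Delta z (RtoC x) * Cconj (K w (RtoC x))))
       (Rbar_locally m_infty) (Rbar_locally p_infty) = Re l).
    { apply (is_RInt_gen_unique (V := R_CompleteNormedModule)).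
      eapply is_RInt_gen_ext; [|exact H1]. apply filter_forall. intros ab x _. apply Hre. }
    assert (E2 : RInt_gen (fun x => Im (KO_formula Delta z (RtoC x) * Cconj (K w (RtoC x))))
       (Rbar_locally m_infty) (Rbar_locally p_infty) = opp (Im l)).
    { apply (is_RInt_gen_unique (V := R_CompleteNormedModule)).
      eapply is_RInt_gen_ext; [|exact (is_RInt_gen_opp (V := R_NormedModule) _ _ H2)].
      apply filter_forall. intros ab x _. apply Him. }
    rewrite E1, E2, Cplus_conj, !Cmult_conj, Cconj_conj, Cconj_RtoC.
    match goal with |- (?u + ?a)%C = (?v + ?b)%C =>
      replace v with u by (apply injective_projections; unfold opp; simpl; ring) end.
    ring.
Qed.
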